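(* Let $u$, $\bar u$, $\widehat u$ be the solutions of SSM, MSM and DSM respectively (defined in the context). Assume that $u_0=u(0)$, $\bar u_0=\bar u(0)$ and $\widehat u_0=\widehat u(0)$ are identically distributed Gaussian random variables, that $u_0$ is independent of $\gamma_0=\gamma(0)$, and that $\widehat u_0$ is independent of $\widehat\gamma_0=\widehat\gamma(0)$, where $\widehat\gamma_0$ is Gaussian. If $$\bar\gamma=\mu=\bar\gamma_\infty:=\frac{\lambda_-\gamma_++\lambda_+\gamma_-}{\lambda_-+\lambda_+},$$ then, for every fixed $T>0$, as $\epsilon\to0$ the mean and variance of $u_T=u(T)$ converge to the mean and variance of $\bar u_T=\bar u(T)$, and the mean and variance of $\widehat u_T=\widehat u(T)$ converge to the mean and variance of $\bar u_T$.
   Context: All processes are real-valued. Fixed parameters: $\gamma_+>0>\gamma_-$, $\lambda_\pm>0$, $\sigma_u$, $\nu>0$, $\sigma$, $\mu,\bar\gamma\in\mathbb R$; the scale parameter is $\epsilon>0$. The laws of all initial conditions do not depend on $\epsilon$. $B_u$ and $B_\gamma$ are independent standard Brownian motions, independent of the initial conditions (and $B_u$ is independent of the switching process $\gamma$). SSM (switching stochastic model): $du=-\gamma u\,dt+\sigma_u\,dB_u$, where $\gamma(t)$ is a continuous-time Markov chain on $\{\gamma_+,\gamma_-\}$ that jumps from $\gamma_+$ to $\gamma_-$ at rate $\lambda_+/\epsilon$ and from $\gamma_-$ to $\gamma_+$ at rate $\lambda_-/\epsilon$. Independence of $u_0$ and $\gamma_0$ is understood so that $u_0$ is independent of the whole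 path of $\gamma$. MSM (mean stochastic model): $d\bar u=-\bar\gamma\,\bar u\,dt+\sigma_u\,dB_u$ with $\bar\gamma$ a constant. DSM (diffusive stochastic model): $d\widehat u=-\widehat\gamma\,\widehat u\,dt+\sigma_u\,dB_u$, $\ d\widehat\gamma=-\frac{\nu}{\epsilon}(\widehat\gamma-\mu)\,dt+\frac{\sigma}{\sqrt\epsilon}\,dB_\gamma$. *)

(* Defs.v *)
From mathcomp Require Import all_boot all_order all_algebra finmap.
From mathcomp Require Import all_classical all_reals all_analysis.

Set Implicit Arguments.
Unset Strict Implicit.
Unset Printing Implicit Defensive.

Import Order.TTheory GRing.Theory Num.Theory.
Import numFieldNormedType.Exports.

Local Open Scope classical_set_scope.
Local Open Scope ring_scope.

(* A real-valued process is a function [X : R -> Om -> R], [X t w] being the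
   value at time [t]; only the times [0 <= t] are ever constrained. *)

Section laws_and_independence.
Context {d : measure_display} {Om : measurableType d} {R : realType}.
Variable P : probability Om R.

Definition has_law (X : Om -> R) (nu : set R -> \bar R) : Prop :=
  measurable_fun setT X /\
  forall A : set R, measurable A -> P (X @^-1` A) = nu A.

(* Normal law with mean [m] and variance [s ^+ 2]. The library's [normal_prob]
   is the uniform law on [0, 1] when [s = 0]; here it is the point mass. *)
Definition gaussian (m s : R) : set R -> \bar R :=
  if s == 0 then fun A => \d_m A else normal_prob m s.

Definition sigma_rv (X : Om -> R) : set (set Om) :=
  preimage_set_system setT X measurable.

Definition sigma_path (X : R -> Om -> R) : set (set Om) :=
  <<s \bigcup_(t in [set t : R | 0 <= t]) sigma_rv (X t) >>.

Definition mutually_independent (I : finType) (F : I -> set (set Om)) : Prop :=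
  forall (J : {set I}) (A : I -> set Om), (forall i, i \in J -> F i (A i)) ->
    P (\bigcap_(i in [set` J]) A i) = (\prod_(i in J) P (A i))%E.

End laws_and_independence.

Section processes.
Context {d : measure_display} {Om : measurableType d} {R : realType}.
Variable P : probability Om R.

Record brownian_motion (B : R -> Om -> R) : Prop := {
  bm_measurable : forall t, 0 <= t -> measurable_fun setT (B t) ;
  bm_start : \forall w \ae P, B 0 w = 0 ;
  bm_increment : forall s t, 0 <= s -> s <= t ->
    has_law P (B t \- B s) (gaussian 0 (Num.sqrt (t - s))) ;
  bm_independent : forall (n : nat) (t : nat -> R),
    0 <= t 0%N -> (forall k, t k <= t k.+1) ->
    mutually_independent P (fun i : 'I_n => sigma_rv (B (t i.+1) \- B (t i))) ;
  bm_continuous :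
    \forall w \ae P, {within [set t : R | 0 <= t], continuous (B ^~ w)} }.

(* Standard transition function on the finite state space [S], with jump rate
   [q i j] from [i] to [j] for [i != j]; the diagonal of [q] is not used. *)
Record transition_function (S : {fset R}) (q : R -> R -> R)
    (p : R -> R -> R -> R) : Prop := {
  tf_ge0 : forall t i j, 0 <= t -> i \in S -> j \in S -> 0 <= p t i j ;
  tf_sum : forall t i, 0 <= t -> i \in S -> \sum_(j <- S) p t i j = 1 ;
  tf_zero : forall i j, i \in S -> j \in S -> p 0 i j = (i == j)%:R ;
  tf_chapman : forall s t i j, 0 <= s -> 0 <= t -> i \in S -> j \in S ->
    p (s + t) i j = \sum_(k <- S) p s i k * p t k j ;
  tf_rate : forall i j, i \in S -> j \in S -> i != j ->
    p h i j / h @[h --> 0^'+] --> q i j }.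

Record markov_chain (S : {fset R}) (q : R -> R -> R) (X : R -> Om -> R)
    : Prop := {
  mc_measurable : forall t, 0 <= t -> measurable_fun setT (X t) ;
  mc_state : forall t w, 0 <= t -> X t w \in S ;
  mc_right_continuous : \forall w \ae P,
    forall t, 0 <= t -> X s w @[s --> t^'+] --> X t w ;
  mc_markov : exists2 p, transition_function S q p &
    forall (n : nat) (t x : nat -> R) (h j : R),
      0 <= t 0%N -> (forall k, t k <= t k.+1) -> 0 <= h ->
      x n \in S -> j \in S ->
      let past := [set w | forall k, (k <= n)%N -> X (t k) w = x k] in
      (P (past `&` [set w | X (t n + h)%R w = j]) =
       P past * (p h (x n) j)%:E)%E }.

(* [dX = f dt + s dB]. The noise is additive, so the stochastic integral of the
   constant [s] is [s * (B t - B 0)] and the equation is meant pathwise. *)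
Record additive_sde (f : R -> Om -> R) (s : R) (B X : R -> Om -> R) : Prop := {
  sde_measurable : forall t, 0 <= t -> measurable_fun setT (X t) ;
  sde_continuous :
    \forall w \ae P, {within [set t : R | 0 <= t], continuous (X ^~ w)} ;
  sde_equation : \forall w \ae P, forall t, 0 <= t ->
    lebesgue_measure.-integrable `[0, t] (fun r => (f r w)%:E) /\
    X t w = X 0 w + \int[lebesgue_measure]_(r in `[0, t]) f r w
            + s * (B t w - B 0 w) }.

Record SSM (gp gm lp lm su eps : R) (B g u : R -> Om -> R) : Prop := {
  ssm_noise : brownian_motion B ;
  ssm_switching : markov_chain [fset gp; gm]%fset
    (fun i _ => (if i == gp then lp else lm) / eps) g ;
  ssm_equation : additive_sde (fun t w => - g t w * u t w) su B u }.

Record MSM (gbar su : R) (B u : R -> Om -> R) : Prop := {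
  msm_noise : brownian_motion B ;
  msm_equation : additive_sde (fun t w => - gbar * u t w) su B u }.

Record DSM (nu mu sg su eps : R) (Bu Bg g u : R -> Om -> R) : Prop := {
  dsm_noise_u : brownian_motion Bu ;
  dsm_noise_g : brownian_motion Bg ;
  dsm_damping : additive_sde (fun t w => - (nu / eps) * (g t w - mu))
    (sg / Num.sqrt eps) Bg g ;
  dsm_equation : additive_sde (fun t w => - g t w * u t w) su Bu u }.

End processes.

(* Main.v *)
(** Pathwise, the solution of [du = - g u dt + su dB] is
    [u T = K 0 * u 0 + su * \int_0^T K x dB x] with the random propagator
    [K x = exp (- \int_x^T g)], and [K] is independent of [(u 0, B)]. In all three
    models [K x] is within mean square distance [de] of the deterministic
    [k x = exp (- gbar * (T - x))], uniformly in [x]: [de = 0] for MSM; [de] is of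
    order [eps] for SSM, because the autocovariance of the two-state chain decays
    exponentially at rate [(lp + lm) / eps]; and [de --> 0] for DSM, because the
    integrated Ornstein-Uhlenbeck equation expresses [\int_x^T (g - mu)] through
    [B_g T - B_g x] and [g T - g x] with coefficients tending to [0], which makes
    its exponential moments tend to [1].

    No stochastic integral is needed. A telescoping argument shows that the left
    Riemann sums of [\int K dB] converge almost surely. By independence these sums
    obey a discrete Ito isometry, so that Fatou's lemma along refinements of a
    grid bounds the mean square distance between [u T] and the discretization
    [W_n = k 0 * u 0 + su * \sum_i k (t_i) (B t_(i+1) - B t_i)] by
    [C * (de + 1 / n ^ 2)]. The first two moments of [W_n] depend only on the laws
    of [u 0] and of Brownian increments, hence are the same in all three models. *)

From HB Require Import structures.
Require Import Defs.
From mathcomp Require Import all_boot all_order all_algebra finmap.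
From mathcomp Require Import all_classical all_reals all_analysis measurable_realfun.
From mathcomp Require Import ring lra.

Set Implicit Arguments.
Unset Strict Implicit.
Unset Printing Implicit Defensive.

Import Order.TTheory GRing.Theory Num.Theory.
Import numFieldNormedType.Exports.

Local Open Scope classical_set_scope.
Local Open Scope ring_scope.

(** * Square-integrable random variables and independence *)

(** The models live on unrelated probability spaces, one for each [eps], so their solutions cannot
    be subtracted: each is compared with its own discretization, and the discretizations are
    compared only through moments. In the error bound the contributions of [de] and of the mesh are
    separate, so [n] can tend to infinity at fixed [eps] before [eps] tends to 0. The propagator at
    time [x] depends on the damping over [[x, T]], hence need not be adapted to a forward
    filtration; independence from the entire noise path replaces the martingale property. This
    independence concerns sigma-algebras that are not completed, which is why random limits are
    defined as superior limits, measurable exactly and not only up to null sets. For SSM the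
    exponent of the propagator is bounded, and the Lipschitz bound of [expR] turns a variance
    estimate for the integrated damping into one for the propagator. For DSM the exponent is
    unbounded, so exponential moments take the place of that bound. *)

Section expectations.
Context {d : measure_display} {Om : measurableType d} {R : realType}.
Variable P : probability Om R.
Local Notation Ex := (Rintegral P setT).

Lemma Lfun_measurable p (X : Om -> R) : X \in Lfun P p -> measurable_fun setT X.
Proof. by rewrite inE => /andP[/[!inE]]. Qed.

Lemma Lfun1P (X : Om -> R) : measurable_fun setT X ->
  (\int[P]_w `|X w|%:E < +oo)%E -> X \in Lfun P 1.
Proof.
by move=> mX iX; apply/Lfun1_integrable/integrableP; split => //; apply/measurable_EFinP.
Qed.

Lemma Lfun2P (X : Om -> R) : measurable_fun setT X ->
  (fun w => X w ^+ 2) \in Lfun P 1 -> X \in Lfun P 2%:E.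
Proof.
move=> mX /Lfun1_integrable/integrableP[_ iX]; rewrite inE; apply/andP; split; rewrite inE//=.
rewrite /finite_norm unlock poweR_lty//.
apply: le_lt_trans iX; apply: ge0_le_integral => //=.
- apply/measurable_EFinP.
  by apply/(@measurableT_comp _ _ _ _ _ _ (fun x : R => x `^ 2)%R) => //; exact/measurableT_comp.
- by apply/measurable_EFinP/measurableT_comp => //; apply: measurable_funX.
- by move=> x _; rewrite lee_fin powR_mulrn// normrX.
Qed.

Lemma Lfun2_sqr (X : Om -> R) : X \in Lfun P 2%:E -> (fun w => X w ^+ 2) \in Lfun P 1.
Proof. by move=> /Lfun2_integrable_sqr/Lfun1_integrable. Qed.

Lemma Lfun2_Lfun1 (X : Om -> R) : X \in Lfun P 2%:E -> X \in Lfun P 1.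
Proof. apply: Lfun_subset12; exact: fin_num_measure. Qed.

Lemma Lfun1D (X Y : Om -> R) : X \in Lfun P 1 -> Y \in Lfun P 1 ->
  (fun w => X w + Y w) \in Lfun P 1.
Proof. by move=> X1 Y1; apply: rpredD. Qed.

Lemma Lfun1Z a (X : Om -> R) : X \in Lfun P 1 -> (fun w => a * X w) \in Lfun P 1.
Proof.
by move=> X1; rewrite (_ : (fun _ => _) = a \o* X) ?Lfun_scale//; apply/funext => w /=; rewrite mulrC.
Qed.

Lemma Lfun2D (X Y : Om -> R) : X \in Lfun P 2%:E -> Y \in Lfun P 2%:E ->
  (fun w => X w + Y w) \in Lfun P 2%:E.
Proof. by move=> X1 Y1; apply: rpredD; rewrite ?lee1n. Qed.

Lemma Lfun2Z a (X : Om -> R) : X \in Lfun P 2%:E -> (fun w => a * X w) \in Lfun P 2%:E.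
Proof.
by move=> X1; rewrite (_ : (fun _ => _) = a \o* X) ?Lfun_scale ?ler1n//; apply/funext => w /=; rewrite mulrC.
Qed.

Lemma Lfun1B (X Y : Om -> R) : X \in Lfun P 1 -> Y \in Lfun P 1 ->
  (fun w => X w - Y w) \in Lfun P 1.
Proof. by move=> X1 Y1; apply: rpredB. Qed.

Lemma Lfun1_cst (c : R) : (fun=> c) \in Lfun P 1.
Proof. exact: Lfun_cst. Qed.

Lemma Lfun2_cst (c : R) : (fun=> c) \in Lfun P 2%:E.
Proof. exact: Lfun_cst. Qed.

Lemma Lfun1_sum n (F : 'I_n -> Om -> R) : (forall i, F i \in Lfun P 1) ->
  (fun w => \sum_(i < n) F i w) \in Lfun P 1.
Proof.
elim: n F => [|n ih] F F1.
  by under eq_fun do rewrite big_ord0; exact: Lfun1_cst.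
by under eq_fun do rewrite big_ord_recl; apply: Lfun1D => //; exact: ih.
Qed.

Lemma Lfun2_sum n (F : 'I_n -> Om -> R) : (forall i, F i \in Lfun P 2%:E) ->
  (fun w => \sum_(i < n) F i w) \in Lfun P 2%:E.
Proof.
elim: n F => [|n ih] F F1.
  by under eq_fun do rewrite big_ord0; exact: Lfun2_cst.
by under eq_fun do rewrite big_ord_recl; apply: Lfun2D => //; exact: ih.
Qed.

Lemma ExD (X Y : Om -> R) : X \in Lfun P 1 -> Y \in Lfun P 1 ->
  Ex (fun w => X w + Y w) = Ex X + Ex Y.
Proof. by move=> /Lfun1_integrable X1 /Lfun1_integrable Y1; exact: RintegralD. Qed.

Lemma ExB (X Y : Om -> R) : X \in Lfun P 1 -> Y \in Lfun P 1 ->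
  Ex (fun w => X w - Y w) = Ex X - Ex Y.
Proof. by move=> /Lfun1_integrable X1 /Lfun1_integrable Y1; exact: RintegralB. Qed.

Lemma ExZ a (X : Om -> R) : X \in Lfun P 1 -> Ex (fun w => a * X w) = a * Ex X.
Proof. by move=> /Lfun1_integrable X1; exact: RintegralZl. Qed.

Lemma Ex_cst c : Ex (fun=> c) = c.
Proof. by rewrite Rintegral_cst// -[fine _]/(fine (P setT)) probability_setT mulr1. Qed.

Lemma Ex_sum n (F : 'I_n -> Om -> R) : (forall i, F i \in Lfun P 1) ->
  Ex (fun w => \sum_(i < n) F i w) = \sum_(i < n) Ex (F i).
Proof.
elim: n F => [|n ih] F F1.
  by rewrite big_ord0 -[RHS](Ex_cst 0); apply: eq_Rintegral => w _; rewrite big_ord0.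
under eq_Rintegral do rewrite big_ord_recl.
by rewrite ExD// ?ih// ?big_ord_recl//; exact: Lfun1_sum.
Qed.

Lemma le_Ex (X Y : Om -> R) : X \in Lfun P 1 -> Y \in Lfun P 1 ->
  (forall w, X w <= Y w) -> Ex X <= Ex Y.
Proof. by move=> /Lfun1_integrable X1 /Lfun1_integrable Y1 XY; exact: le_Rintegral. Qed.

Lemma Ex_ge0 (X : Om -> R) : (forall w, 0 <= X w) -> 0 <= Ex X.
Proof. by move=> X0; apply: Rintegral_ge0. Qed.

Lemma le_Lfun1 (X Y : Om -> R) : measurable_fun setT X -> Y \in Lfun P 1 ->
  (forall w, `|X w| <= Y w) -> X \in Lfun P 1.
Proof.
move=> mX /Lfun1_integrable iY XY; apply/Lfun1_integrable.
apply: le_integrable iY => //; first exact/measurable_EFinP.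
move=> w _ /=; rewrite lee_fin; apply: le_trans (XY w) _; exact: ler_norm.
Qed.

Lemma bounded_Lfun1 (X : Om -> R) M : measurable_fun setT X ->
  (forall w, `|X w| <= M) -> X \in Lfun P 1.
Proof. by move=> mX XM; apply: le_Lfun1 mX (Lfun1_cst M) XM. Qed.

Lemma ge0_Lfun1_le (X : Om -> R) c : measurable_fun setT X -> (forall w, 0 <= X w) ->
  (\int[P]_w (X w)%:E <= c%:E)%E -> X \in Lfun P 1 /\ Ex X <= c.
Proof.
move=> mX X0 Xc.
have fX : (\int[P]_w (X w)%:E < +oo)%E by apply: le_lt_trans Xc (ltry _).
split.
  by apply: Lfun1P => //; under eq_integral do rewrite ger0_norm//.
rewrite -lee_fin /Rintegral fineK// ge0_fin_numE//.
by apply: integral_ge0 => w _; rewrite lee_fin.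
Qed.

Lemma EFin_Ex (X : Om -> R) : X \in Lfun P 1 -> (\int[P]_w (X w)%:E)%E = (Ex X)%:E.
Proof.
by move=> /Lfun1_integrable iX; rewrite /Rintegral fineK//; exact: integrable_fin_num.
Qed.

(** Integrability of the limit is part of the conclusion: the limits to which this is applied are
    not known beforehand to have moments. The bounds [c_ n] may vary with [n], as they do for the
    switching damping. *)
Lemma fatou_Ex (F : nat -> Om -> R) (X : Om -> R) (c : R) (c_ : nat -> R) :
  (forall n, F n \in Lfun P 1) -> (forall n w, 0 <= F n w) ->
  measurable_fun setT X -> (forall w, 0 <= X w) ->
  (\forall w \ae P, F n w @[n --> \oo] --> X w) ->
  (forall n, Ex (F n) <= c_ n) -> c_ n @[n --> \oo] --> c ->
  X \in Lfun P 1 /\ Ex X <= c.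
Proof.
move=> F1 F0 mX X0 FX Fc cc; apply: ge0_Lfun1_le => //.
have mF n : measurable_fun setT (fun w => (F n w)%:E).
  by apply/measurable_EFinP; exact: Lfun_measurable (F1 n).
apply: (@le_trans _ _ (\int[P]_w limn_einf (fun n => (F n w)%:E))%E).
  apply: ae_ge0_le_integral => //.
  - by move=> w _; rewrite lee_fin.
  - exact/measurable_EFinP.
  - move=> w _; rewrite limn_einf_lim; apply: lime_ge; first exact: is_cvg_einfs.
    by apply: nearW => n; apply: le_ereal_inf_tmp => _ [m _ <-]; rewrite lee_fin.
  - rewrite /limn_einf; apply: measurableT_comp => //.
    by apply: measurable_fun_limn_esup => n; exact: measurableT_comp.
  - apply: filterS FX => w Fw _.
    have /cvg_limn_einf_sup[-> _] // : (F n w)%:E @[n --> \oo] --> (X w)%:E.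
    by apply: cvg_EFin Fw; apply: nearW.
apply: (le_trans (fatou _ _ _ _)) => //; first by move=> n w _; rewrite lee_fin.
rewrite limn_einf_lim.
have cE : (c_ n)%:E @[n --> \oo] --> c%:E by apply: cvg_EFin cc; apply: nearW.
rewrite -(cvg_lim _ cE)//; apply: lee_lim; [exact: is_cvg_einfs|by apply/cvg_ex; exists c%:E|].
apply: nearW => n; apply: (@le_trans _ _ (\int[P]_w (F n w)%:E)%E).
  by apply: ereal_inf_lbound; exists n => /=.
by rewrite EFin_Ex// lee_fin.
Qed.

Definition indep (F1 F2 : set (set Om)) : Prop :=
  forall A B, F1 A -> F2 B -> P (A `&` B) = (P A * P B)%E.

(** Preimages must lie in [F] itself, with no completion: a variable almost surely equal to an
    adapted one need not be adapted. *)
Definition adapted (F : set (set Om)) (X : Om -> R) : Prop :=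
  forall A, measurable A -> F (X @^-1` A).

(** The joint law of [(X, Y)] agrees with the product of the marginal laws on rectangles, hence
    everywhere. Tonelli for the absolute value then gives integrability, and Fubini the
    factorization. *)
Let indep_Lfun1M_mfun (X Y : {RV P >-> R}) :
  (forall A B, measurable A -> measurable B ->
    P (X @^-1` A `&` Y @^-1` B) = (P (X @^-1` A) * P (Y @^-1` B))%E) ->
  (X : Om -> R) \in Lfun P 1 -> (Y : Om -> R) \in Lfun P 1 ->
  (fun w => X w * Y w) \in Lfun P 1 /\ Ex (fun w => X w * Y w) = Ex X * Ex Y.
Proof.
move=> XY X1 Y1.
pose Z w := (X w, Y w).
have mZ : measurable_fun setT Z by apply: measurable_fun_pair.
pose ZP : {mfun Om >-> (R * R)%type} := HB.pack Z (isMeasurableFun.Build _ _ _ _ _ mZ).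
have ZE : forall A, measurable A -> ((distribution P X) \x (distribution P Y))%E A = distribution P ZP A.
  by apply: product_measure_unique => A B mA mB; rewrite -XY.
pose f (z : R * R) := (z.1 * z.2)%:E.
have mf : measurable_fun setT f.
  by apply/measurable_EFinP; apply: measurable_funM.
have mX : measurable_fun setT X := Lfun_measurable X1.
have mY : measurable_fun setT Y := Lfun_measurable Y1.
have iX : (\int[distribution P X]_x `|x%:E| = (Ex (fun w => `|X w|))%:E)%E.
  rewrite ge0_integral_distribution//; last exact: measurableT_comp.
  by rewrite -EFin_Ex//; exact: Lfun_norm.
have iY : (\int[distribution P Y]_x `|x%:E| = (Ex (fun w => `|Y w|))%:E)%E.
  rewrite ge0_integral_distribution//; last exact: measurableT_comp.
  by rewrite -EFin_Ex//; exact: Lfun_norm.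
have iXY : (\int[P]_w `|X w * Y w|%:E = (Ex (fun w => `|X w|) * Ex (fun w => `|Y w|))%:E)%E.
  transitivity (\int[distribution P ZP]_z `|f z|)%E.
    by rewrite ge0_integral_distribution//; exact: measurableT_comp.
  transitivity (\int[((distribution P X) \x (distribution P Y))%E]_z `|f z|)%E.
    by apply: eq_measure_integral => A mA _; exact: (esym (ZE A mA)).
  rewrite fubini_tonelli1; [|by apply: measurableT_comp|by []].
  rewrite /fubini_F/=.
  under eq_integral => x _.
    under eq_integral => y _ do rewrite normrM EFinM.
    rewrite ge0_integralZl//=; last exact: measurableT_comp.
    rewrite iY; over.
  by rewrite ge0_integralZr//=; [rewrite iX -EFinM|exact: measurableT_comp|rewrite lee_fin Ex_ge0].
have XY1 : (fun w => X w * Y w) \in Lfun P 1.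
  by apply: Lfun1P; [exact: measurable_funM|rewrite iXY ltry].
split => //.
apply: EFin_inj; rewrite -EFin_Ex//.
transitivity (\int[distribution P ZP]_z f z)%E.
  by rewrite integral_distribution//; exact/Lfun1_integrable.
transitivity (\int[((distribution P X) \x (distribution P Y))%E]_z f z)%E.
  by apply: eq_measure_integral => A mA _; exact: (esym (ZE A mA)).
have if1 : (distribution P X).-integrable setT (EFin : R -> \bar R).
  by apply/integrableP; split => //; rewrite iX ltry.
have if2 : (distribution P Y).-integrable setT (EFin : R -> \bar R).
  by apply/integrableP; split => //; rewrite iY ltry.
rewrite -integral12_prod_meas1; last first.
  apply/integrable12ltyP => //=.
  under eq_integral => x _.
    under eq_integral => y _ do rewrite normrM EFinM.
    rewrite ge0_integralZl//=; last exact: measurableT_comp.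
    rewrite iY; over.
  by rewrite ge0_integralZr//=; [rewrite iX -EFinM ltry|exact: measurableT_comp|rewrite lee_fin Ex_ge0].
under eq_integral => x _.
  rewrite /fubini_F /f/=; under eq_integral => y _ do rewrite EFinM.
  rewrite integralZl//= integral_distribution//; last exact/Lfun1_integrable.
  rewrite [X in (_ * X)%E]EFin_Ex//; over.
rewrite integralZr//= integral_distribution//; last exact/Lfun1_integrable.
by rewrite [X in (X * _)%E]EFin_Ex.
Qed.

Lemma indep_Lfun1M F1 F2 (X Y : Om -> R) : indep F1 F2 -> adapted F1 X -> adapted F2 Y ->
  X \in Lfun P 1 -> Y \in Lfun P 1 ->
  (fun w => X w * Y w) \in Lfun P 1 /\ Ex (fun w => X w * Y w) = Ex X * Ex Y.
Proof.
move=> F12 FX FY X1 Y1.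
pose XP : {mfun Om >-> R} := HB.pack X (isMeasurableFun.Build _ _ _ _ _ (Lfun_measurable X1)).
pose YP : {mfun Om >-> R} := HB.pack Y (isMeasurableFun.Build _ _ _ _ _ (Lfun_measurable Y1)).
apply: (@indep_Lfun1M_mfun XP YP) => // A B mA mB.
by apply: F12; [exact: FX|exact: FY].
Qed.

End expectations.

(** * Gaussian laws *)

Section exponential_inequalities.
Context {R : realType}.
Implicit Types x y : R.

(** The right side is [4 * (expR (x / 2) - expR (- (x / 2))) ^+ 2]. For [0 <= x] the bounds
    [1 + x / 2 <= expR (x / 2)] and [expR (- (x / 2)) <= 1] make the difference at least [x / 2];
    negative arguments follow by symmetry. *)
Lemma sqr_le_expR x : x ^+ 2 <= 4 * (expR x + expR (- x) - 2).
Proof.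
have half y : 0 <= y -> y ^+ 2 <= 4 * (expR y + expR (- y) - 2).
  move=> y0; have e0 := expR_gt0 (y / 2).
  have e1 : expR y = expR (y / 2) ^+ 2 by rewrite expr2 -expRD -splitr.
  have e2 : expR (- y) = expR (- (y / 2)) ^+ 2 by rewrite expr2 -expRD -opprD -splitr.
  have e3 : expR (y / 2) * expR (- (y / 2)) = 1 by rewrite -expRD subrr expR0.
  have e4 := expR_ge1Dx (y / 2).
  have e5 : expR (- (y / 2)) <= 1 by rewrite -expR0 ler_expR oppr_le0 divr_ge0.
  rewrite e1 e2; nra.
case: (leP 0 x) => [|x0]; first exact: half.
by have := half (- x); rewrite opprK sqrrN (addrC (expR (- x))) => ->//; rewrite oppr_ge0 ltW.
Qed.

Lemma expR_sub1_le x : expR x - 1 <= x * expR x.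
Proof.
have := expR_ge1Dx (- x); have := expR_gt0 x.
have : expR x * expR (- x) = 1 by rewrite -expRD subrr expR0.
nra.
Qed.

End exponential_inequalities.

Section laws.
Context {d : measure_display} {Om : measurableType d} {R : realType}.
Variable P : probability Om R.
Local Notation Ex := (Rintegral P setT).

Lemma ge0_integral_law d' (T : measurableType d') (X : Om -> T)
    (nu : {measure set T -> \bar R}) (f : T -> \bar R) :
  measurable_fun setT X -> (forall A : set T, measurable A -> P (X @^-1` A) = nu A) ->
  measurable_fun setT f -> (forall x, 0 <= f x)%E ->
  (\int[P]_w f (X w) = \int[nu]_x f x)%E.
Proof.
move=> mX PX mf f0.
pose XP : {mfun Om >-> T} := HB.pack X (isMeasurableFun.Build _ _ _ _ _ mX).
rewrite -[LHS](@ge0_integral_distribution _ _ _ _ _ P XP)//.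
by apply: eq_measure_integral => A mA _; exact: PX.
Qed.

(** The Radon-Nikodym derivative and [normal_pdf] have the same integral over every measurable set,
    so they agree almost everywhere and the latter can be used in the change of variables. *)
Lemma integral_normal_prob (m s : R) (f : R -> \bar R) : s != 0 ->
  measurable_fun setT f -> (forall x, 0 <= f x)%E ->
  (\int[normal_prob m s]_x f x = \int[lebesgue_measure]_x (f x * (normal_pdf m s x)%:E))%E.
Proof.
move=> s0 mf f0.
have dom := normal_prob_dominates m s.
rewrite -(Radon_Nikodym_SigmaFinite.change_of_variables dom)//.
have mRN : measurable_fun setT (Radon_Nikodym_SigmaFinite.f (normal_prob m s) lebesgue_measure).
  by apply: measurable_int; exact: Radon_Nikodym_SigmaFinite.f_integrable.
apply: ae_eq_integral => //.
- exact: emeasurable_funM.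
- by apply: emeasurable_funM => //; apply/measurable_EFinP; exact: measurable_normal_pdf.
- apply: ae_eqe_mul2l; apply: integral_ae_eq => //=.
  + exact: Radon_Nikodym_SigmaFinite.f_integrable.
  + by apply/measurable_EFinP; exact: measurable_normal_pdf.
  + by move=> A _ mA; rewrite -Radon_Nikodym_SigmaFinite.f_integral.
Qed.

(** Completing the square shifts the mean from [m] to [m + t * s ^+ 2], and the shifted density
    integrates to 1. This is the only Gaussian integral that is computed; moments are deduced from
    it by inequalities. *)
Lemma gaussian_mgf (X : Om -> R) m s (t : R) : has_law P X (gaussian m s) ->
  (fun w => expR (t * X w)) \in Lfun P 1 /\
  Ex (fun w => expR (t * X w)) = expR (t * m + t ^+ 2 * s ^+ 2 / 2).
Proof.
move=> [mX PX].
have mE : measurable_fun setT (fun x : R => expR (t * x)).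
  by apply: measurableT_comp => //; exact: measurable_funM.
suff H : (\int[P]_w (expR (t * X w))%:E = (expR (t * m + t ^+ 2 * s ^+ 2 / 2))%:E)%E.
  split; last by rewrite /Rintegral H.
  apply: Lfun1P; first exact: (measurableT_comp mE).
  by under eq_integral do rewrite ger0_norm ?expR_ge0//; rewrite H ltry.
move: PX; rewrite /gaussian; have [->|s0] := eqVneq s 0 => PX.
  rewrite (ge0_integral_law (f := fun x => (expR (t * x))%:E) mX PX)//; last exact/measurable_EFinP.
  rewrite integral_dirac//; last exact/measurable_EFinP.
  by rewrite diracT mul1e expr0n/= mulr0 mul0r addr0.
rewrite (ge0_integral_law (T := measurableTypeR R) (nu := normal_prob m s) (f := fun x => (expR (t * x))%:E) mX PX)//; last exact/measurable_EFinP.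
rewrite integral_normal_prob//; last exact/measurable_EFinP.
under eq_integral => x _.
  rewrite -EFinM (_ : expR (t * x) * _ = expR (t * m + t ^+ 2 * s ^+ 2 / 2) * normal_pdf (m + t * s ^+ 2) s x).
    rewrite EFinM; over.
  rewrite /normal_pdf (negbTE s0) /normal_fun mulrCA [RHS]mulrCA; congr *%R.
  by rewrite -!expRD; congr expR; field.
rewrite ge0_integralZl//=; last 2 first.
  - by apply/measurable_EFinP; exact: measurable_normal_pdf.
  - by move=> x _; rewrite lee_fin normal_pdf_ge0.
by rewrite integral_normal_pdf mule1.
Qed.

(** [sqr_le_expR] at [t * X w], in expectation. The scale [t] stays free: [1] settles integrability,
    and [s^-1] gives a bound proportional to [s ^+ 2]. *)
Lemma gaussian_sqr_le (X : Om -> R) m s (t : R) : has_law P X (gaussian m s) -> t != 0 ->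
  X \in Lfun P 2%:E /\
  t ^+ 2 * Ex (fun w => X w ^+ 2) <=
    4 * (expR (t * m + t ^+ 2 * s ^+ 2 / 2) + expR (- t * m + t ^+ 2 * s ^+ 2 / 2) - 2).
Proof.
move=> lX t0; have [mX _] := lX.
have [p1 pE] := gaussian_mgf t lX; have [n1 nE] := gaussian_mgf (- t) lX.
pose Y w := 4 * (expR (t * X w) + expR (- t * X w) - 2).
have Y1 : Y \in Lfun P 1.
  by apply: Lfun1Z; apply: Lfun1B; [exact: Lfun1D|exact: Lfun1_cst].
have XY w : t ^+ 2 * X w ^+ 2 <= Y w by rewrite -exprMn /Y mulNr sqr_le_expR.
have tX1 : (fun w => t ^+ 2 * X w ^+ 2) \in Lfun P 1.
  apply: le_Lfun1 Y1 _; first by apply: measurable_funM => //; exact: measurable_funX.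
  by move=> w; rewrite ger0_norm// mulr_ge0// sqr_ge0.
have X1 : (fun w => X w ^+ 2) \in Lfun P 1.
  rewrite (_ : (fun _ => _) = fun w => (t ^+ 2)^-1 * (t ^+ 2 * X w ^+ 2)); first exact: Lfun1Z.
  by apply/funext => w; rewrite mulKf// sqrf_eq0.
split; first exact: Lfun2P.
rewrite -ExZ//; apply: le_trans (le_Ex tX1 Y1 XY) _.
have c1 : (fun=> 2) \in Lfun P 1 := Lfun1_cst P 2.
have pn1 := Lfun1D p1 n1.
rewrite /Y ExZ; last exact: Lfun1B.
by rewrite ExB// ExD// Ex_cst pE nE sqrrN.
Qed.

Lemma gaussian_Lfun2 (X : Om -> R) m s : has_law P X (gaussian m s) -> X \in Lfun P 2%:E.
Proof. by move=> lX; have [] := gaussian_sqr_le lX (oner_neq0 R). Qed.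

(* The constant [8 * expR 1] is not sharp; it is what [sqr_le_expR] and the moment
   generating function at [1 / s] give. *)
Lemma centered_gaussian_sqr_le (X : Om -> R) s : has_law P X (gaussian 0 s) ->
  Ex (fun w => X w ^+ 2) <= 8 * expR 1 * s ^+ 2.
Proof.
move=> lX; have [s0|s0] := eqVneq s 0.
  have [_] := gaussian_sqr_le lX (oner_neq0 R).
  rewrite !mulr0 add0r s0 !expr0n/= !mulr0 mul0r expR0.
  by rewrite expr1n mul1r => /le_trans; apply; lra.
have [_] := gaussian_sqr_le lX (invr_neq0 s0).
rewrite !mulr0 add0r exprVn mulVf ?sqrf_eq0// => H.
have e1 : expR (1 / 2) <= expR 1 :> R by rewrite ler_expR; lra.
have s2 : 0 < s ^+ 2 by rewrite exprn_even_gt0.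
rewrite -ler_pdivrMr// mulrC; apply: le_trans H _; lra.
Qed.

(** Since [t * x <= expR (t * x) - 1], the product [t * Ex X] is at most
    [expR (t ^+ 2 * s ^+ 2 / 2) - 1], which is of order [t ^+ 2]. Using both [t] and [- t], dividing
    by [t] and letting [t] tend to 0 forces the mean to vanish. *)
Lemma centered_gaussian_mean (X : Om -> R) s : has_law P X (gaussian 0 s) -> Ex X = 0.
Proof.
move=> lX.
have X1 : X \in Lfun P 1 := Lfun2_Lfun1 (gaussian_Lfun2 lX).
pose K := s ^+ 2 / 2 * expR (s ^+ 2 / 2).
have K0 : 0 <= K by rewrite mulr_ge0 ?expR_ge0// divr_ge0 ?sqr_ge0.
have bound (t : R) : t ^+ 2 <= 1 -> t * Ex X <= t ^+ 2 * K.
  move=> t1; have [m1 mE] := gaussian_mgf t lX.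
  rewrite -ExZ//; apply: (@le_trans _ _ (Ex (fun w => expR (t * X w) - 1))).
    apply: le_Ex; [exact: Lfun1Z|by apply: Lfun1B => //; exact: Lfun1_cst|].
    by move=> w; have := expR_ge1Dx (t * X w); lra.
  rewrite ExB//; last exact: Lfun1_cst.
  rewrite Ex_cst mE mulr0 add0r; apply: le_trans (expR_sub1_le _) _.
  have -> : t ^+ 2 * K = t ^+ 2 * s ^+ 2 / 2 * expR (s ^+ 2 / 2) by rewrite /K; ring.
  have c0 : 0 <= t ^+ 2 * s ^+ 2 / 2.
    by apply: divr_ge0 => //; apply: mulr_ge0; exact: sqr_ge0.
  rewrite ler_wpM2l//.
  by rewrite ler_expR ler_pM2r// -[leRHS]mul1r ler_wpM2r// sqr_ge0.
suff H : forall e, 0 < e -> `|Ex X| <= e * K.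
  apply/eqP; rewrite -normr_le0; apply/ler_addgt0Pl => e e0; rewrite addr0.
  apply: le_trans (H (e / (K + 1)) _) _; first by rewrite divr_gt0//; lra.
  by rewrite mulrAC ler_pdivrMr; lra || nra.
(* Truncation at 1 ensures [t ^+ 2 <= 1], the range in which [bound] holds with the fixed constant
   [K]. *)
move=> e e0; pose t := Num.min e 1.
have t0 : 0 < t by rewrite lt_min e0 ltr01.
have tle1 : t <= 1 by rewrite /t ge_min lexx orbT.
have t1 : t ^+ 2 <= 1 by rewrite expr_le1// ltW.
have te : t * K <= e * K by rewrite ler_wpM2r// ge_min lexx.
apply: le_trans te; rewrite ler_norml -(ler_pM2l t0) -[X in _ && X](ler_pM2l t0).
have := bound t t1; have := bound (- t); rewrite sqrrN => /(_ t1); rewrite !expr2.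
lra.
Qed.

End laws.

Section equal_laws.
Context {R : realType} {d d' : measure_display} {Om : measurableType d} {Om' : measurableType d'}.
Variables (P : probability Om R) (P' : probability Om' R).

(** [nu] is a mere set function, so the pushforward of [P'] by [X'] stands in for it as a
    measure. *)
Lemma ge0_Ex_same_law (X : Om -> R) (X' : Om' -> R) nu (f : R -> R) :
  has_law P X nu -> has_law P' X' nu -> measurable_fun setT f -> (forall x, 0 <= f x) ->
  Rintegral P setT (f \o X) = Rintegral P' setT (f \o X').
Proof.
move=> [mX PX] [mX' PX'] mf f0; congr fine.
pose XP : {mfun Om' >-> R} := HB.pack X' (isMeasurableFun.Build _ _ _ _ _ mX').
rewrite (@ge0_integral_law _ _ _ P _ _ X (distribution P' XP) (EFin \o f))//.
- by rewrite ge0_integral_distribution//; exact/measurable_EFinP.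
- by move=> A mA; rewrite PX// -PX'.
- exact/measurable_EFinP.
Qed.

(** The nonnegative case applied to [|x| + x] and to [|x|], whose difference is the identity. *)
Lemma Ex_same_law (X : Om -> R) (X' : Om' -> R) nu :
  has_law P X nu -> has_law P' X' nu -> X \in Lfun P 1 -> X' \in Lfun P' 1 ->
  Rintegral P setT X = Rintegral P' setT X'.
Proof.
move=> lX lX' X1 X'1.
pose f (x : R) := `|x| + x; pose g (x : R) := `|x|.
have -> : Rintegral P setT X = Rintegral P setT (f \o X) - Rintegral P setT (g \o X).
  rewrite -ExB//; last 2 first.
    by apply: Lfun1D => //; exact: Lfun_norm.
    exact: Lfun_norm.
  by apply: eq_Rintegral => w _; rewrite /f /g/= addrC addKr.
have -> : Rintegral P' setT X' = Rintegral P' setT (f \o X') - Rintegral P' setT (g \o X').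
  rewrite -ExB//; last 2 first.
    by apply: Lfun1D => //; exact: Lfun_norm.
    exact: Lfun_norm.
  by apply: eq_Rintegral => w _; rewrite /f /g/= addrC addKr.
congr (_ - _).
  apply: ge0_Ex_same_law lX lX' _ _; first by apply: measurable_funD => //; exact: measurableT_comp.
  by move=> x; rewrite /f -lerBlDr sub0r lerNl; have := ler_norm (- x); rewrite normrN; lra.
by apply: ge0_Ex_same_law lX lX' _ _; [exact: measurableT_comp|move=> x; exact: normr_ge0].
Qed.

End equal_laws.

(** * The linear equation along a path *)

Section grids.
Context {R : realType}.
Implicit Types (a b : R) (f : R -> R).
Local Notation mu := (@lebesgue_measure R).

Definition grid a b (n i : nat) : R := a + i%:R * ((b - a) / n%:R).

Lemma grid0 a b n : grid a b n 0 = a.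
Proof. by rewrite /grid mul0r addr0. Qed.

Lemma gridn a b n : grid a b n.+1 n.+1 = b.
Proof. by rewrite /grid mulrCA mulfV ?mulr1 ?subrKC// pnatr_eq0. Qed.

Lemma gridS a b n i : grid a b n i.+1 = grid a b n i + (b - a) / n%:R.
Proof. by rewrite /grid -natr1; ring. Qed.

Lemma mesh_ge0 a b n : a <= b -> 0 <= (b - a) / n%:R.
Proof. by move=> ab; rewrite divr_ge0// subr_ge0. Qed.

Lemma le_grid a b n i j : a <= b -> (i <= j)%N -> grid a b n i <= grid a b n j.
Proof. by move=> ab ij; rewrite lerD2l ler_wpM2r ?mesh_ge0// ler_nat. Qed.

Lemma grid_itv a b n i : a <= b -> (i <= n.+1)%N -> a <= grid a b n.+1 i <= b.
Proof.
move=> ab ni; have := le_grid n.+1 ab (leq0n i); have := le_grid n.+1 ab ni.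
by rewrite grid0 gridn => -> ->.
Qed.

Lemma mesh_cvg a b : (b - a) / n.+1%:R @[n --> \oo] --> (0 : R).
Proof.
rewrite -[X in _ --> X](mulr0 (b - a)); apply: cvgM; first exact: cvg_cst.
exact: cvg_harmonic.
Qed.

Lemma Rintegral_itv_split f x y z : x <= y -> y <= z ->
  mu.-integrable `[x, z[ (EFin \o f) ->
  \int[mu]_(t in `[x, z[) f t = \int[mu]_(t in `[x, y[) f t + \int[mu]_(t in `[y, z[) f t.
Proof.
move=> xy yz fi.
have E : `[x, z[%classic = `[x, y[%classic `|` `[y, z[%classic.
  by apply: itv_bndbnd_setU; rewrite bnd_simp.
rewrite E Rintegral_setU -?E//.
by apply/disj_setPS => t [/=]; rewrite !in_itv/= => /andP[_ ty] /andP[]; rewrite leNgt ty.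
Qed.

Lemma Rintegral_grid f a b n m : a <= b -> mu.-integrable `[a, grid a b n m[ (EFin \o f) ->
  \int[mu]_(t in `[a, grid a b n m[) f t =
  \sum_(i < m) \int[mu]_(t in `[grid a b n i, grid a b n i.+1[) f t.
Proof.
move=> ab; elim: m => [|m ih] fi.
  by rewrite big_ord0 grid0 set_itvco0 Rintegral_set0.
have am : a <= grid a b n m by rewrite -{1}(grid0 a b n) le_grid.
rewrite big_ord_recr/= -ih.
  by rewrite -Rintegral_itv_split// le_grid.
by apply: integrableS fi => //; apply: subset_itvl; rewrite bnd_simp le_grid.
Qed.

(** The right end of the cell containing [t]. For [a <= t] it lies strictly to the right of [t], so
    right-continuity alone makes the values of a path at these points converge to its value at
    [t]. *)
Definition grid_right a b n (t : R) : R :=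
  grid a b n (Num.truncn ((t - a) / ((b - a) / n%:R))).+1.

Lemma grid_rightE a b n i t : a < b -> (0 < n)%N ->
  grid a b n i <= t < grid a b n i.+1 -> grid_right a b n t = grid a b n i.+1.
Proof.
move=> ab n0 /andP[it ti].
have h0 : 0 < (b - a) / n%:R by rewrite divr_gt0 ?subr_gt0// ltr0n.
rewrite /grid_right; congr (grid _ _ _ _.+1); apply: truncn_def.
rewrite ler_pdivlMr// ltr_pdivrMr//; move: it ti; rewrite /grid; lra.
Qed.

Lemma grid_cell a b n t : a < b -> (0 < n)%N -> a <= t ->
  let i := Num.truncn ((t - a) / ((b - a) / n%:R)) in
  grid a b n i <= t < grid a b n i.+1.
Proof.
move=> ab n0 at_ /=.
have h0 : 0 < (b - a) / n%:R by rewrite divr_gt0 ?subr_gt0// ltr0n.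
have /truncn_itv : 0 <= (t - a) / ((b - a) / n%:R) by rewrite divr_ge0 ?subr_ge0// ltW.
by rewrite ler_pdivlMr// ltr_pdivrMr// /grid => /andP[? ?]; apply/andP; split; lra.
Qed.

Lemma grid_right_itv a b n t : a < b -> (0 < n)%N -> a <= t ->
  t < grid_right a b n t <= t + (b - a) / n%:R.
Proof.
move=> ab n0 at_; have /= /andP[it ti] := grid_cell ab n0 at_.
by rewrite /grid_right ti gridS lerD2r.
Qed.

Lemma grid_right_cvg a b t : a < b -> a <= t -> grid_right a b n.+1 t @[n --> \oo] --> t.
Proof.
move=> ab at_; apply: (@squeeze_cvgr _ _ _ _ (fun=> t) (fun n => t + (b - a) / n.+1%:R)).
- by apply: nearW => n; have /andP[/ltW -> ->] := grid_right_itv ab (ltn0Sn n) at_.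
- exact: cvg_cst.
- rewrite -[X in _ --> X](addr0 t); apply: cvgD; first exact: cvg_cst.
  exact: mesh_cvg.
Qed.

Lemma grid_right_le a b n t : a < b -> a <= t < b -> grid_right a b n.+1 t <= b.
Proof.
move=> ab /andP[at_ tb]; have /= /andP[it ti] := grid_cell ab (ltn0Sn n) at_.
rewrite /grid_right -[X in _ <= X](gridn a b n) le_grid ?(ltW ab)//.
have h0 : 0 < (b - a) / n.+1%:R by rewrite divr_gt0 ?subr_gt0.
have : grid a b n.+1 (Num.truncn ((t - a) / ((b - a) / n.+1%:R))) < grid a b n.+1 n.+1.
  by rewrite gridn (le_lt_trans it).
by rewrite /grid ltrD2l ltr_pM2r// ltr_nat.
Qed.

(** [f] is arbitrary: the composite is constant on each of countably many cells. Right-continuous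
    paths are measurable as pointwise limits of such step functions. *)
Lemma measurable_grid_right f a b n : a < b -> (0 < n)%N ->
  measurable_fun `[a, b[ (f \o grid_right a b n).
Proof.
move=> ab n0.
apply: (@measurable_funS _ _ _ _ (\bigcup_i `[grid a b n i, grid a b n i.+1[%classic)).
- by apply: bigcup_measurable => i _; exact: measurable_itv.
- move=> t /=; rewrite in_itv/= => /andP[at_ _].
  by have /= := grid_cell ab n0 at_; eexists => //=; rewrite in_itv/=; eassumption.
- apply/measurable_fun_bigcup; first by move=> i; exact: measurable_itv.
  move=> i; apply: (eq_measurable_fun (fun=> f (grid a b n i.+1))) => //.
  by move=> t; rewrite inE/= in_itv/= => ti; rewrite (grid_rightE ab n0 ti).
Qed.

(** * Right-continuous paths as limits of step functions *)

Section right_continuous_functions.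
Variables (f : R -> R) (a b M : R).
Hypothesis ab : a < b.
Hypothesis fM : forall t, a <= t <= b -> `|f t| <= M.
Hypothesis fr : forall t, a <= t < b -> f s @[s --> t^'+] --> f t.

Let fcvg t : a <= t < b -> f (grid_right a b n.+1 t) @[n --> \oo] --> f t.
Proof.
move=> /[dup] /fr + /andP[at_ tb]; move/cvg_at_rightP; apply; split.
  by move=> n; have /andP[] := grid_right_itv ab (ltn0Sn n) at_.
exact: grid_right_cvg.
Qed.

Lemma right_continuous_measurable : measurable_fun `[a, b] f.
Proof.
apply/measurable_fun_itv_bndo_bndcP.
apply: (@measurable_fun_cvg _ _ _ _ (fun n => f \o grid_right a b n.+1)).
  by move=> n; exact: measurable_grid_right.
by move=> t /=; rewrite in_itv/= => tab; exact: fcvg.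
Qed.

Let mf : measurable_fun `[a, b[ f.
Proof. by apply/measurable_fun_itv_bndo_bndcP; exact: right_continuous_measurable. Qed.

(** The sum is exactly the integral of the step function [f \o grid_right a b n.+1], which converges
    pointwise to [f] and is dominated by [M]. *)
Lemma right_Riemann_sum_cvg :
  \sum_(i < n.+1) f (grid a b n.+1 i.+1) * ((b - a) / n.+1%:R) @[n --> \oo]
    --> \int[mu]_(t in `[a, b[) f t.
Proof.
have mg n : measurable_fun `[a, b[ (f \o grid_right a b n.+1).
  exact: measurable_grid_right.
have gM n t : a <= t < b -> `|f (grid_right a b n.+1 t)| <= M.
  move=> tab; apply: fM; rewrite grid_right_le// andbT; have /andP[at_ _] := tab.
  by have /andP[/ltW /(le_trans at_)] := grid_right_itv ab (ltn0Sn n) at_.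
have iM : mu.-integrable `[a, b[ (EFin \o cst M).
  apply: measurable_bounded_integrable => //.
    by rewrite /= lebesgue_measure_itv/= lte_fin ab -EFinD ltry.
  by exists `|M|; split => // x Mx t _ /=; exact: ltW.
have := @dominated_convergence _ _ _ mu `[a, b[%classic (measurable_itv _)
  (fun n => EFin \o (f \o grid_right a b n.+1)) (EFin \o f) (EFin \o cst M).
case.
- by move=> n; apply/measurable_EFinP; exact: (mg n).
- exact/measurable_EFinP.
- apply: aeW => t; rewrite /= in_itv/= => tab; apply: cvg_EFin; first exact: nearW.
  exact: fcvg.
- exact: iM.
- by apply: aeW => t n; rewrite /= in_itv/= => tab; rewrite lee_fin gM.
move=> fi _; rewrite -[X in _ --> X -> _]fineK; last exact: integrable_fin_num.
move=> /fine_cvg H; apply: cvg_trans H; apply: near_eq_cvg; apply: nearW => n /=.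
have ig : mu.-integrable `[a, b[ (EFin \o (f \o grid_right a b n.+1)).
  apply: le_integrable iM => //; first by apply/measurable_EFinP; exact: (mg n).
  move=> t; rewrite /= in_itv/= => tab; rewrite lee_fin; apply: le_trans (gM _ _ tab) _.
  exact: ler_norm.
rewrite -[LHS]/(Rintegral _ _ _) -{1}(gridn a b n) Rintegral_grid ?(ltW ab) ?gridn//.
apply: eq_bigr => i _.
transitivity (\int[mu]_(t in `[grid a b n.+1 i, grid a b n.+1 i.+1[) f (grid a b n.+1 i.+1)).
  apply: eq_Rintegral => t; rewrite inE/= in_itv/= => ti.
  by rewrite (grid_rightE ab (ltn0Sn n) ti).
rewrite Rintegral_cst//= lebesgue_measure_itv/= lte_fin gridS ltrDl.
by rewrite divr_gt0 ?subr_gt0//= (addrC (grid _ _ _ _)) addrK.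
Qed.

End right_continuous_functions.

Lemma normr_Rintegral_itv_le f x y (M : R) : x <= y -> mu.-integrable `[x, y[ (EFin \o f) ->
  (forall t, x <= t < y -> `|f t| <= M) ->
  `|\int[mu]_(t in `[x, y[) f t| <= M * (y - x).
Proof.
move=> xy fi fM; apply: le_trans (le_normr_Rintegral _ fi) _ => //.
apply: (@le_trans _ _ (\int[mu]_(t in `[x, y[) M)).
  apply: le_Rintegral => //; first exact: integrable_norm.
    apply: measurable_bounded_integrable => //.
      rewrite /= lebesgue_measure_itv/= lte_fin; case: ifP => _; last exact: ltry.
      by rewrite -EFinD ltry.
    by exists `|M|; split => // z Mz t _ /=; exact: ltW.
rewrite Rintegral_cst//= lebesgue_measure_itv/= lte_fin.
by move: xy; rewrite le_eqVlt => /predU1P[->|->]//=; rewrite ltxx subrr.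
Qed.

Lemma within_unif_continuous f a b : {within `[a, b], continuous f} ->
  forall e : R, 0 < e -> exists2 de : R, 0 < de & forall x y, a <= x <= b -> a <= y <= b ->
    `|x - y| < de -> `|f x - f y| <= e.
Proof.
move=> /subspace_continuousP cf e e0.
have /compact_near_coveringP := @segment_compact R a b.
move=> /(_ R (0^'+) (fun de x => forall y, a <= x <= b -> a <= y <= b ->
    `|x - y| < de -> `|f x - f y| <= e) _).
case.
  move=> x xab.
  have /cf/cvgrPdist_le/(_ (e / 2)) : `[a, b]%classic x by [].
  rewrite divr_gt0// => /(_ isT); rewrite near_withinE => -[r /= r0 Hr].
  exists (ball x (r / 2), [set de | de < r / 2]%classic) => /=.
    by split => /=; [apply: nbhsx_ballx|apply: nbhs_right_lt]; rewrite divr_gt0.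
  - move=> [x' de] /= [xx' der] y x'ab yab x'y.
    have fx' : `|f x - f x'| <= e / 2.
      apply: Hr; last by rewrite /= in_itv.
      by rewrite /ball_/= (lt_trans xx')// ltr_pdivrMr// ltr_pMr// ltr1n.
    have fy : `|f x - f y| <= e / 2.
      apply: Hr; last by rewrite /= in_itv.
      rewrite /ball_/= (le_lt_trans (ler_distD x' _ _))//.
      rewrite (splitr r) ltrD//; exact: lt_trans x'y der.
    by rewrite (le_trans (ler_distD (f x) _ _))// (splitr e) lerD// distrC.
move=> r /= r0 Hr; exists (r / 2); first by rewrite divr_gt0.
move=> x y xab yab xy; apply: (Hr (r / 2)) => //.
- by rewrite /ball_/= sub0r normrN gtr0_norm ?divr_gt0// ltr_pdivrMr// ltr_pMr// ltr1n.
- by rewrite divr_gt0.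
Qed.

(** By [expR_sub1_le] the remainder is at most [x * (expR x - 1)]. The second factor is in turn at
    most [x * expR x] when [0 <= x], and at least [x] when [x < 0]. *)
Lemma expR_sub1Dx_norm (x : R) : `|x| <= 1 -> `|expR x - 1 - x| <= expR 1 * x ^+ 2.
Proof.
move=> x1; have H1 := expR_ge1Dx x; have H2 := expR_sub1_le x.
have H3 : 1 <= expR 1 :> R by rewrite -expR0 ler_expR.
have /andP[x1' x1''] : -1 <= x <= 1 by rewrite -ler_norml.
rewrite ger0_norm; last lra.
case: (leP 0 x) => x0.
  have H4 : expR x <= expR 1 by rewrite ler_expR.
  have : x * (expR x - 1) <= x * (x * expR 1).
    by rewrite ler_wpM2l//; apply: le_trans H2 _; rewrite ler_wpM2l.
  rewrite expr2; lra.
have H5 : 0 <= x ^+ 2 by rewrite sqr_ge0.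
have H6 : x ^+ 2 <= expR 1 * x ^+ 2 by rewrite ler_peMl.
have H7 : x * (expR x - 1) <= x * x by rewrite ler_wnM2l//; lra.
rewrite expr2 in H6; lra.
Qed.

(** * The integrating factor along a single path *)

Section linear_equation.
Implicit Types x y t U e C : R.
Variables (g u b : R -> R) (T M s : R).
Hypothesis T0 : 0 < T.
Hypothesis mg : measurable_fun `[0, T] g.
Hypothesis gM : forall t, 0 <= t <= T -> `|g t| <= M.
Hypothesis cu : {within `[0, T], continuous u}.
Hypothesis u_eq : forall t, 0 <= t <= T ->
  u t = u 0 + \int[mu]_(r in `[0, t]) (- g r * u r) + s * (b t - b 0).

(** The integrating factor [k] with value 1 at [T]: formally [dk = g k dx], so that
    [d(k u) = s k db]. *)
Definition propagator x := expR (- \int[mu]_(r in `[x, T[) g r).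

Lemma propagator_end : propagator T = 1.
Proof. by rewrite /propagator set_itvco0 Rintegral_set0 oppr0 expR0. Qed.

Let M0 : 0 <= M.
Proof. by apply: le_trans (gM (t := 0) _); rewrite ?normr_ge0// lexx ltW. Qed.

Let bounded_integrable (f : R -> R) C : measurable_fun `[0, T] f ->
  (forall t, 0 <= t <= T -> `|f t| <= C) -> mu.-integrable `[0, T] (EFin \o f).
Proof.
move=> mf fC; apply: measurable_bounded_integrable => //.
  by rewrite /= lebesgue_measure_itv/= lte_fin T0 -EFinD ltry.
exists `|C|; split => // x Cx t; rewrite /= in_itv/= => /fC tC.
by rewrite (le_trans tC)// (le_trans (ler_norm _))// ltW.
Qed.

Lemma within_continuous_bounded : exists2 U, 0 <= U & forall t, 0 <= t <= T -> `|u t| <= U.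
Proof.
have /compact_bounded[U [_ HU]] := continuous_compact cu (@segment_compact R 0 T).
exists (`|U| + 1); first by rewrite addr_ge0.
move=> t t0T; apply: HU; last by exists t => //=; rewrite in_itv.
by rewrite ltr_pwDr// ler_norm.
Qed.

Let ig : mu.-integrable `[0, T] (EFin \o g).
Proof. exact: bounded_integrable gM. Qed.

Let igu : mu.-integrable `[0, T] (EFin \o (fun r => - g r * u r)).
Proof.
have [U U0 HU] := within_continuous_bounded.
apply: (@bounded_integrable _ (M * U)).
  apply: measurable_funM; first exact: measurableT_comp.
  by apply: subspace_continuous_measurable_fun => //; exact: measurable_itv.
by move=> t tT; rewrite normrM normrN ler_pM// ?gM// HU.
Qed.

Let sub_itv x y : 0 <= x -> y <= T -> `[x, y[%classic `<=` `[0, T]%classic.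
Proof. by move=> x0 yT; apply: subset_itvScc; rewrite bnd_simp. Qed.

Let integrable_sub f x y : 0 <= x -> y <= T -> mu.-integrable `[0, T] (EFin \o f) ->
  mu.-integrable `[x, y[ (EFin \o f).
Proof. by move=> x0 yT fi; apply: integrableS fi => //; exact: sub_itv. Qed.

Lemma linear_equation_increment x y : 0 <= x -> x <= y -> y <= T ->
  u y - u x = \int[mu]_(r in `[x, y[) (- g r * u r) + s * (b y - b x).
Proof.
move=> x0 xy yT.
have y0 := le_trans x0 xy; have xT := le_trans xy yT.
rewrite (u_eq (t := y)) ?y0// (u_eq (t := x)) ?x0//.
rewrite -!Rintegral_itv_bndo_bndc; [|exact: integrable_sub igu..].
rewrite (@Rintegral_itv_split _ 0 x y)//; last exact: integrable_sub igu.
by ring.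
Qed.

Lemma propagator_le x : 0 <= x <= T -> propagator x <= expR (M * T).
Proof.
move=> /andP[x0 xT]; rewrite ler_expR; apply: le_trans (ler_norm _) _; rewrite normrN.
apply: le_trans (@normr_Rintegral_itv_le _ _ _ M xT _ _) _.
- exact: integrable_sub ig.
- by move=> t /andP[xt tT]; rewrite gM// (le_trans x0 xt) ltW.
- by rewrite ler_wpM2l//; lra.
Qed.

Let propagator_split x y : 0 <= x -> x <= y -> y <= T ->
  propagator y = propagator x * expR (\int[mu]_(r in `[x, y[) g r).
Proof.
move=> x0 xy yT; rewrite /propagator -expRD; congr expR.
rewrite (@Rintegral_itv_split _ x y T)//; last exact: integrable_sub ig.
by ring.
Qed.

(** On the cell, [propagator y = propagator x * expR G] with [G] the integral of [g]. Replacing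
    [s * (b y - b x)] by means of the equation cancels the first-order terms. What remains is
    [(expR G - 1 - G) * u y], quadratic in the cell length, and the integral of [g r * (u y - u r)],
    small by continuity of [u]. *)
Let residual x y U e : 0 <= x -> x <= y -> y <= T -> M * (y - x) <= 1 ->
  `|u y| <= U -> (forall r, x <= r < y -> `|u y - u r| <= e) ->
  `|propagator y * u y - propagator x * u x - propagator x * (s * (b y - b x))| <=
  expR (M * T) * (expR 1 * (M * (y - x)) ^+ 2 * U + M * (y - x) * e).
Proof.
move=> x0 xy yT M1 yU ue.
have y0 := le_trans x0 xy; have xT := le_trans xy yT.
set G := \int[mu]_(r in `[x, y[) g r.
have GM : `|G| <= M * (y - x).
  apply: normr_Rintegral_itv_le => //; first exact: integrable_sub ig.
  by move=> t /andP[xt ty]; rewrite gM// (le_trans x0 xt) (ltW (lt_le_trans ty yT)).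
have E : propagator y * u y - propagator x * u x - propagator x * (s * (b y - b x)) =
    propagator x * ((expR G - 1 - G) * u y + \int[mu]_(r in `[x, y[) (g r * (u y - u r))).
  rewrite (propagator_split x0 xy yT) -/G.
  have -> : s * (b y - b x) = u y - u x - \int[mu]_(r in `[x, y[) (- g r * u r).
    by rewrite linear_equation_increment//; ring.
  have -> : \int[mu]_(r in `[x, y[) (g r * (u y - u r)) =
      G * u y + \int[mu]_(r in `[x, y[) (- g r * u r).
    rewrite -RintegralZr//; last exact: integrable_sub ig.
    rewrite -RintegralD//; last 2 first.
    - apply: integrable_sub => //.
      rewrite (_ : _ \o _ = (fun r => (EFin \o g) r * (u y)%:E)%E); first exact: integrableZr.
      by apply/funext => r /=; rewrite EFinM.
    - exact: integrable_sub igu.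
    by apply: eq_Rintegral => r _; ring.
  by ring.
rewrite E normrM ler_pM//.
  by rewrite ger0_norm ?expR_ge0// propagator_le// x0.
apply: le_trans (ler_normD _ _) _; apply: lerD.
  rewrite normrM ler_pM//; apply: le_trans (expR_sub1Dx_norm (le_trans GM M1)) _.
  by rewrite ler_wpM2l ?expR_ge0// -real_normK ?num_real// lerXn2r// nnegrE// (le_trans _ GM).
rewrite mulrAC; apply: normr_Rintegral_itv_le => //.
- have -> : EFin \o (fun r => g r * (u y - u r)) =
      (fun r => (EFin \o g) r * (u y)%:E + (EFin \o (fun r => - g r * u r)%R) r)%E.
    by apply/funext => r /=; rewrite -EFinM -EFinD; congr EFin; ring.
  apply: integrableD => //; last exact: integrable_sub igu.
  by apply: integrableZr => //; exact: integrable_sub ig.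
- move=> t tI; rewrite normrM ler_pM// ?ue// gM//.
  by have /andP[xt ty] := tI; rewrite (le_trans x0 xt) (ltW (lt_le_trans ty yT)).
Qed.

(* The sum of the increments of [propagator * u] telescopes; by [residual] each of
   them is the corresponding Riemann term up to [o(T / n)]. *)
Lemma linear_equation_cvg :
  \sum_(i < n.+1) propagator (grid 0 T n.+1 i) *
    (s * (b (grid 0 T n.+1 i.+1) - b (grid 0 T n.+1 i))) @[n --> \oo]
  --> u T - propagator 0 * u 0.
Proof.
have [U U0 HU] := within_continuous_bounded.
pose A := expR (M * T).
have A0 : 0 < A by exact: expR_gt0.
apply/cvgrPdist_le => eps eps0.
(* Chosen so that [A * M * T * e <= eps / 2]; the added 1 keeps the divisor positive. *)
pose e := eps / (2 * (A * M * T + 1)).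
have AMT0 : 0 <= A * M * T by rewrite !mulr_ge0// ltW.
have e0 : 0 < e by rewrite divr_gt0// mulr_gt0// ltr_pwDr.
have [de de0 ude] := within_unif_continuous cu e0.
pose C := A * (expR 1 * M ^+ 2 * U) * T.
have C0 : 0 <= C.
  rewrite /C; apply: mulr_ge0; last exact: ltW.
  apply: mulr_ge0; first exact: ltW.
  by apply: mulr_ge0 => //; apply: mulr_ge0; [exact: expR_ge0|exact: sqr_ge0].
have hcvg := mesh_cvg 0 T.
have h_lt (r : R) : 0 < r -> \forall n \near \oo, (T - 0) / n.+1%:R < r.
  move=> r0; have /cvgrPdist_lt/(_ r r0) := hcvg; apply: filterS => n.
  by rewrite sub0r normrN; apply: le_lt_trans; exact: ler_norm.
have M1 : 0 < M + 1 by rewrite ltr_pwDr.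
have C1 : 0 < C + 1 by rewrite ltr_pwDr.
near=> n.
(* Three requirements on the mesh: [u] varies by at most [e] on a cell, [M * h <= 1] so that
   [expR_sub1Dx_norm] applies, and the quadratic remainders add up to at most [eps / 2]. *)
have hde : (T - 0) / n.+1%:R < de by near: n; exact: h_lt.
have hM1 : (T - 0) / n.+1%:R < (M + 1)^-1 by near: n; apply: h_lt; rewrite invr_gt0.
have hC1 : (T - 0) / n.+1%:R < eps / 2 / (C + 1) by near: n; apply: h_lt; rewrite !divr_gt0.
set h := (T - 0) / n.+1%:R in hde hM1 hC1.
have h0 : 0 <= h by rewrite divr_ge0// subr0 ltW.
have hM : M * h <= 1.
  have : (M + 1) * h <= 1 by rewrite mulrC -ler_pdivlMr// div1r ltW.
  by apply: le_trans; rewrite ler_wpM2r// lerDl.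
have hC : C * h <= eps / 2.
  have : (C + 1) * h <= eps / 2 by rewrite mulrC -ler_pdivlMr// ltW.
  by apply: le_trans; rewrite ler_wpM2r// lerDl.
pose t := grid 0 T n.+1.
have tel : u T - propagator 0 * u 0 =
    \sum_(i < n.+1) (propagator (t i.+1) * u (t i.+1) - propagator (t i) * u (t i)).
  rewrite -(big_mkord xpredT (fun i => propagator (t i.+1) * u (t i.+1) - propagator (t i) * u (t i))).
  by rewrite telescope_sumr// /t gridn grid0 propagator_end mul1r.
rewrite tel -sumrB; apply: le_trans (ler_norm_sum _ _ _) _.
apply: (@le_trans _ _ (\sum_(i < n.+1) A * (expR 1 * (M * h) ^+ 2 * U + M * h * e))).
  apply: ler_sum => i _.
  have /andP[ti0 tiT] : 0 <= t i <= T by apply: grid_itv; [exact: ltW|exact: ltnW].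
  have /andP[ti0' tiT'] : 0 <= t i.+1 <= T by apply: grid_itv; [exact: ltW|exact: ltn_ord].
  have hE : h = t i.+1 - t i by rewrite /t gridS addrC addKr.
  rewrite hE; apply: residual => //.
  - by apply: le_grid => //; exact: ltW.
  - by rewrite -hE.
  - by apply: HU; rewrite ti0'.
  - move=> r /andP[tr rt]; apply: ude; rewrite ?ti0' ?(le_trans ti0 tr) ?(ltW (lt_le_trans rt tiT'))//.
    by rewrite gtr0_norm ?subr_gt0//; apply: le_lt_trans hde; rewrite hE lerB.
rewrite sumr_const card_ord -mulr_natl.
have nh : n.+1%:R * h = T by rewrite /h mulrCA mulfV ?mulr1 ?subr0// pnatr_eq0.
have -> : n.+1%:R * (A * (expR 1 * (M * h) ^+ 2 * U + M * h * e)) =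
    A * (expR 1 * M ^+ 2 * U) * (n.+1%:R * h) * h + A * M * (n.+1%:R * h) * e by ring.
rewrite nh -/C (splitr eps) lerD//.
rewrite /e mulrA ler_pdivrMr; last by rewrite mulr_gt0// ltr_pwDr.
rewrite mulrC (_ : eps / 2 * _ = eps * (A * M * T + 1)); last by field.
by rewrite ler_wpM2l ?(ltW eps0)// lerDl.
Unshelve. all: by end_near.
Qed.

End linear_equation.

End grids.

(** * Mean square approximation of the linear equation with random damping *)

Section adapted_functions.
Context {d : measure_display} {Om : measurableType d} {R : realType}.
Implicit Types (F : set (set Om)) (X Y : Om -> R).

(** [F] becomes the sigma-algebra of a copy of [Om], so that closure properties of measurable
    functions transfer to adapted ones. *)
Lemma adapted_measurable F X : sigma_algebra setT F ->
  adapted F X <-> measurable_fun (setT : set (g_sigma_algebraType F)) (X : g_sigma_algebraType F -> R).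
Proof.
move=> sF; split=> [aX _ A mA|mX A mA].
  by rewrite setTI; apply: sub_sigma_algebra; exact: aX.
have := mX measurableT A mA; rewrite setTI.
by rewrite -[in X in _ -> X](sigma_algebra_id sF).
Qed.

Lemma adapted_cst F c : sigma_algebra setT F -> adapted F (fun=> c : R).
Proof. by move=> sF; apply/adapted_measurable. Qed.

Lemma adaptedM F X Y : sigma_algebra setT F -> adapted F X -> adapted F Y ->
  adapted F (fun w => X w * Y w).
Proof.
move=> sF /(adapted_measurable _ sF) aX /(adapted_measurable _ sF) aY.
by apply/adapted_measurable => //; exact: measurable_funM.
Qed.

Lemma adaptedD F X Y : sigma_algebra setT F -> adapted F X -> adapted F Y ->
  adapted F (fun w => X w + Y w).
Proof.
move=> sF /(adapted_measurable _ sF) aX /(adapted_measurable _ sF) aY.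
by apply/adapted_measurable => //; exact: measurable_funD.
Qed.

Lemma adapted_sum F n (X : 'I_n -> Om -> R) : sigma_algebra setT F ->
  (forall i, adapted F (X i)) -> adapted F (fun w => \sum_(i < n) X i w).
Proof.
move=> sF; elim: n X => [|n ih] X aX.
  by under eq_fun do rewrite big_ord0; exact: adapted_cst.
by under eq_fun do rewrite big_ord_recl; apply: adaptedD => //; exact: ih.
Qed.

Lemma adapted_comp F X (f : R -> R) : measurable_fun setT f -> adapted F X ->
  adapted F (f \o X).
Proof. by move=> mf aX A mA; rewrite comp_preimage -[f @^-1` A]setTI; apply: aX; exact: mf. Qed.

Lemma sub_adapted F F' X : F `<=` F' -> adapted F X -> adapted F' X.
Proof. by move=> FF aX A mA; apply: FF; exact: aX. Qed.

(** A superior limit of adapted variables is adapted without adding null sets; [fine] assigns 0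
    where it is infinite. *)
Lemma adapted_limn_sup F (X : nat -> Om -> R) : sigma_algebra setT F ->
  (forall n, adapted F (X n)) -> adapted F (fun w => fine (limn_esup (fun n => (X n w)%:E))).
Proof.
move=> sF aX; apply/adapted_measurable => //.
apply: (measurable_comp measurableT (@subsetT _ _) (@fine_measurable R _ measurableT)).
by apply: measurable_fun_limn_esup => n; apply/measurable_EFinP/adapted_measurable.
Qed.

Lemma sigma_algebra_rv X : sigma_algebra setT (sigma_rv X).
Proof. by apply: sigma_algebra_preimage; exact: sigma_algebra_measurable. Qed.

Lemma adapted_rv X : adapted (sigma_rv X) X.
Proof. by move=> A mA; exists A => //; rewrite setTI. Qed.

Lemma sigma_algebra_path (X : R -> Om -> R) : sigma_algebra setT (sigma_path X).
Proof. exact: smallest_sigma_algebra. Qed.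

Lemma adapted_path (X : R -> Om -> R) t : 0 <= t -> adapted (sigma_path X) (X t).
Proof.
move=> t0 A mA; apply: sub_sigma_algebra; exists t => //.
by exists A => //; rewrite setTI.
Qed.

Lemma adapted_path_increment (X : R -> Om -> R) s t : 0 <= s -> 0 <= t ->
  adapted (sigma_path X) (fun w => X t w - X s w).
Proof.
move=> s0 t0; have sX := sigma_algebra_path X.
apply: adaptedD => //; first exact: adapted_path.
by apply: (@adapted_comp _ (X s) -%R) => //; exact: adapted_path.
Qed.

End adapted_functions.

(** * Independence and the discrete isometry *)

Section independence.
Context {d : measure_display} {Om : measurableType d} {R : realType}.
Variable P : probability Om R.
Local Notation Ex := (Rintegral P setT).

Lemma mutually_independent_pair (I : finType) (F : I -> set (set Om)) i j :
  mutually_independent P F -> i != j -> indep P (F i) (F j).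
Proof.
move=> iF ij A B FA FB.
pose C k := if k == i then A else B.
have := iF [set i; j]%SET C.
have CF k : k \in [set i; j]%SET -> F k (C k).
  rewrite /C !inE; case: eqVneq => [->//|_ /=] /eqP ->.
  by [].
move=> /(_ CF); rewrite big_setU1 ?inE//= big_set1/=.
rewrite {2 3}/C eqxx eq_sym (negbTE ij) => <-; congr (P _).
apply/seteqP; split => w /=.
  by move=> [Aw Bw] k; rewrite /= !inE /C => /orP[] /eqP ->; rewrite ?eqxx// eq_sym (negbTE ij).
move=> H; split.
  by have := H i; rewrite /C eqxx; apply; rewrite /= !inE eqxx.
by have := H j; rewrite /C eq_sym (negbTE ij); apply; rewrite /= !inE eqxx orbT.
Qed.

(** Independence of all the [X i] from all the [Y i] factors the expectation of
    [X i * X j * Y i * Y j], and orthogonality of the [Y i] removes the terms off the diagonal. No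
    filtration is involved, so the [X i] may depend on the future of the damping. *)
Lemma discrete_isometry F G n (X Y : 'I_n -> Om -> R) :
  sigma_algebra setT F -> sigma_algebra setT G -> indep P F G ->
  (forall i, adapted F (X i)) -> (forall i, adapted G (Y i)) ->
  (forall i, X i \in Lfun P 2%:E) -> (forall i, Y i \in Lfun P 2%:E) ->
  (forall i j, i != j -> Ex (fun w => Y i w * Y j w) = 0) ->
  let S w := \sum_(i < n) X i w * Y i w in
  S \in Lfun P 2%:E /\
  Ex (fun w => S w ^+ 2) = \sum_(i < n) Ex (fun w => X i w ^+ 2) * Ex (fun w => Y i w ^+ 2).
Proof.
move=> sF sG FG aX aY X2 Y2 orth S.
have XY2 i : (fun w => X i w * Y i w) \in Lfun P 2%:E.
  apply: Lfun2P.
    by apply: measurable_funM; [exact: Lfun_measurable (X2 i)|exact: Lfun_measurable (Y2 i)].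
  under eq_fun do rewrite exprMn.
  case: (@indep_Lfun1M _ _ _ P F G (fun w => X i w ^+ 2) (fun w => Y i w ^+ 2) FG) => //.
  - exact: adaptedM.
  - exact: adaptedM.
  - exact: Lfun2_sqr.
  - exact: Lfun2_sqr.
have prod i j : Ex (fun w => (X i w * Y i w) * (X j w * Y j w)) =
    Ex (fun w => X i w * X j w) * Ex (fun w => Y i w * Y j w).
  have [_ <-] := @indep_Lfun1M _ _ _ P F G (fun w => X i w * X j w) (fun w => Y i w * Y j w) FG
    (adaptedM sF (aX i) (aX j)) (adaptedM sG (aY i) (aY j))
    (Lfun2_mul_Lfun1 (X2 i) (X2 j)) (Lfun2_mul_Lfun1 (Y2 i) (Y2 j)).
  by apply: eq_Rintegral => w _; ring.
have S2 : S \in Lfun P 2%:E by exact: Lfun2_sum.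
split => //.
have -> : Ex (fun w => S w ^+ 2) =
    Ex (fun w => \sum_(i < n) \sum_(j < n) (X i w * Y i w) * (X j w * Y j w)).
  apply: eq_Rintegral => w _; rewrite expr2 mulr_suml; apply: eq_bigr => i _.
  by rewrite mulr_sumr.
rewrite Ex_sum; last by move=> i; apply: Lfun1_sum => j; exact: Lfun2_mul_Lfun1.
apply: eq_bigr => i _; rewrite Ex_sum; last by move=> j; exact: Lfun2_mul_Lfun1.
rewrite (bigD1 i)//= big1 ?addr0.
  by rewrite prod; congr (_ * _); apply: eq_Rintegral => w _; rewrite expr2.
by move=> j ji; rewrite prod orth ?mulr0// eq_sym.
Qed.

End independence.

Section brownian_increments.
Context {d : measure_display} {Om : measurableType d} {R : realType}.
Variables (P : probability Om R) (B : R -> Om -> R).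
Hypothesis hB : brownian_motion P B.
Local Notation Ex := (Rintegral P setT).

Lemma bm_increment_Lfun2 s t : 0 <= s -> s <= t -> (fun w => B t w - B s w) \in Lfun P 2%:E.
Proof. by move=> s0 st; exact: gaussian_Lfun2 (bm_increment hB s0 st). Qed.

Lemma bm_increment_sqr s t : 0 <= s -> s <= t ->
  Ex (fun w => (B t w - B s w) ^+ 2) <= 8 * expR 1 * (t - s).
Proof.
move=> s0 st; apply: le_trans (centered_gaussian_sqr_le (bm_increment hB s0 st)) _.
by rewrite sqr_sqrtr// subr_ge0.
Qed.

Lemma bm_increment_mean s t : 0 <= s -> s <= t -> Ex (fun w => B t w - B s w) = 0.
Proof. by move=> s0 st; exact: centered_gaussian_mean (bm_increment hB s0 st). Qed.

Lemma bm_grid_orthogonal (T : R) n (i j : 'I_n) : 0 <= T -> i != j ->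
  Ex (fun w => (B (grid 0 T n i.+1) w - B (grid 0 T n i) w) *
               (B (grid 0 T n j.+1) w - B (grid 0 T n j) w)) = 0.
Proof.
move=> T0 ij.
have g0 k : 0 <= grid 0 T n k by rewrite -{1}(grid0 0 T n) le_grid.
have gS k : grid 0 T n k <= grid 0 T n k.+1 by apply: le_grid.
have iB := mutually_independent_pair (bm_independent hB (n := n) (g0 0) gS) ij.
have [_ ->] := indep_Lfun1M iB (@adapted_rv _ _ _ _) (@adapted_rv _ _ _ _)
  (Lfun2_Lfun1 (bm_increment_Lfun2 (g0 i) (gS i))) (Lfun2_Lfun1 (bm_increment_Lfun2 (g0 j) (gS j))).
by rewrite bm_increment_mean// mul0r.
Qed.

(** The cell widths add up to [T]. The bound [8 * expR 1 * (t - s)] replaces the exact variance of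
    an increment, since only the order of magnitude matters. *)
Lemma bm_discrete_integral F (T : R) n (X : 'I_n -> Om -> R) c :
  0 <= T -> (0 < n)%N -> sigma_algebra setT F -> indep P F (sigma_path B) ->
  (forall i, adapted F (X i)) -> (forall i, X i \in Lfun P 2%:E) ->
  (forall i, Ex (fun w => X i w ^+ 2) <= c) ->
  let S w := \sum_(i < n) X i w * (B (grid 0 T n i.+1) w - B (grid 0 T n i) w) in
  S \in Lfun P 2%:E /\ Ex (fun w => S w ^+ 2) <= c * (8 * expR 1 * T).
Proof.
move=> T0 n0 sF FB aX X2 Xc S.
have g0 k : 0 <= grid 0 T n k by rewrite -{1}(grid0 0 T n) le_grid.
have gS k : grid 0 T n k <= grid 0 T n k.+1 by apply: le_grid.
case: (@discrete_isometry _ _ _ P F (sigma_path B) n X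
  (fun i w => B (grid 0 T n i.+1) w - B (grid 0 T n i) w) sF (sigma_algebra_path B) FB aX) => //.
- by move=> i; exact: adapted_path_increment.
- by move=> i; exact: bm_increment_Lfun2.
- by move=> i j ij; exact: bm_grid_orthogonal.
move=> S2 SE; split => //; rewrite SE.
apply: (@le_trans _ _ (\sum_(i < n) c * (8 * expR 1 * (T / n%:R)))).
  apply: ler_sum => i _; apply: ler_pM => //.
  - by apply: Ex_ge0 => w; exact: sqr_ge0.
  - by apply: Ex_ge0 => w; exact: sqr_ge0.
  - apply: le_trans (bm_increment_sqr (g0 i) (gS i)) _.
    by rewrite gridS (addrC (grid _ _ _ _)) addrK subr0.
rewrite sumr_const card_ord -mulr_natl.
have nn : n%:R != 0 :> R by rewrite pnatr_eq0 -lt0n.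
by rewrite le_eqVlt; apply/orP; left; apply/eqP; field.
Qed.

End brownian_increments.

Section discretization.
Context {R : realType}.

(** The fine cells [j] with [j %/ l = i] subdivide the coarse cell [i], and the increments of [b]
    over them telescope. *)
Lemma refine_discrete_integral (k b : R -> R) (T : R) n l : (0 < n)%N -> (0 < l)%N ->
  \sum_(i < n) k (grid 0 T n i) * (b (grid 0 T n i.+1) - b (grid 0 T n i)) =
  \sum_(j < n * l) k (grid 0 T n (j %/ l)) *
    (b (grid 0 T (n * l) j.+1) - b (grid 0 T (n * l) j)).
Proof.
move=> n0 l0.
have gE i : grid 0 T (n * l) (i * l) = grid 0 T n i.
  rewrite /grid !natrM; congr (_ + _).
  by field; rewrite !pnatr_eq0 -!lt0n n0.
rewrite -(big_mkord xpredT (fun i => k (grid 0 T n i) * (b (grid 0 T n i.+1) - b (grid 0 T n i)))).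
rewrite -(big_mkord xpredT (fun j => k (grid 0 T n (j %/ l)) *
    (b (grid 0 T (n * l) j.+1) - b (grid 0 T (n * l) j)))).
rewrite big_nat_mul; apply: eq_bigr => i _.
rewrite -!gE -(telescope_sumr (fun j => b (grid 0 T (n * l) j))) ?leq_mul2r ?leqnSn ?orbT//.
rewrite mulr_sumr [LHS]big_nat_cond [RHS]big_nat_cond; apply: eq_bigr => j.
rewrite andbT => /andP[ij ji].
suff -> : (j %/ l)%N = i by rewrite gE.
by apply/eqP; rewrite eqn_leq -ltnS ltn_divLR// ji leq_divRL.
Qed.

Lemma fine_grid_dist (T : R) n l j : 0 <= T -> (0 < n)%N -> (0 < l)%N -> (j < n * l)%N ->
  [/\ 0 <= grid 0 T (n * l) j <= T, 0 <= grid 0 T n (j %/ l) <= T &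
      `|grid 0 T (n * l) j - grid 0 T n (j %/ l)| <= T / n%:R].
Proof.
move=> T0 n0 l0 jnl.
have gE i : grid 0 T (n * l) (i * l) = grid 0 T n i.
  rewrite /grid !natrM; congr (_ + _).
  by field; rewrite !pnatr_eq0 -!lt0n n0.
have gT : grid 0 T (n * l) (n * l) = T.
  by rewrite gE -(prednK n0) gridn.
have H1 : grid 0 T n (j %/ l) <= grid 0 T (n * l) j by rewrite -gE le_grid// leq_divM.
have H2 : grid 0 T (n * l) j <= grid 0 T n (j %/ l).+1.
  by rewrite -gE le_grid// mulSn addnC ltnW// {1}(divn_eq j l) ltn_add2l ltn_pmod.
have H3 : grid 0 T (n * l) j <= T by rewrite -[leRHS]gT le_grid// ltnW.
have H4 : 0 <= grid 0 T n (j %/ l) by rewrite -{1}(grid0 0 T n) le_grid.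
split; rewrite ?H3 ?H4 ?(le_trans H4 H1) ?(le_trans H1 H3)//.
by rewrite ger0_norm ?subr_ge0//; move: H2; rewrite gridS subr0; lra.
Qed.

End discretization.

(** * Mean square distance to the discretization *)

Section linear_sde.
Context {d : measure_display} {Om : measurableType d} {R : realType}.
Variable P : probability Om R.
Local Notation Ex := (Rintegral P setT).

Definition discrete_solution (su T : R) (k : R -> R) (B : R -> Om -> R) (u0 : Om -> R)
    (n : nat) (w : Om) : R :=
  k 0 * u0 w + su * \sum_(i < n.+1) k (grid 0 T n.+1 i) *
    (B (grid 0 T n.+1 i.+1) w - B (grid 0 T n.+1 i) w).

Lemma linear_sde_cvg (g u B : R -> Om -> R) (su T : R) : 0 < T ->
  additive_sde P (fun t w => - g t w * u t w) su B u ->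
  (\forall w \ae P, measurable_fun `[0, T] (g^~ w) /\
     exists M, forall t, 0 <= t <= T -> `|g t w| <= M) ->
  \forall w \ae P,
    propagator (g^~ w) T 0 * u 0 w + su * \sum_(i < n.+1) propagator (g^~ w) T (grid 0 T n.+1 i) *
      (B (grid 0 T n.+1 i.+1) w - B (grid 0 T n.+1 i) w) @[n --> \oo] --> u T w.
Proof.
move=> T0 [_ cu eqn] hg; near=> w.
have [mg [M gM]] : measurable_fun `[0, T] (g^~ w) /\
    exists M, forall t, 0 <= t <= T -> `|g t w| <= M by near: w.
have cw : {within `[0, T], continuous (u^~ w)}.
  have : {within [set t | 0 <= t], continuous (u^~ w)} by near: w.
  by apply: continuous_subspaceW => t /=; rewrite in_itv/= => /andP[].
have ew : forall t, 0 <= t ->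
    lebesgue_measure.-integrable `[0, t] (fun r => (- g r w * u r w)%:E) /\
    u t w = u 0 w + \int[lebesgue_measure]_(r in `[0, t]) (- g r w * u r w)
            + su * (B t w - B 0 w) by near: w.
have := @linear_equation_cvg _ (g^~ w) (u^~ w) (B^~ w) T M su T0 mg gM cw.
move=> /(_ _) H.
rewrite -[X in _ --> X](subrKC (propagator (g^~ w) T 0 * u 0 w)).
apply: cvgD; first exact: cvg_cst.
have -> : (fun n => su * \sum_(i < n.+1) propagator (g^~ w) T (grid 0 T n.+1 i) *
      (B (grid 0 T n.+1 i.+1) w - B (grid 0 T n.+1 i) w)) =
   (fun n => \sum_(i < n.+1) propagator (g^~ w) T (grid 0 T n.+1 i) *
      (su * (B (grid 0 T n.+1 i.+1) w - B (grid 0 T n.+1 i) w))).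
  by apply/funext => n; rewrite mulr_sumr; apply: eq_bigr => i _; ring.
by apply: H => t /andP[t0 _]; have [] := ew t t0.
Unshelve. all: by end_near.
Qed.

Variables (g u B K : R -> Om -> R) (F : set (set Om)) (k : R -> R) (su T L de : R).
Hypothesis T0 : 0 < T.
Hypothesis hB : brownian_motion P B.
Hypothesis hu : additive_sde P (fun t w => - g t w * u t w) su B u.
Hypothesis u2 : u 0 \in Lfun P 2%:E.
Hypothesis hg : \forall w \ae P, measurable_fun `[0, T] (g^~ w) /\
  exists M, forall t, 0 <= t <= T -> `|g t w| <= M.
Hypothesis sF : sigma_algebra setT F.
Hypothesis FB : indep P F (sigma_path B).
Hypothesis Fu : indep P F (sigma_rv (u 0)).
(** [K x] is a version of the propagator that is exactly adapted to [F]. It equals the propagator of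
    the path outside a null set depending on [x], which is harmless because only countably many grid
    points occur. *)
Hypothesis aK : forall x : R, 0 <= x <= T -> adapted F (K x).
Hypothesis KE : forall x : R, 0 <= x <= T -> \forall w \ae P, K x w = propagator (g^~ w) T x.
Hypothesis k_lip : forall x y : R, 0 <= x <= T -> 0 <= y <= T -> `|k x - k y| <= L * `|x - y|.
Hypothesis Kk : forall x : R, 0 <= x <= T ->
  (fun w => K x w - k x) \in Lfun P 2%:E /\ Ex (fun w => (K x w - k x) ^+ 2) <= de.

Let sqrD (x y : R) : (x + y) ^+ 2 <= 2 * x ^+ 2 + 2 * y ^+ 2.
Proof. by have := sqr_ge0 (x - y); rewrite !expr2; lra. Qed.

(* On the grid with [n.+1 * l.+1] cells, [discrete_solution] is the Riemann sum of the
   step function that freezes [k] on the [n.+1] coarse cells. Hence the isometry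
   bounds the distance to the fine Riemann sum of [K] uniformly in [l], and Fatou's
   lemma applies as [l] tends to infinity. *)
Lemma linear_sde_discretization n :
  (fun w => u T w - discrete_solution su T k B (u 0) n w) \in Lfun P 2%:E /\
  Ex (fun w => (u T w - discrete_solution su T k B (u 0) n w) ^+ 2) <=
    2 * (de * Ex (fun w => u 0 w ^+ 2)) +
    2 * (su ^+ 2 * ((2 * de + 2 * (L * (T / n.+1%:R)) ^+ 2) * (8 * expR 1 * T))).
Proof.
have T0' := ltW T0.
have h0 : 0 <= (0 : R) <= T by rewrite lexx.
have [Kk02 Kk0de] := Kk h0.
have de0 : 0 <= de by apply: le_trans Kk0de; apply: Ex_ge0 => w; exact: sqr_ge0.
have aKk (x c : R) : 0 <= x <= T -> adapted F (fun w => K x w - c).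
  by move=> xT; apply: adaptedD; [exact: sF|exact: aK|exact: adapted_cst].
(* [a] is the error in the coefficient of the initial value; [S] below collects the errors in the
   coefficients of the Brownian increments. *)
pose a w := (K 0 w - k 0) * u 0 w.
have [a1 aE] := indep_Lfun1M Fu (adaptedM sF (aKk 0 (k 0) h0) (aKk 0 (k 0) h0))
  (adaptedM (sigma_algebra_rv _) (@adapted_rv _ _ _ (u 0)) (@adapted_rv _ _ _ (u 0)))
  (Lfun2_sqr Kk02) (Lfun2_sqr u2).
have a2 : a \in Lfun P 2%:E.
  apply: Lfun2P.
    by apply: measurable_funM; [exact: Lfun_measurable Kk02|exact: Lfun_measurable u2].
  by under eq_fun do rewrite /a exprMn.
have aEx : Ex (fun w => a w ^+ 2) <= de * Ex (fun w => u 0 w ^+ 2).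
  have -> : Ex (fun w => a w ^+ 2) = Ex (fun w => (K 0 w - k 0) ^+ 2) * Ex (fun w => u 0 w ^+ 2).
    by rewrite -aE; apply: eq_Rintegral => w _; rewrite /a exprMn.
  by rewrite ler_wpM2r//; apply: Ex_ge0 => w; exact: sqr_ge0.
pose N l := (n.+1 * l.+1)%N.
pose s l j := grid 0 T (N l) j.
pose X l (j : 'I_(N l)) w := K (s l j) w - k (grid 0 T n.+1 (j %/ l.+1)).
pose S l w := \sum_(j < N l) X l j w * (B (s l j.+1) w - B (s l j) w).
pose D l w := a w + su * S l w.
have XP l (j : 'I_(N l)) : X l j \in Lfun P 2%:E /\
    Ex (fun w => X l j w ^+ 2) <= 2 * de + 2 * (L * (T / n.+1%:R)) ^+ 2.
  have [sj tj st] := @fine_grid_dist R T n.+1 l.+1 j T0' isT isT (ltn_ord j).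
  set c := k (s l j) - k (grid 0 T n.+1 (j %/ l.+1)).
  have XE w : X l j w = (K (s l j) w - k (s l j)) + c by rewrite /X /c; ring.
  have [Ks2 Ksde] := Kk sj.
  have X2 : X l j \in Lfun P 2%:E.
    rewrite (_ : X l j = fun w => (K (s l j) w - k (s l j)) + c); last exact/funext.
    by apply: Lfun2D => //; exact: Lfun2_cst.
  split => //.
  apply: (@le_trans _ _ (Ex (fun w => 2 * (K (s l j) w - k (s l j)) ^+ 2 + 2 * c ^+ 2))).
    apply: le_Ex; first exact: Lfun2_sqr.
      by apply: Lfun1D; [apply: Lfun1Z; exact: Lfun2_sqr|exact: Lfun1_cst].
    by move=> w; rewrite XE; exact: sqrD.
  have Q1 : (fun w => (K (s l j) w - k (s l j)) ^+ 2) \in Lfun P 1 := Lfun2_sqr Ks2.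
  rewrite ExD; [|exact: Lfun1Z|exact: Lfun1_cst].
  rewrite ExZ// Ex_cst.
  rewrite lerD// ler_wpM2l// -real_normK ?num_real//.
  have cL : `|c| <= L * (T / n.+1%:R).
    apply: le_trans (k_lip sj tj) _; rewrite ler_wpM2l//.
    (* [0 <= L] is read off from the Lipschitz bound between the endpoints, as [0 < T]. *)
    have := k_lip (x := 0) (y := T) h0; rewrite T0' lexx => /(_ isT).
    rewrite sub0r normrN (gtr0_norm T0) => H.
    by rewrite -(pmulr_lge0 _ T0); exact: le_trans H.
  by rewrite lerXn2r// nnegrE// (le_trans _ cL).
have [S2 SE] : (forall l, S l \in Lfun P 2%:E) /\ (forall l, Ex (fun w => S l w ^+ 2) <=
    (2 * de + 2 * (L * (T / n.+1%:R)) ^+ 2) * (8 * expR 1 * T)).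
  have SP l : S l \in Lfun P 2%:E /\ Ex (fun w => S l w ^+ 2) <=
      (2 * de + 2 * (L * (T / n.+1%:R)) ^+ 2) * (8 * expR 1 * T).
    apply: (bm_discrete_integral hB T0' _ sF FB) => //.
    - move=> j; apply: aKk.
      by have [] := @fine_grid_dist R T n.+1 l.+1 j T0' isT isT (ltn_ord j).
    - by move=> j; have [] := XP l j.
    - by move=> j; have [] := XP l j.
  by split => l; have [] := SP l.
have D2 l : D l \in Lfun P 2%:E by apply: Lfun2D => //; exact: Lfun2Z.
set C := _ + _.
have DC l : Ex (fun w => D l w ^+ 2) <= C.
  apply: (@le_trans _ _ (Ex (fun w => 2 * a w ^+ 2 + 2 * (su ^+ 2 * S l w ^+ 2)))).
    apply: le_Ex; first exact: Lfun2_sqr.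
      by apply: Lfun1D; apply: Lfun1Z; [|apply: Lfun1Z]; exact: Lfun2_sqr.
    by move=> w; rewrite -exprMn; exact: sqrD.
  have S1 : (fun w => su ^+ 2 * S l w ^+ 2) \in Lfun P 1 by apply: Lfun1Z; exact: Lfun2_sqr.
  rewrite ExD; [|by apply: Lfun1Z; exact: Lfun2_sqr|exact: Lfun1Z].
  rewrite !ExZ//; [|exact: Lfun2_sqr..].
  rewrite /C lerD// ler_wpM2l// ler_wpM2l// sqr_ge0//.
have mD : measurable_fun setT (fun w => u T w - discrete_solution su T k B (u 0) n w).
  apply: measurable_funB; first exact: sde_measurable hu _ T0'.
  apply: measurable_funD; first by apply: measurable_funM => //; exact: Lfun_measurable u2.
  apply: measurable_funM => //; apply: measurable_sum => i.
  apply: measurable_funM => //; apply: measurable_funB; apply: (bm_measurable hB).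
    by have /andP[] := grid_itv T0' (ltn_ord i).
  by have /andP[] := grid_itv T0' (ltnW (ltn_ord i)).
have Dcvg : \forall w \ae P, D l w ^+ 2 @[l --> \oo] -->
    (u T w - discrete_solution su T k B (u 0) n w) ^+ 2.
  (* By countability, one null set serves every node of every grid. *)
  have KEall : \forall w \ae P, forall m i, (i <= m.+1)%N ->
      K (grid 0 T m.+1 i) w = propagator (g^~ w) T (grid 0 T m.+1 i).
    apply/ae_foralln => m; apply/ae_foralln => i.
    have [im|im] := leqP i m.+1; last exact: aeW.
    by apply: filterS (KE (grid_itv T0' im)).
  have cvgu := linear_sde_cvg T0 hu hg.
  near=> w.
  have Kw : forall m i, (i <= m.+1)%N ->
      K (grid 0 T m.+1 i) w = propagator (g^~ w) T (grid 0 T m.+1 i) by near: w.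
  have uw : propagator (g^~ w) T 0 * u 0 w +
      su * \sum_(i < m.+1) propagator (g^~ w) T (grid 0 T m.+1 i) *
      (B (grid 0 T m.+1 i.+1) w - B (grid 0 T m.+1 i) w) @[m --> \oo] --> u T w by near: w.
  (* [linear_sde_cvg] indexes the grid with [m.+1] cells by [m], so the grids with [N l] cells form
     the subsequence [(N l).-1]. *)
  have cN : (N l).-1 @[l --> \oo] --> \oo.
    apply/cvgnyPge => A; exists A => // l /= Al.
    by apply: leq_trans Al _; exact: leq_addr.
  have uN := cvg_comp _ _ cN uw.
  suff Dw : D l w @[l --> \oo] --> u T w - discrete_solution su T k B (u 0) n w.
    by rewrite expr2; under eq_fun do rewrite expr2; exact: cvgM.
  have -> : D ^~ w = fun l => (propagator (g^~ w) T 0 * u 0 w +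
      su * \sum_(i < (N l).-1.+1) propagator (g^~ w) T (grid 0 T (N l).-1.+1 i) *
      (B (grid 0 T (N l).-1.+1 i.+1) w - B (grid 0 T (N l).-1.+1 i) w)) -
      discrete_solution su T k B (u 0) n w.
    apply/funext => l; rewrite /D /a /S prednK// /discrete_solution.
    rewrite (refine_discrete_integral k (B^~ w) T (l := l.+1))// -/(N l).
    have -> : \sum_(j < N l) X l j w * (B (s l j.+1) w - B (s l j) w) =
      \sum_(j < N l) propagator (g^~ w) T (s l j) * (B (s l j.+1) w - B (s l j) w) -
      \sum_(j < N l) k (grid 0 T n.+1 (j %/ l.+1)) * (B (s l j.+1) w - B (s l j) w).
      rewrite -sumrB; apply: eq_bigr => j _; rewrite /X mulrBl.
      have := Kw (N l).-1 j; rewrite prednK// => -> //; exact: ltnW.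
    have := Kw 0%N 0%N isT; rewrite grid0 => ->; rewrite /s; ring.
  apply: cvgB; [exact: uN|exact: cvg_cst].
have [H1 H2] := @fatou_Ex _ _ _ P (fun l w => D l w ^+ 2)
  (fun w => (u T w - discrete_solution su T k B (u 0) n w) ^+ 2) C (fun=> C)
  (fun l => Lfun2_sqr (D2 l)) (fun l w => sqr_ge0 _) (measurable_funX 2 mD) (fun w => sqr_ge0 _)
  Dcvg DC (cvg_cst _).
split => //; exact: Lfun2P.
Unshelve. all: by end_near.
Qed.

End linear_sde.

(** * Convergence of moments *)

Section discrete_moments.
Context {d : measure_display} {Om : measurableType d} {R : realType}.
Variables (P : probability Om R) (B : R -> Om -> R) (u0 : Om -> R) (k : R -> R) (su T : R).
Hypothesis T0 : 0 <= T.
Hypothesis hB : brownian_motion P B.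
Hypothesis u02 : u0 \in Lfun P 2%:E.
Hypothesis uB : indep P (sigma_rv u0) (sigma_path B).
Local Notation Ex := (Rintegral P setT).

(** The isometry with deterministic coefficients; the cross term vanishes because the sum of
    increments is centered and independent of [u0]. The second moments of the increments stay
    unevaluated: the comparison of models only requires that they depend on the law alone. *)
Lemma discrete_solution_moments n :
  [/\ discrete_solution su T k B u0 n \in Lfun P 2%:E,
      Ex (discrete_solution su T k B u0 n) = k 0 * Ex u0 &
      Ex (fun w => discrete_solution su T k B u0 n w ^+ 2) =
        k 0 ^+ 2 * Ex (fun w => u0 w ^+ 2) +
        su ^+ 2 * \sum_(i < n.+1) k (grid 0 T n.+1 i) ^+ 2 *
          Ex (fun w => (B (grid 0 T n.+1 i.+1) w - B (grid 0 T n.+1 i) w) ^+ 2)].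
Proof.
have g0 j : 0 <= grid 0 T n.+1 j by rewrite -{1}(grid0 0 T n.+1) le_grid.
have gS j : grid 0 T n.+1 j <= grid 0 T n.+1 j.+1 by apply: le_grid.
pose S w := \sum_(i < n.+1) k (grid 0 T n.+1 i) *
    (B (grid 0 T n.+1 i.+1) w - B (grid 0 T n.+1 i) w).
have dB2 (i : 'I_n.+1) : (fun w => B (grid 0 T n.+1 i.+1) w - B (grid 0 T n.+1 i) w) \in Lfun P 2%:E.
  exact: (bm_increment_Lfun2 hB).
have aB (i : 'I_n.+1) : adapted (sigma_path B) (fun w => B (grid 0 T n.+1 i.+1) w - B (grid 0 T n.+1 i) w).
  exact: adapted_path_increment.
have [S2 SE] := @discrete_isometry _ _ _ P (sigma_rv u0) (sigma_path B) n.+1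
  (fun i w => k (grid 0 T n.+1 i))
  (fun i w => B (grid 0 T n.+1 i.+1) w - B (grid 0 T n.+1 i) w)
  (sigma_algebra_rv u0) (sigma_algebra_path B) uB
  (fun i => adapted_cst _ (sigma_algebra_rv u0)) aB (fun i => Lfun2_cst P _) dB2
  (fun i j => bm_grid_orthogonal hB T0).
have S0 : Ex S = 0.
  rewrite /S Ex_sum; last by move=> i; apply: Lfun1Z; exact: Lfun2_Lfun1.
  rewrite big1// => i _; rewrite ExZ; last exact: Lfun2_Lfun1.
  by rewrite (bm_increment_mean hB)// mulr0.
have aS : adapted (sigma_path B) S.
  apply: adapted_sum; first exact: sigma_algebra_path.
  by move=> i; apply: adaptedM; [exact: sigma_algebra_path|apply: adapted_cst; exact: sigma_algebra_path|].
have [uS1 uSE] := indep_Lfun1M uB (@adapted_rv _ _ _ u0) aS (Lfun2_Lfun1 u02) (Lfun2_Lfun1 S2).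
have ku2 : (fun w => k 0 * u0 w) \in Lfun P 2%:E by exact: Lfun2Z.
have sS2 : (fun w => su * S w) \in Lfun P 2%:E by exact: Lfun2Z.
split.
- exact: Lfun2D.
- rewrite /discrete_solution ExD; [|exact: Lfun2_Lfun1|exact: Lfun2_Lfun1].
  by rewrite !ExZ; [rewrite S0 mulr0 addr0|exact: Lfun2_Lfun1|exact: Lfun2_Lfun1].
have us1 : (fun w => 2 * k 0 * su * (u0 w * S w)) \in Lfun P 1 by exact: Lfun1Z.
have u1 : (fun w => k 0 ^+ 2 * u0 w ^+ 2) \in Lfun P 1 by apply: Lfun1Z; exact: Lfun2_sqr.
have s1 : (fun w => su ^+ 2 * S w ^+ 2) \in Lfun P 1 by apply: Lfun1Z; exact: Lfun2_sqr.
transitivity (Ex (fun w => (k 0 ^+ 2 * u0 w ^+ 2 + su ^+ 2 * S w ^+ 2) + 2 * k 0 * su * (u0 w * S w))).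
  by apply: eq_Rintegral => w _; rewrite /discrete_solution -/(S w); ring.
rewrite ExD//; last exact: Lfun1D.
rewrite ExD// !ExZ//; [|exact: Lfun2_sqr|exact: Lfun2_sqr].
rewrite uSE S0 !mulr0 addr0 SE; congr (_ + _ * _); apply: eq_bigr => i _.
by rewrite Ex_cst.
Qed.

(** A bound uniform in [n]: it controls the term of [moments_close] that carries the second moment
    of the discretization while [n] tends to infinity. *)
Lemma discrete_solution_sqr_le n c : (forall x, 0 <= x <= T -> k x ^+ 2 <= c) ->
  Ex (fun w => discrete_solution su T k B u0 n w ^+ 2) <=
    c * Ex (fun w => u0 w ^+ 2) + su ^+ 2 * (c * (8 * expR 1 * T)).
Proof.
move=> kc; have [_ _ ->] := discrete_solution_moments n.
have g0 j : 0 <= grid 0 T n.+1 j by rewrite -{1}(grid0 0 T n.+1) le_grid.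
have gS j : grid 0 T n.+1 j <= grid 0 T n.+1 j.+1 by apply: le_grid.
apply: lerD.
  by rewrite ler_wpM2r ?kc ?lexx//; apply: Ex_ge0 => w; exact: sqr_ge0.
rewrite ler_wpM2l ?sqr_ge0//.
apply: (@le_trans _ _ (\sum_(i < n.+1) c * (8 * expR 1 * (T / n.+1%:R)))).
  apply: ler_sum => i _; apply: ler_pM.
  - exact: sqr_ge0.
  - by apply: Ex_ge0 => w; exact: sqr_ge0.
  - by apply: kc; apply: grid_itv => //; exact: ltnW.
  - apply: le_trans (bm_increment_sqr hB (g0 i) (gS i)) _.
    by rewrite gridS (addrC (grid _ _ _ _)) addrK subr0.
rewrite sumr_const card_ord -mulr_natl.
by rewrite le_eqVlt; apply/orP; left; apply/eqP; field; rewrite nat1r pnatr_eq0.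
Qed.

End discrete_moments.

Section same_moments.
Context {R : realType} {d d' : measure_display} {Om : measurableType d} {Om' : measurableType d'}.
Variables (P : probability Om R) (P' : probability Om' R).
Variables (B : R -> Om -> R) (B' : R -> Om' -> R) (u0 : Om -> R) (u0' : Om' -> R).
Variables (k : R -> R) (su T m0 s0 : R).
Hypotheses (T0 : 0 <= T) (hB : brownian_motion P B) (hB' : brownian_motion P' B').
Hypotheses (lu : has_law P u0 (gaussian m0 s0)) (lu' : has_law P' u0' (gaussian m0 s0)).
Hypotheses (uB : indep P (sigma_rv u0) (sigma_path B)) (uB' : indep P' (sigma_rv u0') (sigma_path B')).

Lemma discrete_solution_same_moments n :
  Rintegral P setT (discrete_solution su T k B u0 n) =
    Rintegral P' setT (discrete_solution su T k B' u0' n) /\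
  Rintegral P setT (fun w => discrete_solution su T k B u0 n w ^+ 2) =
    Rintegral P' setT (fun w => discrete_solution su T k B' u0' n w ^+ 2).
Proof.
have u2 := gaussian_Lfun2 lu; have u2' := gaussian_Lfun2 lu'.
have [_ E1 E2] := discrete_solution_moments k su T0 hB u2 uB n.
have [_ E1' E2'] := discrete_solution_moments k su T0 hB' u2' uB' n.
have sq_meas : measurable_fun setT (fun x : R => x ^+ 2) by exact: measurable_funX.
rewrite E1 E1' E2 E2' (Ex_same_law lu lu' (Lfun2_Lfun1 u2) (Lfun2_Lfun1 u2')); split => //.
congr (_ * _ + _ * _).
  by apply: (ge0_Ex_same_law lu lu' sq_meas) => x; exact: sqr_ge0.
apply: eq_bigr => i _; congr (_ * _).
have g0 j : 0 <= grid 0 T n.+1 j by rewrite -{1}(grid0 0 T n.+1) le_grid.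
have gS j : grid 0 T n.+1 j <= grid 0 T n.+1 j.+1 by apply: le_grid.
by apply: (ge0_Ex_same_law (bm_increment hB (g0 i) (gS i)) (bm_increment hB' (g0 i) (gS i)) sq_meas) => x; exact: sqr_ge0.
Qed.

End same_moments.

(** * From mean square distance to mean and variance *)

Section moment_comparison.
Context {d : measure_display} {Om : measurableType d} {R : realType}.
Variable P : probability Om R.
Local Notation Ex := (Rintegral P setT).

Lemma sqr_Ex_le (X : Om -> R) : X \in Lfun P 2%:E -> Ex X ^+ 2 <= Ex (fun w => X w ^+ 2).
Proof.
move=> X2; have X1 := Lfun2_Lfun1 X2; set m := Ex X.
have : 0 <= Ex (fun w => (X w - m) ^+ 2) by apply: Ex_ge0 => w; exact: sqr_ge0.
have -> : Ex (fun w => (X w - m) ^+ 2) = Ex (fun w => X w ^+ 2 + (m ^+ 2 - 2 * m * X w)).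
  by apply: eq_Rintegral => w _; ring.
have Z1 : (fun w => 2 * m * X w) \in Lfun P 1 := Lfun1Z (2 * m) X1.
rewrite ExD; [|exact: Lfun2_sqr|by apply: Lfun1B => //; exact: Lfun1_cst].
rewrite ExB//; last exact: Lfun1_cst.
rewrite Ex_cst ExZ// -/m !expr2; lra.
Qed.

(** Young's inequality with weight [h], applied to [x ^+ 2 - y ^+ 2 = (x - y) ^+ 2 + 2 * (x - y) *
    y], keeps everything linear in second moments. Later [h] is fixed by the desired precision
    before [e] is made small. *)
Lemma moments_close (X W : Om -> R) (e h : R) : 0 < h -> W \in Lfun P 2%:E ->
  (fun w => X w - W w) \in Lfun P 2%:E -> Ex (fun w => (X w - W w) ^+ 2) <= e ->
  [/\ X \in Lfun P 2%:E, (Ex X - Ex W) ^+ 2 <= e &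
   `|Ex (fun w => X w ^+ 2) - Ex (fun w => W w ^+ 2)| <=
     (1 + h^-1) * e + h * Ex (fun w => W w ^+ 2)].
Proof.
move=> h0 W2 D2 De.
have X2 : X \in Lfun P 2%:E.
  rewrite (_ : X = fun w => (X w - W w) + W w); first exact: Lfun2D.
  by apply/funext => w; rewrite subrK.
have X1 := Lfun2_Lfun1 X2; have W1 := Lfun2_Lfun1 W2.
split => //; first by rewrite -ExB//; apply: le_trans De; exact: sqr_Ex_le.
have sX := Lfun2_sqr X2; have sW := Lfun2_sqr W2; have sD := Lfun2_sqr D2.
have dD : (fun w => (1 + h^-1) * (X w - W w) ^+ 2) \in Lfun P 1 by exact: Lfun1Z.
have hW : (fun w => h * W w ^+ 2) \in Lfun P 1 by exact: Lfun1Z.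
have key (x y : R) : `|x ^+ 2 - y ^+ 2| <= (1 + h^-1) * (x - y) ^+ 2 + h * y ^+ 2.
  have hh : h * h^-1 = 1 by rewrite mulfV// gt_eqF.
  have ih : 0 < h^-1 by rewrite invr_gt0.
  have E (z : R) : h^-1 * (h * y + z) ^+ 2 = h * y ^+ 2 + 2 * z * y + h^-1 * z ^+ 2.
    by field; rewrite gt_eqF.
  have p1 : 0 <= h^-1 * (h * y + (x - y)) ^+ 2 by rewrite mulr_ge0 ?sqr_ge0// ltW.
  have p2 : 0 <= h^-1 * (h * y + (y - x)) ^+ 2 by rewrite mulr_ge0 ?sqr_ge0// ltW.
  rewrite E in p1; rewrite E in p2.
  have q : (y - x) ^+ 2 = (x - y) ^+ 2 by rewrite -sqrrN opprB.
  rewrite q in p2; have q2 := sqr_ge0 (x - y).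
  have r : x ^+ 2 - y ^+ 2 = (x - y) ^+ 2 + 2 * (x - y) * y by ring.
  rewrite r ler_norml; apply/andP; split; lra.
have UB : Ex (fun w => (1 + h^-1) * (X w - W w) ^+ 2 + h * W w ^+ 2) <=
    (1 + h^-1) * e + h * Ex (fun w => W w ^+ 2).
  rewrite ExD// !ExZ// lerD2r ler_wpM2l// addr_ge0// invr_ge0 ltW//.
rewrite -ExB//; apply: le_trans UB; rewrite ler_norml; apply/andP; split.
  rewrite lerNl -mulN1r -ExZ; last exact: Lfun1B.
  apply: le_Ex; [by apply: Lfun1Z; exact: Lfun1B|exact: Lfun1D|move=> w].
  by rewrite mulN1r; apply: le_trans (key _ _); rewrite -normrN ler_norm.
by apply: le_Ex; [exact: Lfun1B|exact: Lfun1D|move=> w; apply: le_trans (key _ _); exact: ler_norm].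
Qed.

Lemma Lfun2_expectation (X : Om -> R) : X \in Lfun P 2%:E -> 'E_P[X]%E = (Ex X)%:E.
Proof. by move=> X2; rewrite expectation.unlock EFin_Ex//; exact: Lfun2_Lfun1. Qed.

Lemma Lfun2_variance (X : Om -> R) : X \in Lfun P 2%:E ->
  'V_P[X] = (Ex (fun w => X w ^+ 2) - Ex X ^+ 2)%:E.
Proof.
move=> X2; rewrite varianceE// (Lfun2_expectation X2) expectation.unlock EFinB EFin_expe.
by rewrite -(EFin_Ex (Lfun2_sqr X2)).
Qed.

End moment_comparison.

(** The two sides meet through the equal moments of [W1 e n] and [W2 n]. The moments of [X e] and
    [Y] do not involve [n], so [om n] can be sent to 0 at fixed [e], leaving bounds in [de e] and
    the Young weight only. *)
Lemma moments_cvg (R : realType)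
  (d1 : R -> measure_display) (Om1 : forall e : R, measurableType (d1 e))
  (P1 : forall e : R, probability (Om1 e) R) (X : forall e : R, Om1 e -> R)
  (d2 : measure_display) (Om2 : measurableType d2) (P2 : probability Om2 R) (Y : Om2 -> R)
  (W1 : forall e : R, nat -> Om1 e -> R) (W2 : nat -> Om2 -> R)
  (c C : R) (de : R -> R) (om : nat -> R) :
  0 <= C ->
  (forall e : R, 0 < e -> forall n,
    [/\ W1 e n \in Lfun (P1 e) 2%:E, (fun w => X e w - W1 e n w) \in Lfun (P1 e) 2%:E &
        Rintegral (P1 e) setT (fun w => (X e w - W1 e n w) ^+ 2) <= C * (de e + om n)]) ->
  (forall n,
    [/\ W2 n \in Lfun P2 2%:E, (fun w => Y w - W2 n w) \in Lfun P2 2%:E,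
        Rintegral P2 setT (fun w => (Y w - W2 n w) ^+ 2) <= C * om n &
        Rintegral P2 setT (fun w => W2 n w ^+ 2) <= c]) ->
  (forall e : R, 0 < e -> forall n,
    Rintegral (P1 e) setT (W1 e n) = Rintegral P2 setT (W2 n) /\
    Rintegral (P1 e) setT (fun w => W1 e n w ^+ 2) = Rintegral P2 setT (fun w => W2 n w ^+ 2)) ->
  om n @[n --> \oo] --> (0 : R) -> de e @[e --> 0^'+] --> (0 : R) ->
  ('E_(P1 e)[X e] @[e --> 0^'+] --> 'E_P2[Y] /\ 'V_(P1 e)[X e] @[e --> 0^'+] --> 'V_P2[Y])%E.
Proof.
move=> C0 H1 H2 H12 om0 de0.
have X2 (e : R) : 0 < e -> X e \in Lfun (P1 e) 2%:E.
  by move=> e0; have [w2 d2' le2] := H1 e e0 0%N; have [] := moments_close ltr01 w2 d2' le2.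
have Y2 : Y \in Lfun P2 2%:E.
  by have [w2 d2' le2 _] := H2 0%N; have [] := moments_close ltr01 w2 d2' le2.
have c0 : 0 <= c.
  by have [_ _ _] := H2 0%N; apply: le_trans; apply: Ex_ge0 => w; exact: sqr_ge0.
pose mX e := Rintegral (P1 e) setT (X e); pose mY := Rintegral P2 setT Y.
pose qX e := Rintegral (P1 e) setT (fun w => X e w ^+ 2).
pose qY := Rintegral P2 setT (fun w => Y w ^+ 2).
have limn (a b f : R) : (forall n, f <= a + b * om n) -> f <= a.
  move=> H; have lim : a + b * om n @[n --> \oo] --> a.
    rewrite -[X in _ --> X]addr0 -(mulr0 b).
    by apply: cvgD; [exact: cvg_cst|apply: cvgM => //; exact: cvg_cst].
  by apply: (cvgr_to_ge lim); exact: nearW.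
have meanle (e : R) : 0 < e -> (mX e - mY) ^+ 2 <= 2 * C * de e.
  move=> e0; apply: (@limn _ (4 * C)) => n.
  have [w1 x1 le1] := H1 e e0 n; have [w2 y2 le2 _] := H2 n; have [E1 _] := H12 e e0 n.
  have [_ m1 _] := moments_close ltr01 w1 x1 le1.
  have [_ m2 _] := moments_close ltr01 w2 y2 le2.
  rewrite E1 in m1; set a := Rintegral P2 setT (W2 n) in m1 m2.
  have -> : mX e - mY = (mX e - a) - (mY - a) by ring.
  have := sqr_ge0 ((mX e - a) + (mY - a)); move: m1 m2.
  rewrite -/(mX e) -/mY !expr2; nra.
have sqle (h e : R) : 0 < h -> 0 < e ->
    `|qX e - qY| <= (1 + h^-1) * C * de e + 2 * h * c.
  move=> h0 e0; apply: (@limn _ ((1 + h^-1) * C * 2)) => n.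
  have [w1 x1 le1] := H1 e e0 n; have [w2 y2 le2 lec] := H2 n; have [_ E1] := H12 e e0 n.
  have [_ _ m1] := moments_close h0 w1 x1 le1.
  have [_ _ m2] := moments_close h0 w2 y2 le2.
  rewrite E1 in m1; set a := Rintegral P2 setT (fun w => W2 n w ^+ 2) in m1 m2 lec.
  have ac : h * a <= h * c by rewrite ler_wpM2l// ltW.
  apply: le_trans (ler_distD a _ _) _.
  rewrite (distrC a); apply: le_trans (lerD m1 m2) _.
  have -> : (1 + h^-1) * (C * (de e + om n)) = (1 + h^-1) * C * de e + (1 + h^-1) * C * om n by ring.
  have -> : (1 + h^-1) * (C * om n) = (1 + h^-1) * C * om n by ring.
  have -> : (1 + h^-1) * C * 2 * om n = 2 * ((1 + h^-1) * C * om n) by ring.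
  lra.
have near_de (r : R) : 0 < r -> \forall e \near 0^'+, `|de e| <= r.
  move=> r0; have /cvgrPdist_le/(_ r r0) := de0.
  by apply: filterS => e; rewrite sub0r normrN.
have pos : \forall e \near 0^'+, 0 < e :> R by exact: nbhs_right_gt.
have cm : mX e @[e --> 0^'+] --> mY.
  apply/cvgrPdist_le => r r0.
  have C1 : 0 < 2 * C + 1 by rewrite ltr_pwDr// mulr_ge0.
  have q0 : 0 < r ^+ 2 / (2 * C + 1) by rewrite divr_gt0// exprn_gt0.
  apply: filterS2 pos (near_de _ q0) => e e0 der.
  rewrite distrC -(@ler_pXn2r _ 2)// ?nnegrE ?(ltW r0)// real_normK ?num_real//.
  apply: le_trans (meanle e e0) _.
  apply: (@le_trans _ _ ((2 * C + 1) * `|de e|)).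
    apply: (@le_trans _ _ (2 * C * `|de e|)); first by rewrite ler_wpM2l ?mulr_ge0// ler_norm.
    by rewrite ler_wpM2r// lerDl.
  by rewrite mulrC -ler_pdivlMr.
have cq : qX e @[e --> 0^'+] --> qY.
  apply/cvgrPdist_le => r r0.
  have c1 : 0 < 4 * (c + 1) by rewrite mulr_gt0// ltr_pwDr.
  (* Makes the Young term [2 * h * c] at most [r / 2], independently of [e]. *)
  pose h := r / (4 * (c + 1)).
  have h0 : 0 < h by rewrite divr_gt0.
  pose A := (1 + h^-1) * C.
  have A0 : 0 <= A by rewrite mulr_ge0// addr_ge0// invr_ge0 ltW.
  have A1 : 0 < A + 1 by rewrite ltr_pwDr.
  have q0 : 0 < r / 2 / (A + 1) by rewrite !divr_gt0.
  apply: filterS2 pos (near_de _ q0) => e e0 der.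
  rewrite distrC; apply: le_trans (sqle h e h0 e0) _; rewrite (splitr r); apply: lerD.
    apply: (@le_trans _ _ ((A + 1) * `|de e|)); last by rewrite mulrC -ler_pdivlMr.
    apply: (@le_trans _ _ (A * `|de e|)); first by rewrite ler_wpM2l// ler_norm.
    by rewrite ler_wpM2r// lerDl.
  have E : h * (4 * (c + 1)) = r by rewrite /h mulfVK// gt_eqF.
  rewrite -E; have := mulr_ge0 (ltW h0) c0; nra.
split.
  rewrite Lfun2_expectation//.
  have cE : (mX e)%:E @[e --> 0^'+] --> mY%:E by apply: cvg_EFin; [exact: nearW|exact: cm].
  apply: cvg_trans cE; apply: near_eq_cvg; apply: filterS pos => e e0.
  by rewrite Lfun2_expectation//; exact: X2.
rewrite Lfun2_variance//.
have cV : (qX e - mX e ^+ 2)%:E @[e --> 0^'+] --> (qY - mY ^+ 2)%:E.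
  apply: cvg_EFin; first exact: nearW.
  apply: cvgB; first exact: cq.
  by rewrite /= expr2; under eq_fun do rewrite expr2; exact: cvgM.
apply: cvg_trans cV; apply: near_eq_cvg; apply: filterS pos => e e0.
by rewrite Lfun2_variance//; exact: X2.
Qed.

(** * Switching damping *)

Section two_state_transition.
Context {R : realType}.
Variables (gp gm qp qm : R) (q : R -> R -> R) (p : R -> R -> R -> R).
Hypothesis hg : gp != gm.
Hypothesis hp : transition_function [fset gp; gm]%fset q p.
Hypothesis hqp : q gp gm = qp.
Hypothesis hqm : q gm gp = qm.
Hypothesis qp0 : 0 < qp.
Hypothesis qm0 : 0 < qm.

Lemma sum_two_states (f : R -> R) : \sum_(j <- [fset gp; gm]%fset) f j = f gp + f gm.
Proof. by rewrite big_fsetU1 ?inE//= big_seq_fset1. Qed.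

Let a t := p t gp gm.
Let b t := p t gm gp.
Let inp : gp \in [fset gp; gm]%fset. Proof. by rewrite !inE eqxx. Qed.
Let inm : gm \in [fset gp; gm]%fset. Proof. by rewrite !inE eqxx orbT. Qed.

Let app t : 0 <= t -> p t gp gp = 1 - a t.
Proof. by move=> t0; have := tf_sum hp t0 inp; rewrite sum_two_states /a => <-; ring. Qed.

Let bmm t : 0 <= t -> p t gm gm = 1 - b t.
Proof. by move=> t0; have := tf_sum hp t0 inm; rewrite sum_two_states /b => <-; ring. Qed.

Let a_ge0 t : 0 <= t -> 0 <= a t.
Proof. by move=> t0; exact: (tf_ge0 hp). Qed.

Let b_ge0 t : 0 <= t -> 0 <= b t.
Proof. by move=> t0; exact: (tf_ge0 hp). Qed.

(** The second eigenvalue of the stochastic matrix [p t] (the first is 1). It is also the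
    determinant, hence multiplicative in [t]. *)
Definition decay t := 1 - p t gp gm - p t gm gp.

Let aD s t : 0 <= s -> 0 <= t -> a (s + t) = a t + a s * decay t.
Proof.
move=> s0 t0; rewrite {1}/a (tf_chapman hp)// sum_two_states app// bmm// /decay -/(a t) -/(b t) -/(a s).
by ring.
Qed.

Let bD s t : 0 <= s -> 0 <= t -> b (s + t) = b t + b s * decay t.
Proof.
move=> s0 t0; rewrite {1}/b (tf_chapman hp)// sum_two_states app// bmm// /decay -/(a t) -/(b t) -/(b s).
by ring.
Qed.

Lemma decayD s t : 0 <= s -> 0 <= t -> decay (s + t) = decay s * decay t.
Proof.
move=> s0 t0; rewrite {1}/decay -/(a (s + t)) -/(b (s + t)) aD// bD// /decay -/(a s) -/(b s) -/(a t) -/(b t).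
by ring.
Qed.

Lemma decay_ge0 t : 0 <= t -> 0 <= decay t.
Proof.
move=> t0; rewrite (splitr t) decayD ?divr_ge0// -expr2; exact: sqr_ge0.
Qed.

Lemma decay_le1 t : 0 <= t -> decay t <= 1.
Proof. by move=> t0; have := a_ge0 t0; have := b_ge0 t0; rewrite /decay -/(a t) -/(b t); lra. Qed.

Lemma decayM t n : 0 <= t -> decay (n%:R * t) = decay t ^+ n.
Proof.
move=> t0; elim: n => [|n ih].
  by rewrite mul0r expr0 /decay !(tf_zero hp)// (negbTE hg) eq_sym (negbTE hg) !subr0.
by rewrite -natr1 mulrDl mul1r decayD ?mulr_ge0// ih exprSr.
Qed.

(** This rate at 0 and multiplicativity suffice; the closed form [expR (- (qp + qm) * t)] is never
    derived. *)
Lemma decay_rate : (1 - decay h) / h @[h --> 0^'+] --> qp + qm.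
Proof.
have cp : a h / h @[h --> 0^'+] --> qp by rewrite -hqp; apply: (tf_rate hp).
have cm : b h / h @[h --> 0^'+] --> qm by rewrite -hqm; apply: (tf_rate hp) => //; rewrite eq_sym.
rewrite (_ : (fun h => _) = (fun h => a h / h + b h / h)); first exact: cvgD.
by apply/funext => h; rewrite -mulrDl /decay -/(a h) -/(b h); congr (_ / _); ring.
Qed.

(** The positive rate at 0 gives the claim for short times; a longer time is a short one plus a
    remainder, over which the factor is at most 1. *)
Lemma decay_lt1 t : 0 < t -> decay t < 1.
Proof.
move=> t0.
have qq : 0 < qp + qm by rewrite addr_gt0.
have := cvgr_gt _ decay_rate _ qq; move=> [r /= r0 Hr].
have small h : 0 < h -> h < r -> decay h < 1.
  move=> h0 hr; have := Hr h; rewrite /ball_/= sub0r normrN gtr0_norm// => /(_ hr h0).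
  by rewrite pmulr_lgt0 ?invr_gt0// subr_gt0.
have [tr|rt] := ltP t r; first exact: small.
have r2 : 0 < r / 2 by rewrite divr_gt0.
have r2r : r / 2 < r by rewrite ltr_pdivrMr// ltr_pMr// ltr1n.
have tr2 : 0 <= t - r / 2 by rewrite subr_ge0 (le_trans (ltW r2r)).
have -> : t = r / 2 + (t - r / 2) by rewrite subrKC.
rewrite decayD// ?ltW//; apply: le_lt_trans (small _ r2 r2r).
by rewrite ler_piMr ?decay_le1// decay_ge0// ltW.
Qed.

(** Equality of [p (s + h)] and [p (h + s)] gives [a s * b h = a h * b s]; dividing by [h] and
    letting [h] tend to 0 turns [a h] and [b h] into the rates. *)
Let balance s : 0 <= s -> a s * qm = b s * qp.
Proof.
move=> s0.
have ab h : 0 <= h -> a s * b h = a h * b s.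
  move=> h0; have := aD s0 h0; rewrite addrC aD// /decay -/(a s) -/(b s) -/(a h) -/(b h).
  lra.
have cp : a h / h * b s @[h --> 0^'+] --> qp * b s.
  by apply: cvgM; [rewrite -hqp; apply: (tf_rate hp)|exact: cvg_cst].
have cm : a s * (b h / h) @[h --> 0^'+] --> a s * qm.
  by apply: cvgM; [exact: cvg_cst|rewrite -hqm; apply: (tf_rate hp) => //; rewrite eq_sym].
have cp' : a s * (b h / h) @[h --> 0^'+] --> qp * b s.
  apply: cvg_trans cp; apply: near_eq_cvg; near=> h.
  have h0 : 0 <= h by near: h; exact: nbhs_right_ge.
  by rewrite /= mulrA ab// mulrAC.
by rewrite -(cvg_lim _ cm)// (cvg_lim _ cp')// mulrC.
Unshelve. all: by end_near.
Qed.

(** [gbar] is the mean under the stationary law, whose weights at [gp] and [gm] are proportional to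
    [qm] and [qp]. By [balance], [i - gbar] is an eigenfunction of [p t] for the eigenvalue
    [decay t]. *)
Lemma centered_mean i t : i \in [fset gp; gm]%fset -> 0 <= t ->
  let gbar := (qm * gp + qp * gm) / (qm + qp) in
  p t i gp * (gp - gbar) + p t i gm * (gm - gbar) = decay t * (i - gbar).
Proof.
move=> iS t0 gbar.
have qq : qm + qp != 0 by rewrite gt_eqF// addr_gt0.
have ep : gp - gbar = qp * (gp - gm) / (qm + qp) by rewrite /gbar; field.
have em : gm - gbar = - (qm * (gp - gm) / (qm + qp)) by rewrite /gbar; field.
have bal := balance t0; move: iS; rewrite !inE => /orP[] /eqP ->.
  rewrite app// /decay -/(a t) -/(b t) ep em.
  have -> : b t = a t * qm / qp by rewrite bal mulfK// gt_eqF.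
  by field; rewrite qq gt_eqF.
rewrite bmm// /decay -/(a t) -/(b t) ep em.
have -> : a t = b t * qp / qm by rewrite -bal mulfK// gt_eqF.
by field; rewrite qq gt_eqF.
Qed.

End two_state_transition.

Section geometric_covariance.
Context {d : measure_display} {Om : measurableType d} {R : realType}.
Variable P : probability Om R.
Local Notation Ex := (Rintegral P setT).

(** Adding [X n] to a sum of [n] terms costs two cross sums and one square, each at most
    [V / (1 - r)]; hence the 3. The sequence may be non-stationary. *)
Lemma geometric_covariance_sum (X : nat -> Om -> R) (V r : R) n :
  0 <= r < 1 -> 0 <= V -> (forall i, X i \in Lfun P 2%:E) ->
  (forall i j, (i <= j)%N -> Ex (fun w => X i w * X j w) <= V * r ^+ (j - i)) ->
  Ex (fun w => (\sum_(i < n) X i w) ^+ 2) <= n%:R * (3 * V / (1 - r)).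
Proof.
move=> /andP[r0 r1] V0 X2 Xc.
have r1' : 0 < 1 - r by rewrite subr_gt0.
have VV : V <= V / (1 - r).
  by rewrite ler_pdivlMr// ler_piMr// lerBlDr lerDl.
have geo m : \sum_(i < m) V * r ^+ (m - i) <= V / (1 - r).
  (* The exponents start at 1, and [r * (V / (1 - r))] is the fixed point of the recursion sending
     [z] to [r * z + V * r], so the sharper bound is inductive. *)
  suff : \sum_(i < m) V * r ^+ (m - i) <= r * (V / (1 - r)).
    have Q0 : 0 <= V / (1 - r) by rewrite divr_ge0// ltW.
    by move/le_trans; apply; rewrite ler_piMl// ltW.
  elim: m => [|m ih]; first by rewrite big_ord0 mulr_ge0// divr_ge0// ltW.
  rewrite big_ord_recr/= subSnn expr1.
  have -> : \sum_(i < m) V * r ^+ (m.+1 - i) = r * \sum_(i < m) V * r ^+ (m - i).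
    by rewrite mulr_sumr; apply: eq_bigr => i _; rewrite subSn ?(ltnW (ltn_ord i))// exprS mulrCA.
  have /(ler_wpM2l r0) := ih.
  have E : V / (1 - r) * (1 - r) = V by rewrite divfK// gt_eqF.
  set Q := V / (1 - r) in E *; move=> H; apply: (le_trans (lerD H (lexx _))).
  by rewrite -[X in X * r]E; lra.
elim: n => [|n ih].
  under eq_Rintegral do rewrite big_ord0 expr0n/=.
  by rewrite Ex_cst mul0r.
pose S w := \sum_(i < n) X i w.
have S2 : S \in Lfun P 2%:E by exact: Lfun2_sum.
have -> : Ex (fun w => (\sum_(i < n.+1) X i w) ^+ 2) =
    Ex (fun w => S w ^+ 2 + (2 * (S w * X n w) + X n w ^+ 2)).
  by apply: eq_Rintegral => w _; rewrite big_ord_recr/= -/(S w); ring.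
have SX : (fun w => S w * X n w) \in Lfun P 1 := Lfun2_mul_Lfun1 S2 (X2 n).
have SX2 : (fun w => 2 * (S w * X n w)) \in Lfun P 1 := Lfun1Z 2 SX.
rewrite ExD; [|exact: Lfun2_sqr|by apply: Lfun1D => //; exact: Lfun2_sqr].
rewrite ExD//; last exact: Lfun2_sqr.
rewrite ExZ//.
have c1 : Ex (fun w => S w * X n w) <= V / (1 - r).
  have -> : Ex (fun w => S w * X n w) = \sum_(i < n) Ex (fun w => X i w * X n w).
    rewrite -Ex_sum; last by move=> i; exact: Lfun2_mul_Lfun1.
    by apply: eq_Rintegral => w _; rewrite mulr_suml.
  apply: le_trans (geo n); apply: ler_sum => i _; apply: Xc; exact: ltnW.
have c2 : Ex (fun w => X n w ^+ 2) <= V / (1 - r).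
  have := Xc n n (leqnn n); rewrite subnn expr0 mulr1 => H; apply: le_trans VV; apply: le_trans H.
  by rewrite le_eqVlt; apply/orP; left; apply/eqP; apply: eq_Rintegral => w _; rewrite expr2.
apply: (le_trans (lerD ih (lerD (ler_wpM2l _ c1) c2))) => //.
by rewrite -[n.+1%:R]natr1 -mulrA; set Q := V / (1 - r); lra.
Qed.

End geometric_covariance.

(** * Measurable versions of path integrals *)

Section path_integrals.
Context {d : measure_display} {Om : measurableType d} {R : realType}.
Variable P : probability Om R.

Lemma Ex_indic (A : set Om) : measurable A -> Rintegral P setT (\1_A : Om -> R) = fine (P A).
Proof. by move=> mA; rewrite /Rintegral integral_indic// setIT. Qed.

Lemma Lfun1_indic (A : set Om) : measurable A -> (\1_A : Om -> R) \in Lfun P 1.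
Proof.
move=> mA; apply: (@bounded_Lfun1 _ _ _ _ _ 1); first exact: measurable_indic.
by move=> w; rewrite indicE; case: (_ \in _); rewrite ?normr1// normr0.
Qed.

Lemma sub_measurable_adapted (F : set (set Om)) (X : Om -> R) : F `<=` measurable ->
  adapted F X -> measurable_fun setT X.
Proof. by move=> Fm aX _ A mA; rewrite setTI; apply: Fm; exact: aX. Qed.

Lemma sigma_path_measurable (X : R -> Om -> R) :
  (forall t, 0 <= t -> measurable_fun setT (X t)) -> sigma_path X `<=` measurable.
Proof.
move=> mX; apply: smallest_sub; first exact: sigma_algebra_measurable.
by move=> A [t t0 [C mC <-]]; exact: mX.
Qed.

Definition Riemann_sum (g : R -> Om -> R) (a b : R) (n : nat) (w : Om) : R :=
  \sum_(i < n.+1) g (grid a b n.+1 i.+1) w * ((b - a) / n.+1%:R).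

(* Equals the Lebesgue integral of every right-continuous path; as a superior limit
   of Riemann sums it is measurable for [sigma_path g] itself, not only up to null
   sets. *)
Definition path_integral (g : R -> Om -> R) (a b : R) (w : Om) : R :=
  fine (limn_esup (fun n => (Riemann_sum g a b n w)%:E)).

Lemma fine_limn_esup (f : nat -> R) l : f n @[n --> \oo] --> l ->
  fine (limn_esup (fun n => (f n)%:E)) = l.
Proof.
move=> fl; have /cvg_limn_einf_sup[_ ->] // : (f n)%:E @[n --> \oo] --> l%:E.
by apply: cvg_EFin; [exact: nearW|exact: fl].
Qed.

Lemma Riemann_sum_cvg (g : R -> Om -> R) (a b M : R) w : a <= b ->
  (forall t, a <= t <= b -> `|g t w| <= M) ->
  (forall t, a <= t < b -> g s w @[s --> t^'+] --> g t w) ->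
  Riemann_sum g a b n w @[n --> \oo] --> \int[lebesgue_measure]_(t in `[a, b[) g t w.
Proof.
rewrite le_eqVlt => /predU1P[->|ab] gM gr.
  rewrite set_itvco0 Rintegral_set0 (_ : (fun n => _) = cst 0); first exact: cvg_cst.
  by apply/funext => n; rewrite /Riemann_sum big1// => i _; rewrite subrr mul0r mulr0.
exact: (right_Riemann_sum_cvg ab gM gr).
Qed.

Lemma path_integralE (g : R -> Om -> R) (a b M : R) w : a <= b ->
  (forall t, a <= t <= b -> `|g t w| <= M) ->
  (forall t, a <= t < b -> g s w @[s --> t^'+] --> g t w) ->
  path_integral g a b w = \int[lebesgue_measure]_(t in `[a, b[) g t w.
Proof. by move=> ab gM gr; apply: fine_limn_esup; exact: Riemann_sum_cvg gM gr. Qed.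

Lemma adapted_Riemann_sum (g : R -> Om -> R) a b n : 0 <= a -> a <= b ->
  adapted (sigma_path g) (Riemann_sum g a b n).
Proof.
move=> a0 ab; have sg := sigma_algebra_path g.
apply: adapted_sum => // i; apply: adaptedM => //; last exact: adapted_cst.
apply: adapted_path; have /andP[+ _] := grid_itv ab (ltn_ord i); exact: le_trans.
Qed.

Lemma adapted_path_integral (g : R -> Om -> R) a b : 0 <= a -> a <= b ->
  adapted (sigma_path g) (path_integral g a b).
Proof.
move=> a0 ab; apply: adapted_limn_sup; first exact: sigma_algebra_path.
by move=> n; exact: adapted_Riemann_sum.
Qed.

End path_integrals.

(** The tangent at the larger argument [y] gives [expR y - expR x <= expR y * (y - x)]. *)
Lemma expR_lip (R : realType) (x y C : R) : x <= C -> y <= C ->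
  `|expR x - expR y| <= expR C * `|x - y|.
Proof.
wlog xy : x y / x <= y => [hw|xC yC].
  have [xy|/ltW yx] := leP x y; first exact: hw.
  by move=> xC yC; rewrite distrC (distrC x); exact: hw.
rewrite distrC (distrC x) !ger0_norm ?subr_ge0// ?ler_expR//.
have := expR_ge1Dx (x - y); rewrite expRD => H.
have E : expR y * expR (- y) = 1 by rewrite -expRD subrr expR0.
have H1 : expR y * (1 + (x - y)) <= expR x.
  apply: le_trans (ler_wpM2l (expR_ge0 y) H) _.
  by rewrite mulrCA E mulr1.
have H2 : expR y <= expR C by rewrite ler_expR.
have H3 : 0 <= y - x by rewrite subr_ge0.
nra.
Qed.

Section switching.
Context {d : measure_display} {Om : measurableType d} {R : realType}.
Variable P : probability Om R.
Local Notation Ex := (Rintegral P setT).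
Variables (gp gm lp lm eps : R) (g : R -> Om -> R).
Hypothesis hg : gm < gp.
Hypothesis hlp : 0 < lp.
Hypothesis hlm : 0 < lm.
Hypothesis heps : 0 < eps.
Hypothesis hM : markov_chain P [fset gp; gm]%fset
    (fun i _ => (if i == gp then lp else lm) / eps) g.

Let gbar := (lm * gp + lp * gm) / (lm + lp).
Let qp := lp / eps.
Let qm := lm / eps.
Let gpm : gp != gm. Proof. by rewrite gt_eqF. Qed.
Let qp0 : 0 < qp. Proof. exact: divr_gt0. Qed.
Let qm0 : 0 < qm. Proof. exact: divr_gt0. Qed.
Let q := fun i (_ : R) => (if i == gp then lp else lm) / eps.
Let hqp : q gp gm = qp. Proof. by rewrite /q eqxx. Qed.
Let hqm : q gm gp = qm. Proof. by rewrite /q eq_sym (negbTE gpm). Qed.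

(** Both rates carry the factor [eps^-1], so the stationary mean does not depend on [eps]. *)
Let gbarE : gbar = (qm * gp + qp * gm) / (qm + qp).
Proof.
rewrite /gbar /qp /qm; field; rewrite (gt_eqF heps)/=.
by rewrite gt_eqF// addr_gt0.
Qed.

Let state t w : 0 <= t -> g t w = gp \/ g t w = gm.
Proof. by move=> t0; have := mc_state hM w t0; rewrite !inE => /orP[] /eqP; [left|right]. Qed.

Let gbar_itv : gm <= gbar <= gp.
Proof.
have ll : 0 < lm + lp by rewrite addr_gt0.
have P1 : 0 < lm * (gp - gm) by rewrite mulr_gt0// subr_gt0.
have P2 : 0 < lp * (gp - gm) by rewrite mulr_gt0// subr_gt0.
by rewrite /gbar ler_pdivlMr// ler_pdivrMr//; apply/andP; split; lra.
Qed.

Let V := (gp - gm) ^+ 2.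

Let dev_sqr_le t w : 0 <= t -> (g t w - gbar) ^+ 2 <= V.
Proof.
move=> t0; have /andP[b1 b2] := gbar_itv.
rewrite /V !expr2; case: (state w t0) => ->; nra.
Qed.

Let mg t : 0 <= t -> measurable_fun setT (g t).
Proof. by move=> t0; exact: (mc_measurable hM). Qed.

Let dev2 t : 0 <= t -> (fun w => g t w - gbar) \in Lfun P 2%:E.
Proof.
move=> t0; have m1 : measurable_fun setT (fun w => g t w - gbar).
  by apply: measurable_funB => //; exact: mg.
apply: Lfun2P => //; apply: (@bounded_Lfun1 _ _ _ _ _ V); first exact: measurable_funX.
by move=> w; rewrite ger0_norm ?sqr_ge0// dev_sqr_le.
Qed.

(** Moments are taken about the stationary mean rather than the mean at time [s], because the
    initial law is arbitrary. By the Markov property and [centered_mean], the deviation at time [s]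
    is multiplied by [D (t - s)], and its square is at most [V]. *)
Lemma switching_covariance : exists D : R -> R,
  [/\ forall t, 0 < t -> 0 <= D t < 1,
      forall t n, 0 <= t -> D (n%:R * t) = D t ^+ n,
      (1 - D h) / h @[h --> 0^'+] --> (lp + lm) / eps &
      forall s t, 0 <= s -> s <= t ->
        Ex (fun w => (g s w - gbar) * (g t w - gbar)) <= V * D (t - s)].
Proof.
have [p hp hmk] := mc_markov hM.
exists (decay gp gm p); split.
- move=> t t0; rewrite (decay_lt1 gpm hp hqp hqm)// andbT.
  by apply: (decay_ge0 gpm hp); exact: ltW.
- by move=> t n t0; exact: (decayM gpm hp).
- by rewrite mulrDl; exact: (decay_rate gpm hp hqp hqm).
move=> s t s0 st; have t0 := le_trans s0 st.
have h0 : 0 <= t - s by rewrite subr_ge0.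
pose A i r := g r @^-1` [set i].
have mA i r : 0 <= r -> measurable (A i r).
  by move=> r0; rewrite -[A i r]setTI; exact: mg.
(* The Markov property with [n = 0], where the past reduces to the single event [g s = i]. *)
have joint i j : i \in [fset gp; gm]%fset -> j \in [fset gp; gm]%fset ->
    fine (P (A i s `&` A j t)) = fine (P (A i s)) * p (t - s) i j.
  move=> iS jS; have := hmk 0%N (fun=> s) (fun=> i) (t - s) j s0 (fun=> lexx _) h0 iS jS.
  rewrite /= subrKC => H.
  have pE : [set w | forall k : nat, (k <= 0)%N -> g s w = i] = A i s.
    apply/seteqP; split => w /=; first by move=> /(_ 0%N (leqnn _)).
    by move=> gi k _.
  rewrite pE in H; rewrite /A [X in fine X]H fineM//.
  by apply: fin_num_measure; exact: mA.
have inp : gp \in [fset gp; gm]%fset by rewrite !inE eqxx.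
have inm : gm \in [fset gp; gm]%fset by rewrite !inE eqxx orbT.
have memA i r w : (w \in A i r) = (g r w == i) by apply/idP/eqP; rewrite inE.
have indA i r w : \1_(A i r) w = (g r w == i)%:R :> R by rewrite indicE memA.
have indI i j w : \1_(A i s `&` A j t) w = (g s w == i)%:R * (g t w == j)%:R :> R.
  by rewrite indicE in_setI !memA -natrM mulnb.
have gmp : (gm == gp) = false by rewrite eq_sym (negbTE gpm).
pose x := gp - gbar; pose y := gm - gbar.
have prodE w : (g s w - gbar) * (g t w - gbar) =
    x * x * \1_(A gp s `&` A gp t) w + x * y * \1_(A gp s `&` A gm t) w +
    (y * x * \1_(A gm s `&` A gp t) w + y * y * \1_(A gm s `&` A gm t) w).
  rewrite !indI.
  by case: (state w s0) => ->; case: (state w t0) => ->; rewrite !eqxx ?gmp ?(negbTE gpm) /x /y /=; ring.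
have sqE w : (g s w - gbar) ^+ 2 = x ^+ 2 * \1_(A gp s) w + y ^+ 2 * \1_(A gm s) w.
  rewrite !indA.
  by case: (state w s0) => ->; rewrite !eqxx ?gmp ?(negbTE gpm) /x /y /=; ring.
have I1 i j : (\1_(A i s `&` A j t) : Om -> R) \in Lfun P 1.
  by apply: Lfun1_indic; apply: measurableI; exact: mA.
have I2 i : (\1_(A i s) : Om -> R) \in Lfun P 1 by apply: Lfun1_indic; exact: mA.
have E1 : Ex (fun w => (g s w - gbar) * (g t w - gbar)) =
    decay gp gm p (t - s) * Ex (fun w => (g s w - gbar) ^+ 2).
  rewrite (eq_Rintegral _ (fun w _ => prodE w)) (eq_Rintegral _ (fun w _ => sqE w)).
  have Z1 c i j : (fun w => c * \1_(A i s `&` A j t) w) \in Lfun P 1 by exact: Lfun1Z.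
  have Z2 c i : (fun w => c * \1_(A i s) w) \in Lfun P 1 by exact: Lfun1Z.
  rewrite ExD; [|exact: Lfun1D|exact: Lfun1D].
  rewrite !ExD// !ExZ// !Ex_indic//; try (by apply: measurableI; exact: mA); try exact: mA.
  rewrite !joint//.
  have := centered_mean gpm hp hqp hqm qp0 qm0 inp h0.
  have := centered_mean gpm hp hqp hqm qp0 qm0 inm h0.
  rewrite /= -gbarE -/x -/y => cm cp.
  set a := fine (P (A gp s)); set b := fine (P (A gm s)).
  transitivity (a * x * (p (t - s) gp gp * x + p (t - s) gp gm * y) +
     b * y * (p (t - s) gm gp * x + p (t - s) gm gm * y)); first by ring.
  by rewrite cm cp; ring.
rewrite E1 mulrC; apply: ler_pM => //.
- by apply: Ex_ge0 => w; exact: sqr_ge0.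
- exact: (decay_ge0 gpm hp).
- apply: (@le_trans _ _ (Ex (fun=> V))); last by rewrite Ex_cst.
  apply: le_Ex; [exact: Lfun2_sqr (dev2 s0)|exact: Lfun1_cst|].
  by move=> w; exact: dev_sqr_le.
Qed.

Let G : R := `|gp| + `|gm|.

Let G0 : 0 <= G. Proof. by rewrite addr_ge0. Qed.

Let gG t w : 0 <= t -> `|g t w| <= G.
Proof. by move=> t0; rewrite /G; case: (state w t0) => ->; rewrite ?lerDl ?lerDr. Qed.

Let gbarG : `|gbar| <= G.
Proof.
have /andP[b1 b2] := gbar_itv; have := ler_norm gp; have := ler_norm (- gm).
have := normr_ge0 gp; have := normr_ge0 gm; rewrite normrN ler_norml /G => ? ? ? ?.
by apply/andP; split; lra.
Qed.

Variable T : R.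
Hypothesis T0 : 0 < T.

Definition switching_propagator x w := expR (- path_integral g x T w).

Lemma switching_propagatorE x : 0 <= x <= T ->
  \forall w \ae P, switching_propagator x w = propagator (g^~ w) T x.
Proof.
move=> /andP[x0 xT]; apply: filterS (mc_right_continuous hM) => w gr.
rewrite /switching_propagator (path_integralE (M := G))//.
  by move=> t /andP[xt _]; rewrite gG// (le_trans x0).
by move=> t /andP[xt _]; apply: gr; exact: le_trans xt.
Qed.

Lemma switching_path_regular : \forall w \ae P,
  measurable_fun `[0, T] (g^~ w) /\ exists M, forall t, 0 <= t <= T -> `|g t w| <= M.
Proof.
apply: filterS (mc_right_continuous hM) => w gr; split.
  apply: (right_continuous_measurable T0) => t /andP[t0 _]; exact: gr.
by exists G => t /andP[t0 _]; exact: gG.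
Qed.

Lemma adapted_switching_propagator x : 0 <= x <= T ->
  adapted (sigma_path g) (switching_propagator x).
Proof.
move=> /andP[x0 xT]; apply: (@adapted_comp _ _ _ _ _ (fun y : R => expR (- y))).
  exact: measurableT_comp.
exact: adapted_path_integral.
Qed.

(** The Riemann sum differs from [gbar * (T - x)] by [h n * Z n], whose second moment is at most
    [3 * V * (T - x)] times [h n / (1 - D (h n))]. This quotient tends to [eps / (lp + lm)] by the
    rate of [D] at 0, and Fatou carries the bound over to the integral. The bound [G * T] on the
    exponents supplies the Lipschitz constant of [expR]. *)
Lemma switching_propagator_close x : 0 <= x <= T ->
  (fun w => switching_propagator x w - expR (- (gbar * (T - x)))) \in Lfun P 2%:E /\
  Ex (fun w => (switching_propagator x w - expR (- (gbar * (T - x)))) ^+ 2) <=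
    expR (G * T) ^+ 2 * (3 * V * T * (eps / (lp + lm))).
Proof.
move=> /[dup] xI /andP[x0]; have V0 : 0 <= V by rewrite sqr_ge0.
have ll : 0 < lp + lm by rewrite addr_gt0.
have bound0 : 0 <= expR (G * T) ^+ 2 * (3 * V * T * (eps / (lp + lm))).
  apply: mulr_ge0; first exact: sqr_ge0.
  apply: mulr_ge0; last by rewrite divr_ge0// ltW.
  by apply: mulr_ge0; [exact: mulr_ge0|exact: ltW].
(* At [x = T] the mesh would be 0, whereas [D] is below 1 only at positive times. *)
rewrite le_eqVlt => /predU1P[->|xT].
  have E w : switching_propagator T w = 1.
    rewrite /switching_propagator (_ : path_integral g T T w = 0) ?oppr0 ?expR0//.
    apply: fine_limn_esup; rewrite (_ : (fun n => _) = cst 0); first exact: cvg_cst.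
    by apply/funext => n; rewrite /Riemann_sum big1// => i _; rewrite subrr mul0r mulr0.
  under eq_fun do rewrite E subrr mulr0 oppr0 expR0 subrr.
  under eq_Rintegral do rewrite E subrr mulr0 oppr0 expR0 subrr expr0n/=.
  by rewrite Ex_cst; split => //; exact: Lfun2_cst.
have [D [D01 DM Drate Dcov]] := switching_covariance.
pose h n := (T - x) / n.+1%:R.
have h0 n : 0 < h n by rewrite divr_gt0// subr_gt0.
have nh n : n.+1%:R * h n = T - x by rewrite /h mulrCA mulfV ?mulr1// pnatr_eq0.
pose t n i := grid x T n.+1 i.
have t0 n i : 0 <= t n i.
  by rewrite (le_trans x0)// -{1}(grid0 x T n.+1) le_grid// ltW.
pose Z n w := \sum_(i < n.+1) (g (t n i.+1) w - gbar).
have RSE n w : Riemann_sum g x T n w - gbar * (T - x) = h n * Z n w.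
  rewrite /Riemann_sum /Z -mulr_suml -/(h n) sumrB sumr_const card_ord -mulr_natl -(nh n); ring.
have Zcov n : Ex (fun w => Z n w ^+ 2) <= n.+1%:R * (3 * V / (1 - D (h n))).
  apply: (@geometric_covariance_sum _ _ _ P (fun i w => g (t n i.+1) w - gbar)) => //.
  - exact: D01.
  - by move=> i; exact: dev2.
  (* Node differences are multiples of the mesh, so [DM] makes the covariances geometric with ratio
     [D (h n)]. *)
  - move=> i j ij; apply: le_trans (Dcov _ _ (t0 n i.+1) _) _.
      by apply: le_grid => //; exact: ltW.
    rewrite -DM ?(ltW (h0 n))// (_ : t n j.+1 - t n i.+1 = (j - i)%:R * h n)//.
    by rewrite /t !gridS /grid -/(h n) natrB//; ring.
have Z2 n : Z n \in Lfun P 2%:E by apply: Lfun2_sum => i; exact: dev2.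
have RSG n w : - Riemann_sum g x T n w <= G * T.
  apply: le_trans (ler_norm _) _; rewrite normrN.
  apply: le_trans (ler_norm_sum _ _ _) _.
  apply: (@le_trans _ _ (\sum_(i < n.+1) G * h n)).
    apply: ler_sum => i _; rewrite normrM [X in _ * X]ger0_norm ?(ltW (h0 n))//.
    by rewrite ler_wpM2r ?(ltW (h0 n))// gG// t0.
  rewrite sumr_const card_ord -mulr_natl mulrCA nh.
  by rewrite ler_wpM2l// lerBlDr lerDl.
have gT : - (gbar * (T - x)) <= G * T.
  apply: le_trans (ler_norm _) _; rewrite normrN normrM ler_pM//.
  by rewrite ger0_norm ?subr_ge0 ?(ltW xT)// lerBlDr lerDl.
pose k := expR (- (gbar * (T - x))).
pose A := expR (G * T) ^+ 2.
have A0 : 0 <= A by rewrite sqr_ge0.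
pose F n w := (expR (- Riemann_sum g x T n w) - k) ^+ 2.
have mRS n : measurable_fun setT (Riemann_sum g x T n).
  apply: (@sub_measurable_adapted _ _ _ (sigma_path g)).
    by apply: sigma_path_measurable; exact: mg.
  by apply: adapted_Riemann_sum => //; exact: ltW.
have FZ n w : F n w <= A * (h n ^+ 2 * Z n w ^+ 2).
  rewrite /F /A -!exprMn -[leLHS]real_normK ?num_real// -[leRHS]real_normK ?num_real//.
  rewrite lerXn2r ?nnegrE//; apply: le_trans (expR_lip (RSG n w) gT) _.
  rewrite opprK normrM ger0_norm ?expR_ge0// ler_wpM2l ?expR_ge0//.
  by rewrite addrC -opprB normrN RSE.
have AZ1 n : (fun w => A * (h n ^+ 2 * Z n w ^+ 2)) \in Lfun P 1.
  by apply: Lfun1Z; apply: Lfun1Z; exact: Lfun2_sqr.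
have F1 n : F n \in Lfun P 1.
  apply: le_Lfun1 (AZ1 n) _; last by move=> w; rewrite ger0_norm ?sqr_ge0//; exact: FZ.
  apply: measurable_funX; apply: measurable_funB => //.
  by apply: measurableT_comp => //; exact: measurableT_comp.
have mK : measurable_fun setT (fun w => switching_propagator x w - k).
  apply: measurable_funB => //; apply: (@sub_measurable_adapted _ _ _ (sigma_path g)).
    by apply: sigma_path_measurable; exact: mg.
  exact: adapted_switching_propagator.
have c_cvg : A * (3 * V * (T - x) * ((1 - D (h n)) / h n)^-1) @[n --> \oo] -->
    A * (3 * V * (T - x) * ((lp + lm) / eps)^-1).
  apply: cvgM; first exact: cvg_cst.
  apply: cvgM; first exact: cvg_cst.
  apply: cvgV; first by rewrite gt_eqF// divr_gt0.
  move/cvg_at_rightP : Drate; apply; split => //; exact: mesh_cvg.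
have Fcvg : \forall w \ae P, F n w @[n --> \oo] --> (switching_propagator x w - k) ^+ 2.
  apply: filterS (mc_right_continuous hM) => w gr.
  have RSc : Riemann_sum g x T n w @[n --> \oo] -->
      \int[lebesgue_measure]_(t in `[x, T[) g t w.
    apply: (Riemann_sum_cvg (M := G)); first exact: ltW.
      by move=> r /andP[xr _]; rewrite gG// (le_trans x0).
    by move=> r /andP[xr _]; apply: gr; exact: le_trans xr.
  rewrite /switching_propagator /path_integral (fine_limn_esup RSc).
  have : expR (- Riemann_sum g x T n w) - k @[n --> \oo] -->
      expR (- \int[lebesgue_measure]_(t in `[x, T[) g t w) - k.
    apply: cvgB; last exact: cvg_cst.
    by apply: (cvg_comp _ _ (cvgN RSc)); exact: continuous_expR.
  move=> H; rewrite expr2 /F; under eq_fun do rewrite expr2; exact: cvgM.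
have FC n : Ex (F n) <= A * (3 * V * (T - x) * ((1 - D (h n)) / h n)^-1).
  apply: le_trans (le_Ex (F1 n) (AZ1 n) (FZ n)) _.
  have ZZ := Lfun2_sqr (Z2 n).
  rewrite ExZ; last exact: Lfun1Z.
  rewrite ExZ// ler_wpM2l//; apply: le_trans (ler_wpM2l (sqr_ge0 _) (Zcov n)) _.
  have /andP[_ D1] := D01 _ (h0 n).
  rewrite -(nh n) le_eqVlt; apply/orP; left; apply/eqP; field.
  by rewrite gt_eqF ?h0// subr_eq0 gt_eqF.
have [K1 K2] := @fatou_Ex _ _ _ P F (fun w => (switching_propagator x w - k) ^+ 2) _ _
  F1 (fun n w => sqr_ge0 _) (measurable_funX 2 mK) (fun w => sqr_ge0 _) Fcvg FC c_cvg.
split; first exact: Lfun2P.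
apply: le_trans K2 _; rewrite -/A ler_wpM2l// invf_div ler_wpM2r ?divr_ge0 ?(ltW heps) ?(ltW ll)//.
have V3 : 0 <= 3 * V by exact: mulr_ge0.
by rewrite ler_wpM2l// lerBlDr lerDl.
Qed.

End switching.

(** * Diffusive damping *)

Section joint_independence.
Context {d : measure_display} {Om : measurableType d} {R : realType}.
Variable P : probability Om R.

(** When [F1] and [F2] are sigma-algebras, the generating intersections form a pi-system, as
    uniqueness of measures demands. *)
Definition sigma_join (F1 F2 : set (set Om)) : set (set Om) :=
  <<s [set C | exists A B, [/\ F1 A, F2 B & C = A `&` B]] >>.

Lemma sub_sigma_join1 F1 F2 : F2 setT -> F1 `<=` sigma_join F1 F2.
Proof. by move=> F2T A FA; apply: sub_sigma_algebra; exists A, setT; rewrite setIT. Qed.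

Lemma sub_sigma_join2 F1 F2 : F1 setT -> F2 `<=` sigma_join F1 F2.
Proof. by move=> F1T A FA; apply: sub_sigma_algebra; exists setT, A; rewrite setTI. Qed.

Lemma sigma_join_measurable F1 F2 : F1 `<=` measurable -> F2 `<=` measurable ->
  sigma_join F1 F2 `<=` measurable.
Proof.
move=> F1m F2m; apply: smallest_sub; first exact: sigma_algebra_measurable.
by move=> _ [A [B [FA FB ->]]]; apply: measurableI; [exact: F1m|exact: F2m].
Qed.

(** For fixed [C], the measure of the intersection with [C] and the multiple [P C * P A] agree on
    the intersections that generate the join, hence on the whole join. *)
Lemma indep_sigma_join F1 F2 H :
  sigma_algebra setT F1 -> sigma_algebra setT F2 ->
  F1 `<=` measurable -> F2 `<=` measurable -> H `<=` measurable ->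
  indep P F1 F2 ->
  (forall A B C, F1 A -> F2 B -> H C ->
    P (A `&` B `&` C) = (P A * P B * P C)%E) ->
  indep P (sigma_join F1 F2) H.
Proof.
move=> s1 s2 F1m F2m Hm F12 F12H A C FA HC.
have mC := Hm _ HC.
have PC0 : 0 <= fine (P C) by rewrite fine_ge0.
pose m1 := mrestr P mC.
pose m2 := mscale (NngNum PC0) P.
have PCE : (fine (P C))%:E = P C by rewrite fineK//; exact: fin_num_measure.
have T1 : F1 setT by case: s1 => F0 D _; have := D _ F0; rewrite setD0.
have T2 : F2 setT by case: s2 => F0 D _; have := D _ F0; rewrite setD0.
pose G := [set C | exists A B, [/\ F1 A, F2 B & C = A `&` B]].
have Gm : G `<=` measurable.
  by move=> _ [X [Y [FX FY ->]]]; apply: measurableI; [exact: F1m|exact: F2m].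
have I1 : setI_closed F1 by have /sigma_algebraP[] := s1.
have I2 : setI_closed F2 by have /sigma_algebraP[] := s2.
have := @g_sigma_algebra_measure_unique _ R Om G Gm (fun=> setT) _ _
  (mrestr P mC) (mscale (NngNum PC0) P).
move=> /(_ _ _ _ _ _ A FA) H'.
rewrite -[LHS]/(mrestr P mC A) H'.
- by rewrite -[LHS]/((fine (P C))%:E * P A)%E PCE muleC.
- by move=> _; exists setT, setT; rewrite setIT.
- by apply/seteqP; split => // w _; exists 0%N.
- move=> _ _ [X [Y [FX FY ->]]] [X' [Y' [FX' FY' ->]]].
  by exists (X `&` X'), (Y `&` Y'); split; [exact: I1|exact: I2|rewrite setIACA].
- move=> _ [X [Y [FX FY ->]]].
  rewrite -[LHS]/(P (X `&` Y `&` C)) -[RHS]/((fine (P C))%:E * P (X `&` Y))%E.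
  by rewrite PCE F12H// F12// muleC.
- move=> _; apply: (@le_lt_trans _ _ (P setT)); last by rewrite probability_setT ltry.
  by apply: le_measure; rewrite ?inE//; exact: measurableI.
Qed.

Lemma mutually_independent_triple (I : finType) (F : I -> set (set Om)) i j k A B C :
  mutually_independent P F -> i != j -> i != k -> j != k -> F i A -> F j B -> F k C ->
  P (A `&` B `&` C) = (P A * P B * P C)%E.
Proof.
move=> iF ij ik jk FA FB FC.
pose D l := if l == i then A else if l == j then B else C.
have ji : j == i = false by rewrite eq_sym (negbTE ij).
have ki : k == i = false by rewrite eq_sym (negbTE ik).
have kj : k == j = false by rewrite eq_sym (negbTE jk).
have Di : D i = A by rewrite /D eqxx.
have Dj : D j = B by rewrite /D ji eqxx.
have Dk : D k = C by rewrite /D ki kj.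
have DF l : l \in [set i; j; k]%SET -> F l (D l).
  by rewrite !inE => /orP[/orP[]|] /eqP ->; rewrite ?Di ?Dj ?Dk.
have := iF _ D DF.
rewrite -finset.setUA big_setU1 ?inE ?negb_or ?ij//= big_setU1 ?inE//= big_set1.
rewrite Di Dj Dk muleA => <-; congr (P _).
apply/seteqP; split => w /=.
  by move=> [[Aw Bw] Cw] l; rewrite /= !inE => /or3P[] /eqP ->; rewrite ?Di ?Dj ?Dk.
move=> H; split; [split|].
- by have := H i; rewrite Di; apply; rewrite /= !inE eqxx.
- by have := H j; rewrite Dj; apply; rewrite /= !inE eqxx orbT.
- by have := H k; rewrite Dk; apply; rewrite /= !inE eqxx !orbT.
Qed.

End joint_independence.

(** * Convexity of the exponential and summation by parts *)

Section convexity.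
Context {R : realType}.

Lemma expR_tangent (z x : R) : expR z * (1 + (x - z)) <= expR x.
Proof.
rewrite -[X in _ <= expR X](subrKC z) expRD ler_wpM2l ?expR_ge0//.
exact: expR_ge1Dx.
Qed.

(** The mass missing from the weights is placed at the point 0, where [expR] is 1; then the tangent
    inequalities at the mean [z] are summed. *)
Lemma expR_Jensen n (p y : 'I_n -> R) : (forall i, 0 <= p i) -> \sum_(i < n) p i <= 1 ->
  expR (\sum_(i < n) p i * y i) <= \sum_(i < n) p i * expR (y i) + (1 - \sum_(i < n) p i).
Proof.
move=> p0 p1; set z := \sum_(i < n) p i * y i.
have H1 : \sum_(i < n) p i * (expR z * (1 + (y i - z))) <= \sum_(i < n) p i * expR (y i).
  by apply: ler_sum => i _; rewrite ler_wpM2l// expR_tangent.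
have H2 : (1 - \sum_(i < n) p i) * (expR z * (1 + (0 - z))) <= (1 - \sum_(i < n) p i) * 1.
  by rewrite ler_wpM2l ?subr_ge0// -[leRHS]expR0 expR_tangent.
have E : \sum_(i < n) p i * (expR z * (1 + (y i - z))) =
    expR z * ((1 - z) * \sum_(i < n) p i + z).
  rewrite {3}/z mulr_sumr -big_split/= mulr_sumr; apply: eq_bigr => i _; ring.
rewrite E in H1; rewrite mulr1 in H2.
apply: le_trans (lerD H1 H2); rewrite le_eqVlt; apply/orP; left; apply/eqP; ring.
Qed.

(** Convexity with equal weights. It separates the four contributions to the damping deviation:
    these share the same noise, so their exponential moments cannot be factored. *)
Lemma expR_avg4 (x1 x2 x3 x4 : R) : expR (x1 + x2 + x3 + x4) <=
  (expR (4 * x1) + expR (4 * x2) + expR (4 * x3) + expR (4 * x4)) / 4.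
Proof.
set z := x1 + x2 + x3 + x4.
have := expR_tangent z (4 * x1); have := expR_tangent z (4 * x2).
have := expR_tangent z (4 * x3); have := expR_tangent z (4 * x4).
have E : (expR z * (1 + (4 * x1 - z)) + expR z * (1 + (4 * x2 - z)) +
   expR z * (1 + (4 * x3 - z)) + expR z * (1 + (4 * x4 - z))) / 4 = expR z.
  by rewrite -!mulrDr /z; field.
move=> ? ? ? ?; rewrite -[leLHS]E; lra.
Qed.

(** After expansion this reads [3 <= expR (2 * z) + 2 * expR (- z)], and the tangents at 0 add up to
    exactly 3. *)
Lemma sqr_expR_sub1_le (z : R) : (expR (- z) - 1) ^+ 2 <= expR (2 * z) + expR (- 2 * z) - 2.
Proof.
have e2 : expR (- 2 * z) = expR (- z) ^+ 2.
  by rewrite expr2 -expRD; congr expR; ring.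
have := expR_ge1Dx (2 * z); have := expR_ge1Dx (- z).
rewrite e2 !expr2; lra.
Qed.

(** Taking 0 as the term before index 0 makes the differences sum to [k n] and keeps them
    nonnegative for a nonnegative increasing [k]. *)
Definition backward_difference (k : nat -> R) (i : nat) : R :=
  k i - (if i is j.+1 then k j else 0).

Lemma sum_backward_difference (k : nat -> R) n :
  \sum_(i < n.+1) backward_difference k i = k n.
Proof.
elim: n => [|n ih]; first by rewrite big_ord1 /backward_difference subr0.
by rewrite big_ord_recr/= ih /backward_difference; ring.
Qed.

Lemma Abel_summation (k b : nat -> R) n :
  \sum_(i < n) k i * (b i.+1 - b i) =
  \sum_(i < n) backward_difference k i * (b n - b i).
Proof.
elim: n => [|n ih]; first by rewrite !big_ord0.
rewrite big_ord_recr/= ih -[in LHS](sum_backward_difference k n).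
rewrite big_ord_recr/= mulrDl addrA mulr_suml -big_split/= [RHS]big_ord_recr/=.
by congr (_ + _); apply: eq_bigr => i _; ring.
Qed.

End convexity.

(** * The Ornstein-Uhlenbeck equation and its noise *)

Section Ornstein_Uhlenbeck.
Context {d : measure_display} {Om : measurableType d} {R : realType}.
Variable P : probability Om R.
Local Notation Ex := (Rintegral P setT).
Variables (kappa s : R) (B y : R -> Om -> R).
Hypothesis kappa0 : 0 < kappa.
Hypothesis hB : brownian_motion P B.
Hypothesis hy : additive_sde P (fun t w => - kappa * y t w) s B y.

Definition ou_sum (x : R) (n : nat) (w : Om) : R :=
  s * \sum_(i < n.+1) expR (- (kappa * (x - grid 0 x n.+1 i))) *
    (B (grid 0 x n.+1 i.+1) w - B (grid 0 x n.+1 i) w).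

(* The stochastic integral [s * \int_0^x exp (- kappa * (x - r)) dB r], again as a
   superior limit so as to be measurable for [sigma_path B]. *)
Definition ou_noise (x : R) (w : Om) : R := fine (limn_esup (fun n => (ou_sum x n w)%:E)).

Definition ou_solution (x : R) (w : Om) : R := expR (- (kappa * x)) * y 0 w + ou_noise x w.

Lemma propagator_cst (x z : R) : z <= x -> propagator (fun=> kappa) x z = expR (- (kappa * (x - z))).
Proof.
move=> zx; rewrite /propagator Rintegral_cst//= lebesgue_measure_itv/= lte_fin.
by move: zx; rewrite le_eqVlt => /predU1P[->|->]//; rewrite ltxx subrr.
Qed.

(** The equation of [y] has the constant damping [kappa], so [linear_sde_cvg] applies on [[0, x]]
    with a deterministic propagator. The degenerate interval at [x = 0] is treated by hand. *)
Lemma ou_sum_cvg x : 0 <= x ->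
  \forall w \ae P, ou_sum x n w @[n --> \oo] --> ou_noise x w /\ y x w = ou_solution x w.
Proof.
rewrite le_eqVlt => /predU1P[<-|x0].
  have E w : ou_sum 0 ^~ w = cst 0.
    apply/funext => n; rewrite /ou_sum big1 ?mulr0// => i _.
    by rewrite /grid !subr0 mul0r !mulr0 subrr mulr0.
  have E2 w : ou_noise 0 w = 0 by apply: fine_limn_esup; rewrite E; exact: cvg_cst.
  apply: aeW => w; rewrite /ou_solution E E2 mulr0 oppr0 expR0 mul1r addr0; split => //.
  exact: cvg_cst.
have := @linear_sde_cvg _ _ _ P (fun _ _ => kappa) y B s x x0 hy.
move=> /(_ _) H; apply: filterS (H _) => [w yw|]; last first.
  by apply: aeW => w; split; [exact: measurable_cst|exists `|kappa|].
rewrite propagator_cst ?(ltW x0)// subr0 in yw.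
have c : ou_sum x n w @[n --> \oo] --> y x w - expR (- (kappa * x)) * y 0 w.
  rewrite (_ : ou_sum x ^~ w = fun n => expR (- (kappa * x)) * y 0 w +
    s * \sum_(i < n.+1) propagator (fun=> kappa) x (grid 0 x n.+1 i) *
      (B (grid 0 x n.+1 i.+1) w - B (grid 0 x n.+1 i) w) - expR (- (kappa * x)) * y 0 w).
    by apply: cvgB => //; exact: cvg_cst.
  apply/funext => n; rewrite addrAC subrr add0r /ou_sum; congr (_ * _).
  apply: eq_bigr => i _; rewrite propagator_cst//.
  by have /andP[] := grid_itv (ltW x0) (ltnW (ltn_ord i)).
have nE : ou_noise x w = y x w - expR (- (kappa * x)) * y 0 w by exact: fine_limn_esup.
by rewrite /ou_solution nE subrKC; split.
Qed.

Lemma adapted_ou_sum x n : 0 <= x -> adapted (sigma_path B) (ou_sum x n).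
Proof.
move=> x0; have sB := sigma_algebra_path B.
apply: adaptedM => //; first exact: adapted_cst.
apply: adapted_sum => // i; apply: adaptedM => //; first exact: adapted_cst.
by apply: adapted_path_increment; rewrite -{1}(grid0 0 x n.+1) le_grid.
Qed.

Lemma adapted_ou_noise x : 0 <= x -> adapted (sigma_path B) (ou_noise x).
Proof.
move=> x0; apply: adapted_limn_sup; first exact: sigma_algebra_path.
by move=> n; exact: adapted_ou_sum.
Qed.

Let mB : sigma_path B `<=` measurable.
Proof. by apply: sigma_path_measurable; exact: (bm_measurable hB). Qed.

(* Abel summation writes [ou_sum] as a subconvex combination of the increments
   [s * (B x - B t_i)], so Jensen's inequality reduces the joint exponential moment
   to moment generating functions of single increments. *)
Lemma ou_noise_exp_moment x c : 0 <= x ->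
  (fun w => expR (c * ou_noise x w)) \in Lfun P 1 /\
  Ex (fun w => expR (c * ou_noise x w)) <= expR (c ^+ 2 * s ^+ 2 * x / 2).
Proof.
move=> x0.
have mexp (X : Om -> R) : measurable_fun setT X -> measurable_fun setT (fun w => expR (c * X w)).
  by move=> mX; apply: measurableT_comp => //; exact: measurable_funM.
have mS n : measurable_fun setT (ou_sum x n).
  exact: sub_measurable_adapted mB (adapted_ou_sum n x0).
have mN : measurable_fun setT (ou_noise x).
  exact: sub_measurable_adapted mB (adapted_ou_noise x0).
set C := expR (c ^+ 2 * s ^+ 2 * x / 2).
have key n : (fun w => expR (c * ou_sum x n w)) \in Lfun P 1 /\
    Ex (fun w => expR (c * ou_sum x n w)) <= C.
  pose t i := grid 0 x n.+1 i.
  pose k i := expR (- (kappa * (x - t i))).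
  pose p (i : 'I_n.+1) := backward_difference k i.
  have tx (i : 'I_n.+1) : 0 <= t i <= x by apply: grid_itv => //; exact: ltnW.
  have p0 i : 0 <= p i.
    rewrite /p /backward_difference; case: i => -[|i] /= _; first by rewrite subr0 expR_ge0.
    by rewrite subr_ge0 ler_expR lerN2 ler_pM2l// lerD2l lerN2 le_grid.
  have p1 : \sum_(i < n.+1) p i <= 1.
    rewrite sum_backward_difference -expR0 ler_expR oppr_le0 mulr_ge0 ?(ltW kappa0)//.
    by rewrite subr_ge0; have /andP[] := tx ord_max.
  have SE w : c * ou_sum x n w = \sum_(i < n.+1) p i * (c * s * (B x w - B (t i) w)).
    rewrite /ou_sum (Abel_summation k (fun i => B (t i) w)) /t gridn !mulr_sumr.
    by apply: eq_bigr => i _; rewrite /p; ring.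
  have G i := gaussian_mgf (c * s) (bm_increment hB (proj1 (andP (tx i))) (proj2 (andP (tx i)))).
  pose U w := \sum_(i < n.+1) p i * expR (c * s * (B x w - B (t i) w)) + (1 - \sum_(i < n.+1) p i).
  have pG (i : 'I_n.+1) : (fun w => p i * expR (c * s * (B x w - B (t i) w))) \in Lfun P 1.
    by apply: Lfun1Z; have [] := G i.
  have U1 : U \in Lfun P 1 by apply: Lfun1D; [exact: Lfun1_sum|exact: Lfun1_cst].
  have FU w : expR (c * ou_sum x n w) <= U w by rewrite SE; exact: expR_Jensen.
  have F1 : (fun w => expR (c * ou_sum x n w)) \in Lfun P 1.
    by apply: le_Lfun1 U1 _; [exact: mexp|move=> w; rewrite ger0_norm ?expR_ge0].
  split => //; apply: le_trans (le_Ex F1 U1 FU) _.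
  rewrite ExD; [|exact: Lfun1_sum|exact: Lfun1_cst].
  rewrite Ex_cst Ex_sum//.
  have C1 : 1 <= C.
    rewrite -expR0 ler_expR; apply: divr_ge0 => //; apply: mulr_ge0 => //.
    by apply: mulr_ge0; exact: sqr_ge0.
  (* Each increment spans a time of at most [x], so its generating function is at most [C]; the
     missing mass is weighted by 1, which is at most [C] too. *)
  apply: (@le_trans _ _ (\sum_(i < n.+1) p i * C + (1 - \sum_(i < n.+1) p i) * C)); last first.
    by rewrite -mulr_suml; lra.
  apply: lerD; last by rewrite ler_peMr// subr_ge0.
  apply: ler_sum => i _; have [Gi1 GiE] := G i.
  rewrite ExZ// GiE ler_wpM2l// mulr0 add0r ler_expR ler_pM2r ?invr_gt0//.
  have /andP[ti0 tix] := tx i.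
  rewrite sqr_sqrtr ?subr_ge0// exprMn ler_wpM2l//; first by apply: mulr_ge0; exact: sqr_ge0.
  by rewrite lerBlDr lerDl.
apply: (@fatou_Ex _ _ _ P (fun n w => expR (c * ou_sum x n w)) _ C (fun=> C)).
- by move=> n; have [] := key n.
- by move=> n w; exact: expR_ge0.
- exact: mexp.
- by move=> w; exact: expR_ge0.
- apply: filterS (ou_sum_cvg x0) => w [cw _].
  have cw' : c * ou_sum x n w @[n --> \oo] --> c * ou_noise x w.
    by apply: cvgM => //; exact: cvg_cst.
  by apply: (cvg_comp _ _ cw'); exact: continuous_expR.
- by move=> n; have [] := key n.
- exact: cvg_cst.
Qed.

End Ornstein_Uhlenbeck.

(** To be read with [q = s / kappa], [i = kappa^-1], [r = m1 - mu] and [s = s1]. The values 2 and -2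
    of [c] come from squaring the propagator error and the factor 4 from [expR_avg4], so that
    [(4 * c * q) ^+ 2 / 2 = 32 * q ^+ 2]. The four bounds concern the Brownian increment, the noise
    at [T], the noise at [x] and the initial value. *)
Lemma damping_exponents (R : realType) (c q i r s x T t : R) :
  c ^+ 2 = 4 -> 0 <= x <= T -> 0 <= i -> `|t| <= 8 * i ->
  let E := 32 * q ^+ 2 * T + 8 * i * `|r| + 32 * i ^+ 2 * s ^+ 2 in
  [/\ (4 * c * q) ^+ 2 * (T - x) / 2 <= E, (4 * c * q) ^+ 2 * T / 2 <= E,
      (4 * c * q) ^+ 2 * x / 2 <= E & t * r + t ^+ 2 * s ^+ 2 / 2 <= E].
Proof.
move=> c4 /andP[x0 xT] i0 ti E.
have -> : (4 * c * q) ^+ 2 = 64 * q ^+ 2 by rewrite !exprMn c4; ring.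
have al0 : 0 <= q ^+ 2 * x by rewrite mulr_ge0 ?sqr_ge0.
have al1 : q ^+ 2 * x <= q ^+ 2 * T by rewrite ler_wpM2l ?sqr_ge0.
have be0 : 0 <= i * `|r| by rewrite mulr_ge0.
have ga0 : 0 <= i ^+ 2 * s ^+ 2 by apply: mulr_ge0; exact: sqr_ge0.
have h1 : t * r <= 8 * i * `|r| by apply: le_trans (ler_norm _) _; rewrite normrM ler_wpM2r.
have h2 : t ^+ 2 * s ^+ 2 <= (8 * i) ^+ 2 * s ^+ 2.
  by rewrite ler_wpM2r ?sqr_ge0// -real_normK ?num_real// lerXn2r// nnegrE mulr_ge0.
have h3 : (8 * i) ^+ 2 * s ^+ 2 = 64 * (i ^+ 2 * s ^+ 2) by ring.
by rewrite /E; split; lra.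
Qed.

Lemma damping_coefficient_le (R : realType) (c i a b : R) :
  c ^+ 2 = 4 -> 0 <= i -> 0 <= a <= 1 -> 0 <= b <= 1 -> `|4 * c * i * (a - b)| <= 8 * i.
Proof.
move=> c4 i0 /andP[a0 a1] /andP[b0 b1].
have D1 : `|a - b| <= 1 by rewrite ler_norml; apply/andP; split; lra.
have c2 : `|c| <= 2 by rewrite -(@ler_pXn2r _ 2)// ?nnegrE// real_normK ?num_real// c4; lra.
rewrite !normrM (ger0_norm i0) (ger0_norm (ler0n _ 4)).
have -> : 4 * `|c| * i * `|a - b| = 4 * i * (`|c| * `|a - b|) by ring.
have -> : 8 * i = 4 * i * (2 * 1) by ring.
by rewrite ler_wpM2l ?mulr_ge0//; exact: ler_pM.
Qed.

(** * The propagator under diffusive damping *)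

Section diffusive.
Context {d : measure_display} {Om : measurableType d} {R : realType}.
Variable P : probability Om R.
Local Notation Ex := (Rintegral P setT).
Variables (kappa mu s m1 s1 T : R) (B g : R -> Om -> R).
Hypothesis kappa0 : 0 < kappa.
Hypothesis T0 : 0 < T.
Hypothesis hB : brownian_motion P B.
Hypothesis hg : additive_sde P (fun t w => - kappa * (g t w - mu)) s B g.
Hypothesis lg : has_law P (g 0) (gaussian m1 s1).

Let y t w := g t w - mu.

Let y_sde : additive_sde P (fun t w => - kappa * y t w) s B y.
Proof.
case: hg => mg cg eg; split.
- by move=> t t0; apply: measurable_funB => //; exact: mg.
- apply: filterS cg => w cw t; apply: cvgB; [exact: cw|exact: cvg_cst].
- apply: filterS eg => w ew t t0; have [? E] := ew t t0; split => //.
  by rewrite /y E /y; ring.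
Qed.

(** Almost surely equal to [y] at each time, but a function of [g 0] and the noise, hence exactly
    adapted to the [F] introduced below. *)
Let Y := ou_solution kappa s B y.

(* Equals [\int_x^T (g - mu)] almost surely: this is the equation of [g] integrated
   over [[x, T]] and divided by [kappa]. *)
Definition damping_deviation (x : R) (w : Om) : R :=
  s / kappa * (B T w - B x w) - kappa^-1 * (Y T w - Y x w).

Definition diffusive_propagator (x : R) (w : Om) : R :=
  expR (- (mu * (T - x) + damping_deviation x w)).

Lemma diffusive_path_regular : \forall w \ae P,
  measurable_fun `[0, T] (g^~ w) /\ exists M, forall t, 0 <= t <= T -> `|g t w| <= M.
Proof.
apply: filterS (sde_continuous hg) => w cw.
have {}cw : {within `[0, T], continuous (g^~ w)}.
  by apply: continuous_subspaceW cw => t /=; rewrite in_itv/= => /andP[].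
split; first by apply: subspace_continuous_measurable_fun => //; exact: measurable_itv.
by have [U _ HU] := within_continuous_bounded cw; exists U.
Qed.

Lemma diffusive_propagatorE x : 0 <= x <= T ->
  \forall w \ae P, diffusive_propagator x w = propagator (g^~ w) T x.
Proof.
move=> /andP[x0 xT].
have OT := ou_sum_cvg y_sde (ltW T0); have Ox := ou_sum_cvg y_sde x0.
have cy := sde_continuous y_sde; have ey := sde_equation y_sde.
near=> w.
have [_ yT] : ou_sum kappa s B T n w @[n --> \oo] --> ou_noise kappa s B T w /\
  y T w = ou_solution kappa s B y T w by near: w.
have [_ yx] : ou_sum kappa s B x n w @[n --> \oo] --> ou_noise kappa s B x w /\
  y x w = ou_solution kappa s B y x w by near: w.
have cw : {within `[0, T], continuous (y^~ w)}.
  have : {within [set t | 0 <= t], continuous (y^~ w)} by near: w.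
  by apply: continuous_subspaceW => t /=; rewrite in_itv/= => /andP[].
have ew : forall t, 0 <= t ->
    lebesgue_measure.-integrable `[0, t] (fun r => (- kappa * y r w)%:E) /\
    y t w = y 0 w + \int[lebesgue_measure]_(r in `[0, t]) (- kappa * y r w)
            + s * (B t w - B 0 w) by near: w.
have iy : lebesgue_measure.-integrable `[x, T[ (EFin \o y^~ w).
  have iT : lebesgue_measure.-integrable `[0, T] (EFin \o y^~ w).
    by apply: continuous_compact_integrable => //; exact: segment_compact.
  by apply: integrableS iT => //; apply: subset_itvScc; rewrite bnd_simp.
have ic : lebesgue_measure.-integrable `[x, T[ (EFin \o (fun=> mu)).
  apply: measurable_bounded_integrable => //.
    rewrite /= lebesgue_measure_itv/= lte_fin; case: ifP => _; last exact: ltry.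
    by rewrite -EFinD ltry.
  by exists `|mu|; split => // z Mz t _ /=; exact: ltW.
(* The increment of [y] over [[x, T]] is [- kappa] times its integral plus noise; solved for the
   integral, it yields [damping_deviation]. *)
have inc := @linear_equation_increment _ (fun=> kappa) (y^~ w) (B^~ w) T `|kappa| s T0
  (@measurable_cst _ _ _ _ _ _) (fun _ _ => lexx _) cw
  (fun t tT => proj2 (ew t (proj1 (andP tT)))) x T x0 xT (lexx _).
rewrite RintegralZl// in inc.
rewrite /diffusive_propagator /propagator /damping_deviation /Y -yT -yx inc.
congr (expR (- _)).
have -> : \int[lebesgue_measure]_(r in `[x, T[) g r w =
    \int[lebesgue_measure]_(r in `[x, T[) y r w + mu * (T - x).
  have -> : mu * (T - x) = \int[lebesgue_measure]_(r in `[x, T[) mu.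
    rewrite Rintegral_cst//= lebesgue_measure_itv/= lte_fin.
    by move: (xT); rewrite le_eqVlt => /predU1P[->|->]//; rewrite ltxx subrr.
  by rewrite -RintegralD//; apply: eq_Rintegral => r _; rewrite /y subrK.
by field; rewrite gt_eqF.
Unshelve. all: by end_near.
Qed.

(** In the model, the initial value and noise of [u] are independent of [g 0] and [B]; nothing is
    stated about the path of [g], so the propagator has to be measured by these two. *)
Let F := sigma_join (sigma_rv (g 0)) (sigma_path B).

Let sF : sigma_algebra setT F. Proof. exact: smallest_sigma_algebra. Qed.

Let adF (X : Om -> R) : adapted (sigma_path B) X -> adapted F X.
Proof.
apply: sub_adapted; apply: sub_sigma_join2.
by exists setT => //; rewrite setTI preimage_setT.
Qed.

Let ag0 : adapted F (g 0).
Proof.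
apply: sub_adapted (@adapted_rv _ _ _ (g 0)); apply: sub_sigma_join1.
have [h0 hD _] := sigma_algebra_path B; have := hD _ h0; rewrite setD0; exact.
Qed.

Let aY x : 0 <= x -> adapted F (Y x).
Proof.
move=> x0; apply: adaptedD => //; last by apply: adF; exact: adapted_ou_noise.
apply: adaptedM => //; first exact: adapted_cst.
by apply: adaptedD => //; exact: adapted_cst.
Qed.

Let adN (X : Om -> R) : adapted F X -> adapted F (fun w => - X w).
Proof. by move=> aX; apply: (@adapted_comp _ _ _ F X -%R). Qed.

Let aZ x : 0 <= x <= T -> adapted F (damping_deviation x).
Proof.
move=> /andP[x0 xT]; apply: adaptedD => //.
  apply: adaptedM => //; first exact: adapted_cst.
  by apply: adF; apply: adapted_path_increment => //; exact: ltW.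
apply: adN; apply: adaptedM => //; first exact: adapted_cst.
by apply: adaptedD => //; [apply: aY; exact: ltW|apply: adN; exact: aY].
Qed.

Lemma adapted_diffusive_propagator x : 0 <= x <= T -> adapted F (diffusive_propagator x).
Proof.
move=> xT; apply: (@adapted_comp _ _ _ F (damping_deviation x) (fun z => expR (- (mu * (T - x) + z)))).
  apply: measurableT_comp => //; apply: measurableT_comp => //.
  exact: measurable_funD.
exact: aZ.
Qed.

Lemma sigma_join_damping_measurable : F `<=` measurable.
Proof.
apply: sigma_join_measurable.
  move=> _ [A mA <-]; have [mg _] := lg; exact: mg.
by apply: sigma_path_measurable; exact: (bm_measurable hB).
Qed.

Let mZ x : 0 <= x <= T -> measurable_fun setT (damping_deviation x).
Proof. by move=> xT; apply: sub_measurable_adapted sigma_join_damping_measurable (aZ xT). Qed.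

(** A common bound for the four exponential moments. In the model [kappa = nu / eps] and
    [s = sg / Num.sqrt eps], so [(s / kappa) ^+ 2] and [kappa^-1] are of order [eps], and the
    exponent tends to 0. *)
Definition damping_bound : R :=
  expR (32 * (s / kappa) ^+ 2 * T + 8 * kappa^-1 * `|m1 - mu| + 32 * kappa^-1 ^+ 2 * s1 ^+ 2).

(** The deviation is the sum of a Brownian increment, a multiple of [g 0 - mu], and the noise at [T]
    and at [x]. [expR_avg4] separates them, and each then has an exponential moment of at most
    [damping_bound]. *)
Lemma damping_deviation_exp_moment x c : 0 <= x <= T -> c ^+ 2 = 4 ->
  (fun w => expR (c * damping_deviation x w)) \in Lfun P 1 /\
  Ex (fun w => expR (c * damping_deviation x w)) <= damping_bound.
Proof.
move=> /[dup] xI /andP[x0 xT] c4.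
have ki : 0 < kappa^-1 by rewrite invr_gt0.
pose t := 4 * c * kappa^-1 * (expR (- (kappa * x)) - expR (- (kappa * T))).
have [a1 E1] := gaussian_mgf (4 * c * (s / kappa)) (bm_increment hB x0 xT).
have [a2 E2] := gaussian_mgf t lg.
have [a3 E3] := ou_noise_exp_moment kappa0 hB y_sde (- (4 * c * kappa^-1)) (ltW T0).
have [a4 E4] := ou_noise_exp_moment kappa0 hB y_sde (4 * c * kappa^-1) x0.
pose U w := 4^-1 * (expR (4 * c * (s / kappa) * (B T w - B x w)) +
   expR (- (t * mu)) * expR (t * g 0 w) +
   expR (- (4 * c * kappa^-1) * ou_noise kappa s B T w) +
   expR (4 * c * kappa^-1 * ou_noise kappa s B x w)).
have b2 : (fun w => expR (- (t * mu)) * expR (t * g 0 w)) \in Lfun P 1 by exact: Lfun1Z.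
have b12 := Lfun1D a1 b2; have b123 := Lfun1D b12 a3; have b1234 := Lfun1D b123 a4.
have U1 : U \in Lfun P 1 by exact: Lfun1Z.
have ZU w : expR (c * damping_deviation x w) <= U w.
  have -> : c * damping_deviation x w =
    c * (s / kappa) * (B T w - B x w) +
    c * kappa^-1 * (expR (- (kappa * x)) - expR (- (kappa * T))) * (g 0 w - mu) +
    - (c * kappa^-1 * ou_noise kappa s B T w) + c * kappa^-1 * ou_noise kappa s B x w.
    by rewrite /damping_deviation /Y /ou_solution /y; ring.
  apply: le_trans (expR_avg4 _ _ _ _) _; rewrite /U mulrC ler_pM2l// -expRD.
  rewrite le_eqVlt; apply/orP; left; apply/eqP.
  by congr (expR _ + expR _ + expR _ + expR _); rewrite /t; ring.
have F1 : (fun w => expR (c * damping_deviation x w)) \in Lfun P 1.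
  apply: le_Lfun1 U1 _; last by move=> w; rewrite ger0_norm ?expR_ge0.
  by apply: measurableT_comp => //; apply: measurable_funM => //; exact: mZ.
split => //; apply: le_trans (le_Ex F1 U1 ZU) _.
rewrite /U (ExZ _ b1234) (ExD b123 a4) (ExD b12 a3) (ExD a1 b2) (ExZ _ a2) E1 E2.
have e01 z : 0 <= z -> 0 <= expR (- (kappa * z)) <= 1.
  by move=> z0; rewrite expR_ge0/= -expR0 ler_expR oppr_le0 mulr_ge0// ltW.
have [l1 l3 l4 l2] := damping_exponents (s / kappa) (m1 - mu) s1 c4 xI (ltW ki)
  (damping_coefficient_le c4 (ltW ki) (e01 _ x0) (e01 _ (ltW T0))).
have k1 : expR (4 * c * (s / kappa) * 0 +
    (4 * c * (s / kappa)) ^+ 2 * Num.sqrt (T - x) ^+ 2 / 2) <= damping_bound.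
  by rewrite ler_expR sqr_sqrtr ?subr_ge0// mulr0 add0r.
have k2 : expR (- (t * mu)) * expR (t * m1 + t ^+ 2 * s1 ^+ 2 / 2) <= damping_bound.
  rewrite -expRD ler_expR; apply: le_trans l2; rewrite /t mulrBr.
  by rewrite le_eqVlt; apply/orP; left; apply/eqP; ring.
have k3 : expR ((- (4 * c * kappa^-1)) ^+ 2 * s ^+ 2 * T / 2) <= damping_bound.
  rewrite ler_expR; apply: le_trans l3.
  by rewrite le_eqVlt; apply/orP; left; apply/eqP; ring.
have k4 : expR ((4 * c * kappa^-1) ^+ 2 * s ^+ 2 * x / 2) <= damping_bound.
  rewrite ler_expR; apply: le_trans l4.
  by rewrite le_eqVlt; apply/orP; left; apply/eqP; ring.
have := lerD (lerD (lerD k1 k2) (le_trans E3 k3)) (le_trans E4 k4).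
have -> : damping_bound + damping_bound + damping_bound + damping_bound = 4 * damping_bound by ring.
by rewrite -(@ler_pdivrMl _ 4).
Qed.

(** With [Z] the deviation, the error is [k * (expR (- Z) - 1)]. By [sqr_expR_sub1_le] its square is
    controlled by the moments of [expR (2 * Z)] and [expR (- 2 * Z)], with no pathwise bound on
    [Z]. *)
Lemma diffusive_propagator_close x : 0 <= x <= T ->
  (fun w => diffusive_propagator x w - expR (- (mu * (T - x)))) \in Lfun P 2%:E /\
  Ex (fun w => (diffusive_propagator x w - expR (- (mu * (T - x)))) ^+ 2) <=
    expR (`|mu| * T) ^+ 2 * (2 * (damping_bound - 1)).
Proof.
move=> /[dup] xI /andP[x0 xT].
set k := expR (- (mu * (T - x))).
have [p1 pE] := damping_deviation_exp_moment (c := 2) xI ltac:(by rewrite expr2; ring).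
have [n1 nE] := damping_deviation_exp_moment (c := - 2) xI ltac:(by rewrite sqrrN expr2; ring).
pose U w := expR (`|mu| * T) ^+ 2 *
  (expR (2 * damping_deviation x w) + expR (- 2 * damping_deviation x w) - 2).
have b1 := Lfun1D p1 n1.
have b2 := Lfun1B b1 (Lfun1_cst P 2).
have U1 : U \in Lfun P 1 by exact: Lfun1Z.
have kE : k <= expR (`|mu| * T).
  rewrite ler_expR; apply: le_trans (ler_norm _) _; rewrite normrN normrM ler_wpM2l//.
  by rewrite ger0_norm ?subr_ge0// lerBlDr lerDl.
have KU w : (diffusive_propagator x w - k) ^+ 2 <= U w.
  have -> : diffusive_propagator x w - k = k * (expR (- damping_deviation x w) - 1).
    by rewrite mulrBr mulr1 /k -expRD -opprD.
  rewrite exprMn; apply: ler_pM; rewrite ?sqr_ge0//; last exact: sqr_expR_sub1_le.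
  by rewrite lerXn2r// nnegrE expR_ge0.
have mK : measurable_fun setT (fun w => diffusive_propagator x w - k).
  apply: measurable_funB => //.
  exact: sub_measurable_adapted sigma_join_damping_measurable (adapted_diffusive_propagator xI).
have F1 : (fun w => (diffusive_propagator x w - k) ^+ 2) \in Lfun P 1.
  by apply: le_Lfun1 U1 _; [exact: measurable_funX|move=> w; rewrite ger0_norm ?sqr_ge0].
split; first exact: Lfun2P.
apply: le_trans (le_Ex F1 U1 KU) _.
rewrite /U (ExZ _ b2) (ExB b1 (Lfun1_cst P 2)) (ExD p1 n1) Ex_cst ler_wpM2l ?sqr_ge0//.
have -> : 2 * (damping_bound - 1) = damping_bound + damping_bound - 2 by ring.
by rewrite lerD2r lerD.
Qed.

End diffusive.

(** * The three models *)

Definition mean_propagator {R : realType} (gbar T x : R) : R := expR (- (gbar * (T - x))).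

Lemma mean_propagator_exponent (R : realType) (gbar T x : R) : 0 <= x <= T ->
  - (gbar * (T - x)) <= `|gbar| * T.
Proof.
move=> /andP[x0 xT]; apply: le_trans (ler_norm _) _; rewrite normrN normrM ler_wpM2l//.
by rewrite ger0_norm ?subr_ge0// lerBlDr lerDl.
Qed.

Lemma mean_propagator_lip (R : realType) (gbar T x y : R) : 0 <= x <= T -> 0 <= y <= T ->
  `|mean_propagator gbar T x - mean_propagator gbar T y| <=
    expR (`|gbar| * T) * `|gbar| * `|x - y|.
Proof.
move=> xI yI; have := expR_lip (mean_propagator_exponent gbar xI) (mean_propagator_exponent gbar yI).
rewrite -mulrA -normrM; congr (_ <= _ * `|_|); ring.
Qed.

Lemma mean_propagator_sqr_le (R : realType) (gbar T x : R) : 0 <= x <= T ->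
  mean_propagator gbar T x ^+ 2 <= expR (`|gbar| * T) ^+ 2.
Proof.
by move=> xI; rewrite lerXn2r ?nnegrE ?expR_ge0// ler_expR mean_propagator_exponent.
Qed.

(** [q] is the second moment of the initial value, and [L = expR (|gbar| * T) * |gbar|] the
    Lipschitz constant of [mean_propagator]. The factor [1 + L ^+ 2] lets one constant multiply both
    [de] and the squared mesh. *)
Definition discretization_constant {R : realType} (gbar su T q : R) : R :=
  2 * q + 4 * su ^+ 2 * (1 + (expR (`|gbar| * T) * `|gbar|) ^+ 2) * (8 * expR 1 * T).

Section approximation.
Context {d : measure_display} {Om : measurableType d} {R : realType}.
Variables (P : probability Om R) (gbar su T : R).
Local Notation Ex := (Rintegral P setT).

Lemma random_damping_approximation (g u B K : R -> Om -> R) (F : set (set Om)) (m0 s0 de : R) :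
  0 < T -> 0 <= de -> brownian_motion P B ->
  additive_sde P (fun t w => - g t w * u t w) su B u ->
  has_law P (u 0) (gaussian m0 s0) -> indep P (sigma_rv (u 0)) (sigma_path B) ->
  (\forall w \ae P, measurable_fun `[0, T] (g^~ w) /\
    exists M, forall t, 0 <= t <= T -> `|g t w| <= M) ->
  sigma_algebra setT F -> indep P F (sigma_path B) -> indep P F (sigma_rv (u 0)) ->
  (forall x, 0 <= x <= T -> adapted F (K x)) ->
  (forall x, 0 <= x <= T -> \forall w \ae P, K x w = propagator (g^~ w) T x) ->
  (forall x, 0 <= x <= T ->
    (fun w => K x w - mean_propagator gbar T x) \in Lfun P 2%:E /\
    Ex (fun w => (K x w - mean_propagator gbar T x) ^+ 2) <= de) ->
  let W n := discrete_solution su T (mean_propagator gbar T) B (u 0) n in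
  forall n, [/\ W n \in Lfun P 2%:E, (fun w => u T w - W n w) \in Lfun P 2%:E &
    Ex (fun w => (u T w - W n w) ^+ 2) <=
      discretization_constant gbar su T (Ex (fun w => u 0 w ^+ 2)) *
      (de + (T / n.+1%:R) ^+ 2)].
Proof.
move=> T0 de0 hB hu lu uB hg sF FB Fu aK KE Kk W n.
have u2 := gaussian_Lfun2 lu.
have [W2 _ _] := discrete_solution_moments (mean_propagator gbar T) su (ltW T0) hB u2 uB n.
have [D2 DE] := linear_sde_discretization T0 hB hu u2 hg sF FB Fu aK KE
  (@mean_propagator_lip _ gbar T) Kk n.
split => //; apply: le_trans DE _.
rewrite /discretization_constant exprMn.
have q0 : 0 <= Ex (fun w => u 0 w ^+ 2) by apply: Ex_ge0 => w; exact: sqr_ge0.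
have M0 : 0 <= 8 * expR 1 * T by rewrite mulr_ge0 ?ltW ?mulr_gt0 ?expR_gt0.
move: (Ex _) (8 * _ * T) q0 M0 (T / _) (expR _ * _) => q M q0 M0 h L.
have a1 : 0 <= q * h ^+ 2 by rewrite mulr_ge0 ?sqr_ge0.
have a2 : 0 <= su ^+ 2 * M * (de * L ^+ 2).
  by apply: mulr_ge0; apply: mulr_ge0 => //; exact: sqr_ge0.
have a3 : 0 <= su ^+ 2 * M * h ^+ 2.
  by apply: mulr_ge0; [apply: mulr_ge0 => //; exact: sqr_ge0|exact: sqr_ge0].
rewrite -subr_ge0.
rewrite [X in 0 <= X](_ : _ = 2 * (q * h ^+ 2) + 4 * (su ^+ 2 * M * (de * L ^+ 2)) +
  4 * (su ^+ 2 * M * h ^+ 2)); last by ring.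
by rewrite !addr_ge0// mulr_ge0.
Qed.

Lemma sigma_rv_measurable (X : Om -> R) : measurable_fun setT X -> sigma_rv X `<=` measurable.
Proof. by move=> mX _ [A mA <-]; exact: mX. Qed.

(** The sigma-algebra of a constant serves as [F] for MSM, whose propagator is deterministic. *)
Lemma indep_trivial (F : set (set Om)) : F `<=` measurable ->
  indep P (sigma_rv (fun=> 0 : R)) F.
Proof.
move=> Fm _ B [A mA <-] FB; rewrite setTI.
case: (pselect (A 0)) => A0.
- rewrite (_ : _ @^-1` _ = setT); last by apply/seteqP; split.
  by rewrite setTI probability_setT mul1e.
- rewrite (_ : _ @^-1` _ = set0); last by apply/seteqP; split.
  by rewrite set0I measure0 mul0e.
Qed.

Lemma constant_damping_approximation (u B : R -> Om -> R) (m0 s0 : R) :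
  0 < T -> MSM P gbar su B u ->
  has_law P (u 0) (gaussian m0 s0) -> indep P (sigma_rv (u 0)) (sigma_path B) ->
  let W n := discrete_solution su T (mean_propagator gbar T) B (u 0) n in
  forall n, [/\ W n \in Lfun P 2%:E, (fun w => u T w - W n w) \in Lfun P 2%:E,
    Ex (fun w => (u T w - W n w) ^+ 2) <=
      discretization_constant gbar su T (Ex (fun w => u 0 w ^+ 2)) * (T / n.+1%:R) ^+ 2 &
    Ex (fun w => W n w ^+ 2) <=
      expR (`|gbar| * T) ^+ 2 * Ex (fun w => u 0 w ^+ 2) +
      su ^+ 2 * (expR (`|gbar| * T) ^+ 2 * (8 * expR 1 * T))].
Proof.
move=> T0 [hB hu] lu uB W n; have u2 := gaussian_Lfun2 lu.
have [mu0 _] := lu.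
have cK x : 0 <= x <= T -> (fun w : Om => mean_propagator gbar T x - mean_propagator gbar T x) \in Lfun P 2%:E /\
    Ex (fun w => (mean_propagator gbar T x - mean_propagator gbar T x) ^+ 2) <= 0.
  by move=> _; rewrite subrr expr0n/= Ex_cst; split => //; exact: Lfun2_cst.
have [W2 D2 DE] := @random_damping_approximation (fun _ _ => gbar) u B
  (fun x _ => mean_propagator gbar T x) (sigma_rv (fun=> 0 : R)) m0 s0 0 T0 (lexx 0) hB hu lu uB
  ltac:(by apply: nearW => w; split => //; exists `|gbar|)
  (sigma_algebra_rv _) (indep_trivial (sigma_path_measurable (bm_measurable hB)))
  (indep_trivial (sigma_rv_measurable mu0))
  (fun x _ => adapted_cst _ (sigma_algebra_rv _))
  ltac:(by move=> x /andP[x0 xT]; apply: nearW => w; rewrite propagator_cst) cK n.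
rewrite add0r in DE; split => //.
by apply: (discrete_solution_sqr_le _ (ltW T0) hB u2 uB) => x; exact: mean_propagator_sqr_le.
Qed.

Lemma switching_damping_approximation (gp gm lp lm eps : R) (B g u : R -> Om -> R) (m0 s0 : R) :
  0 < T -> gm < gp -> 0 < lp -> 0 < lm -> 0 < eps ->
  SSM P gp gm lp lm su eps B g u -> has_law P (u 0) (gaussian m0 s0) ->
  mutually_independent P (tnth [tuple sigma_rv (u 0); sigma_path g; sigma_path B]) ->
  gbar = (lm * gp + lp * gm) / (lm + lp) ->
  let W n := discrete_solution su T (mean_propagator gbar T) B (u 0) n in
  forall n, [/\ W n \in Lfun P 2%:E, (fun w => u T w - W n w) \in Lfun P 2%:E &
    Ex (fun w => (u T w - W n w) ^+ 2) <=
      discretization_constant gbar su T (Ex (fun w => u 0 w ^+ 2)) *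
      (expR ((`|gp| + `|gm|) * T) ^+ 2 * (3 * (gp - gm) ^+ 2 * T * (eps / (lp + lm))) +
       (T / n.+1%:R) ^+ 2)].
Proof.
move=> T0 gpm lp0 lm0 e0 [hB hg hu] lu hI gbarE.
have ug : indep P (sigma_path g) (sigma_rv (u 0)) :=
  mutually_independent_pair (i := @Ordinal 3 1 isT) (j := @Ordinal 3 0 isT) hI isT.
have gB : indep P (sigma_path g) (sigma_path B) :=
  mutually_independent_pair (i := @Ordinal 3 1 isT) (j := @Ordinal 3 2 isT) hI isT.
have uB : indep P (sigma_rv (u 0)) (sigma_path B) :=
  mutually_independent_pair (i := @Ordinal 3 0 isT) (j := @Ordinal 3 2 isT) hI isT.
have V0 : 0 <= 3 * (gp - gm) ^+ 2 * T * (eps / (lp + lm)).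
  have h1 : 0 <= eps / (lp + lm) by rewrite ltW// divr_gt0// addr_gt0.
  have h2 := sqr_ge0 (gp - gm).
  by rewrite mulr_ge0// mulr_ge0 ?(ltW T0)// mulr_ge0.
apply: (random_damping_approximation T0 (mulr_ge0 (sqr_ge0 _) V0) hB hu lu uB
  (switching_path_regular hg T0) (sigma_algebra_path _) gB ug
  (fun x => @adapted_switching_propagator _ _ _ g T x)
  (fun x => @switching_propagatorE _ _ _ P _ _ _ _ _ g hg T x)).
by move=> x xI; rewrite /mean_propagator gbarE; exact: switching_propagator_close.
Qed.

Lemma diffusive_damping_approximation (kappa s m1 s1 : R) (Bu Bg g u : R -> Om -> R) (m0 s0 : R) :
  0 < T -> 0 < kappa -> brownian_motion P Bu -> brownian_motion P Bg ->
  additive_sde P (fun t w => - kappa * (g t w - gbar)) s Bg g ->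
  additive_sde P (fun t w => - g t w * u t w) su Bu u ->
  has_law P (u 0) (gaussian m0 s0) -> has_law P (g 0) (gaussian m1 s1) ->
  mutually_independent P
    (tnth [tuple sigma_rv (u 0); sigma_rv (g 0); sigma_path Bu; sigma_path Bg]) ->
  let W n := discrete_solution su T (mean_propagator gbar T) Bu (u 0) n in
  forall n, [/\ W n \in Lfun P 2%:E, (fun w => u T w - W n w) \in Lfun P 2%:E &
    Ex (fun w => (u T w - W n w) ^+ 2) <=
      discretization_constant gbar su T (Ex (fun w => u 0 w ^+ 2)) *
      (expR (`|gbar| * T) ^+ 2 * (2 * (damping_bound kappa gbar s m1 s1 T - 1)) +
       (T / n.+1%:R) ^+ 2)].
Proof.
move=> T0 k0 hBu hBg hg hu lu lg hI.
have [mu0 _] := lu; have [mg0 _] := lg.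
have mBu := sigma_path_measurable (bm_measurable hBu).
have mBg := sigma_path_measurable (bm_measurable hBg).
have mur := sigma_rv_measurable mu0; have mgr := sigma_rv_measurable mg0.
have uB : indep P (sigma_rv (u 0)) (sigma_path Bu) :=
  mutually_independent_pair (i := @Ordinal 4 0 isT) (j := @Ordinal 4 2 isT) hI isT.
have gBg : indep P (sigma_rv (g 0)) (sigma_path Bg) :=
  mutually_independent_pair (i := @Ordinal 4 1 isT) (j := @Ordinal 4 3 isT) hI isT.
have join H : H `<=` measurable -> (forall A1 A2 A3, sigma_rv (g 0) A1 -> sigma_path Bg A2 ->
    H A3 -> P (A1 `&` A2 `&` A3) = (P A1 * P A2 * P A3)%E) ->
    indep P (sigma_join (sigma_rv (g 0)) (sigma_path Bg)) H.
  by move=> mH; apply: indep_sigma_join gBg;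
    [exact: sigma_algebra_rv|exact: sigma_algebra_path|exact: mgr|exact: mBg|exact: mH].
have FB : indep P (sigma_join (sigma_rv (g 0)) (sigma_path Bg)) (sigma_path Bu).
  apply: join mBu _ => A1 A2 A3.
  exact: (mutually_independent_triple (i := @Ordinal 4 1 isT) (j := @Ordinal 4 3 isT)
    (k := @Ordinal 4 2 isT) hI isT isT isT).
have Fu : indep P (sigma_join (sigma_rv (g 0)) (sigma_path Bg)) (sigma_rv (u 0)).
  apply: join mur _ => A1 A2 A3.
  exact: (mutually_independent_triple (i := @Ordinal 4 1 isT) (j := @Ordinal 4 3 isT)
    (k := @Ordinal 4 0 isT) hI isT isT isT).
have de0 : 0 <= 2 * (damping_bound kappa gbar s m1 s1 T - 1).
  have i0 : 0 <= kappa^-1 by rewrite invr_ge0 ltW.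
  have h1 := sqr_ge0 (s / kappa); have h2 := sqr_ge0 kappa^-1; have h3 := sqr_ge0 s1.
  have T1 := ltW T0.
  by rewrite mulr_ge0// subr_ge0 -expR0 ler_expR; do !(apply: addr_ge0 || apply: mulr_ge0 => //).
have sF : sigma_algebra setT (sigma_join (sigma_rv (g 0)) (sigma_path Bg)).
  exact: smallest_sigma_algebra.
exact: (random_damping_approximation T0 (mulr_ge0 (sqr_ge0 _) de0) hBu hu lu uB
  (diffusive_path_regular T hg) sF FB Fu
  (fun x => @adapted_diffusive_propagator _ _ _ kappa gbar s T Bg g T0 x)
  (fun x => @diffusive_propagatorE _ _ _ _ _ _ _ _ _ _ k0 T0 hg x)
  (diffusive_propagator_close k0 T0 hBg hg lg)).
Qed.

End approximation.

Lemma damping_bound_cvg (R : realType) (nu mu sg m1 s1 T : R) : nu != 0 ->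
  damping_bound (nu / eps) mu (sg / Num.sqrt eps) m1 s1 T @[eps --> 0^'+] --> (1 : R).
Proof.
move=> nu0.
(* Since [(s / kappa) ^+ 2 = sg ^+ 2 * e / nu ^+ 2], the exponent is [e] times an affine function of
   [e]; in this form it is continuous at 0. *)
pose f (e : R) := expR (e * (32 * sg ^+ 2 / nu ^+ 2 * T + 8 / nu * `|m1 - mu| +
  e * (32 / nu ^+ 2 * s1 ^+ 2))).
have ff : f e @[e --> 0^'+] --> f 0.
  apply: cvg_at_right_filter.
  suff H : e * (32 * sg ^+ 2 / nu ^+ 2 * T + 8 / nu * `|m1 - mu| + e * (32 / nu ^+ 2 * s1 ^+ 2))
      @[e --> (0 : R)] --> 0 * (32 * sg ^+ 2 / nu ^+ 2 * T + 8 / nu * `|m1 - mu| +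
      0 * (32 / nu ^+ 2 * s1 ^+ 2)).
    by apply: (cvg_comp _ _ H); exact: continuous_expR.
  apply: cvgM; first exact: cvg_id.
  by apply: cvgD; [exact: cvg_cst|apply: cvgM; [exact: cvg_id|exact: cvg_cst]].
rewrite /f mul0r expR0 in ff; apply: cvg_trans ff; apply: near_eq_cvg.
near=> e; have e0 : 0 < e by [].
rewrite /damping_bound; congr expR.
have -> : (sg / Num.sqrt e / (nu / e)) ^+ 2 = sg ^+ 2 * e / nu ^+ 2.
  rewrite !exprMn !exprVn !exprMn !exprVn sqr_sqrtr ?(ltW e0)//.
  by field; rewrite nu0 gt_eqF.
by field; rewrite nu0 gt_eqF.
Unshelve. all: by end_near.
Qed.

Theorem theorem3p1 (R : realType)
  (gp gm lp lm su nu sg mu gbar : R)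
  (hgp : 0 < gp) (hgm : gm < 0) (hlp : 0 < lp) (hlm : 0 < lm) (hnu : 0 < nu)
  (* Gaussian law of u(0), ubar(0) and uhat(0); law of gamma(0); Gaussian law
     of gammahat(0) *)
  (m0 s0 : R) (law_g0 : probability (measurableTypeR R) R) (m1 s1 : R)
  (* SSM, for every value of the scale parameter *)
  (d1 : R -> measure_display) (Om1 : forall eps : R, measurableType (d1 eps))
  (P1 : forall eps : R, probability (Om1 eps) R)
  (B g u : forall eps : R, R -> Om1 eps -> R)
  (hSSM : forall eps : R, 0 < eps ->
     [/\ SSM (P1 eps) gp gm lp lm su eps (B eps) (g eps) (u eps),
         has_law (P1 eps) (u eps 0) (gaussian m0 s0),
         has_law (P1 eps) (g eps 0) law_g0
       & mutually_independent (P1 eps) (tnth [tuple sigma_rv (u eps 0);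
           sigma_path (g eps); sigma_path (B eps)])])
  (* MSM *)
  (d2 : measure_display) (Om2 : measurableType d2) (P2 : probability Om2 R)
  (Bbar ubar : R -> Om2 -> R)
  (hMSM : [/\ MSM P2 gbar su Bbar ubar,
         has_law P2 (ubar 0) (gaussian m0 s0)
       & mutually_independent P2
           (tnth [tuple sigma_rv (ubar 0); sigma_path Bbar])])
  (* DSM, for every value of the scale parameter *)
  (d3 : R -> measure_display) (Om3 : forall eps : R, measurableType (d3 eps))
  (P3 : forall eps : R, probability (Om3 eps) R)
  (Bu Bg ghat uhat : forall eps : R, R -> Om3 eps -> R)
  (hDSM : forall eps : R, 0 < eps ->
     [/\ DSM (P3 eps) nu mu sg su eps (Bu eps) (Bg eps) (ghat eps) (uhat eps),
         has_law (P3 eps) (uhat eps 0) (gaussian m0 s0),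
         has_law (P3 eps) (ghat eps 0) (gaussian m1 s1)
       & mutually_independent (P3 eps) (tnth [tuple sigma_rv (uhat eps 0);
           sigma_rv (ghat eps 0); sigma_path (Bu eps); sigma_path (Bg eps)])])
  (hgbar : gbar = (lm * gp + lp * gm) / (lm + lp))
  (hmu : mu = (lm * gp + lp * gm) / (lm + lp))
  (T : R) (hT : 0 < T) :
  [/\ 'E_(P1 eps)[u eps T] @[eps --> 0^'+] --> 'E_P2[ubar T],
      'V_(P1 eps)[u eps T] @[eps --> 0^'+] --> 'V_P2[ubar T],
      'E_(P3 eps)[uhat eps T] @[eps --> 0^'+] --> 'E_P2[ubar T]
    & 'V_(P3 eps)[uhat eps T] @[eps --> 0^'+] --> 'V_P2[ubar T]]%E.
Proof.
have gpm : gm < gp by exact: lt_trans hgp.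
have [hM lM iM] := hMSM.
have muE : mu = gbar by rewrite hmu hgbar.
have hBM := msm_noise hM.
have uM := mutually_independent_pair (i := @Ordinal 2 0 isT) (j := @Ordinal 2 1 isT) iM isT.
pose k := mean_propagator gbar T.
pose q := Rintegral P2 setT (fun w => ubar 0 w ^+ 2).
pose C := discretization_constant gbar su T q.
pose om n := (T / n.+1%:R) ^+ 2.
have sq_meas : measurable_fun setT (fun x : R => x ^+ 2) by exact: measurable_funX.
(* The second moment of the initial value is the same in all models and for every [eps], so [C] is a
   single constant fixed before the limit. *)
have qE d (Om : measurableType d) (P : probability Om R) (X : Om -> R) :
    has_law P X (gaussian m0 s0) -> Rintegral P setT (fun w => X w ^+ 2) = q.
  by move=> lX; apply: (ge0_Ex_same_law lX lM sq_meas) => x; exact: sqr_ge0.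
have C0 : 0 <= C.
  have q0 : 0 <= q by apply: Ex_ge0 => w; exact: sqr_ge0.
  have M0 : 0 <= 8 * expR 1 * T by rewrite mulr_ge0 ?ltW ?mulr_gt0 ?expR_gt0.
  have h1 := sqr_ge0 su; have h2 := sqr_ge0 (expR (`|gbar| * T) * `|gbar|).
  by rewrite /C /discretization_constant; do !(apply: addr_ge0 || apply: mulr_ge0 => //).
have om0 : om n @[n --> \oo] --> (0 : R).
  have := mesh_cvg 0 T; rewrite subr0 => c.
  rewrite /om -[X in _ --> X](mul0r (0 : R)); under eq_fun do rewrite expr2; exact: cvgM.
have H2 := constant_damping_approximation hT hM lM uM.
pose W1 e := discrete_solution su T k (B e) (u e 0).
pose W2 := discrete_solution su T k Bbar (ubar 0).
pose W3 e := discrete_solution su T k (Bu e) (uhat e 0).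
pose de1 e := expR ((`|gp| + `|gm|) * T) ^+ 2 * (3 * (gp - gm) ^+ 2 * T * (e / (lp + lm))).
pose de3 e := expR (`|gbar| * T) ^+ 2 *
  (2 * (damping_bound (nu / e) gbar (sg / Num.sqrt e) m1 s1 T - 1)).
have H1 (e : R) : 0 < e -> forall n,
  [/\ W1 e n \in Lfun (P1 e) 2%:E, (fun w => u e T w - W1 e n w) \in Lfun (P1 e) 2%:E &
    Rintegral (P1 e) setT (fun w => (u e T w - W1 e n w) ^+ 2) <= C * (de1 e + om n)].
  move=> e0 n; have [hS lS _ iS] := hSSM e e0; rewrite /C -(qE _ _ _ _ lS).
  exact: (switching_damping_approximation hT gpm hlp hlm e0 hS lS iS hgbar n).
have H3 (e : R) : 0 < e -> forall n,
  [/\ W3 e n \in Lfun (P3 e) 2%:E, (fun w => uhat e T w - W3 e n w) \in Lfun (P3 e) 2%:E &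
    Rintegral (P3 e) setT (fun w => (uhat e T w - W3 e n w) ^+ 2) <= C * (de3 e + om n)].
  move=> e0 n; have [[hBu hBg hd hu] lD lg iD] := hDSM e e0; rewrite /C -(qE _ _ _ _ lD).
  rewrite muE in hd.
  exact: (diffusive_damping_approximation hT (divr_gt0 hnu e0) hBu hBg hd hu lD lg iD n).
have M1 (e : R) : 0 < e -> forall n,
    Rintegral (P1 e) setT (W1 e n) = Rintegral P2 setT (W2 n) /\
    Rintegral (P1 e) setT (fun w => W1 e n w ^+ 2) = Rintegral P2 setT (fun w => W2 n w ^+ 2).
  move=> e0 n; have [[hB _ _] lS _ iS] := hSSM e e0.
  have uB := mutually_independent_pair (i := @Ordinal 3 0 isT) (j := @Ordinal 3 2 isT) iS isT.
  exact: (discrete_solution_same_moments k su (ltW hT) hB hBM lS lM uB uM n).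
have M3 (e : R) : 0 < e -> forall n,
    Rintegral (P3 e) setT (W3 e n) = Rintegral P2 setT (W2 n) /\
    Rintegral (P3 e) setT (fun w => W3 e n w ^+ 2) = Rintegral P2 setT (fun w => W2 n w ^+ 2).
  move=> e0 n; have [[hB _ _ _] lD _ iD] := hDSM e e0.
  have uB := mutually_independent_pair (i := @Ordinal 4 0 isT) (j := @Ordinal 4 2 isT) iD isT.
  exact: (discrete_solution_same_moments k su (ltW hT) hB hBM lD lM uB uM n).
have de10 : de1 e @[e --> 0^'+] --> (0 : R).
  apply: cvg_at_right_filter.
  rewrite -[X in _ --> X](mulr0 (expR ((`|gp| + `|gm|) * T) ^+ 2)).
  apply: cvgMl_tmp; rewrite -[X in _ --> X](mulr0 (3 * (gp - gm) ^+ 2 * T)).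
  apply: cvgMl_tmp; rewrite -[X in _ --> X](mul0r (lp + lm)^-1); apply: cvgMr_tmp; exact: cvg_id.
have de30 : de3 e @[e --> 0^'+] --> (0 : R).
  rewrite -[X in _ --> X](mulr0 (expR (`|gbar| * T) ^+ 2)).
  apply: cvgMl_tmp; rewrite -[X in _ --> X](mulr0 (2 : R)).
  apply: cvgMl_tmp; rewrite -[X in _ --> X](subrr (1 : R)).
  by apply: cvgB; [apply: damping_bound_cvg; rewrite gt_eqF|exact: cvg_cst].
have [E1 V1] := moments_cvg C0 H1 H2 M1 om0 de10.
have [E3 V3] := moments_cvg C0 H3 H2 M3 om0 de30.
by split.
Qed.
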